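(* Let $x>0$ be real and, for $0<q<1$, let $$\psi_q(x)=\frac{d}{dx}\log\Gamma_q(x)=-\log(1-q)+\log q\sum_{n=0}^\infty\frac{q^{n+x}}{1-q^{n+x}}.$$ Then, as $q\to1^-$ with $x$ fixed, the following two asymptotic expansions hold. (1) $$\psi_q(x)\sim\psi(x)+\log\!\left(\frac{\log q}{q-1}\right)-\sum_{k=1}^\infty\frac{\zeta(1-k)}{k!}B_k(x)(\log q)^k.$$ (2) $$\psi_q(x)\sim\psi(x)+\sum_{k=1}^\infty\frac{\zeta(1-k)}{k!}\left[1-B_k(x)\right](\log q)^k.$$ Here $\sim$ means: for every integer $N\ge0$, if the infinite sum is truncated to the terms with $k\le N$, the difference between the two sides is $O(|\log q|^{N+1})$ as $q\to1^-$.
   Context: $\Gamma_q(x)=(1-q)^{1-x}\prod_{n=0}^\infty\frac{1-q^{n+1}}{1-q^{n+x}}$ is Jackson's q-gamma function and $\psi_q$ is the q-digamma function. $\psi=\Gamma'/\Gamma$ is the digamma function. $B_k(x)$ are the Bernoulli polynomials, $\frac{te^{xt}}{e^t-1}=\sum_{n\ge0}\frac{B_n(x)}{n!}t^n$; $\zeta$ is the Riemann zeta function (analytically continued). *)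

(* Defs.v *)
From Stdlib Require Import Reals Factorial.
From Coquelicot Require Import Coquelicot.
Open Scope R_scope.

Definition Gamma (x : R) : R :=
  RInt_gen (fun t => Rpower t (x - 1) * exp (- t))
    (at_right 0) (Rbar_locally p_infty).

Definition digamma (x : R) : R := Derive Gamma x / Gamma x.

(* [prod_f_R0 f N] is the product of [f 0, ..., f N], both ends included. *)
Definition q_Gamma (q x : R) : R :=
  Rpower (1 - q) (1 - x) *
  real (Lim_seq (prod_f_R0
    (fun n => (1 - q ^ (n + 1)) / (1 - Rpower q (INR n + x))))).

Definition q_digamma (q x : R) : R :=
  Derive (fun y => ln (q_Gamma q y)) x.

Definition q_digamma_term (q x : R) (n : nat) : R :=
  Rpower q (INR n + x) / (1 - Rpower q (INR n + x)).

(* The generating function has a removable singularity at t = 0, so the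
   expansion is required on a punctured neighbourhood of 0; this already
   determines every [B n x]. *)
Definition is_bernoulli_polynomials (B : nat -> R -> R) : Prop :=
  forall x : R,
    locally' 0 (fun t =>
      is_pseries (fun n => B n x / INR (fact n)) t
        (t * exp (x * t) / (exp t - 1))).

Definition Cexp (z : C) : C :=
  (exp (Re z) * cos (Im z), exp (Re z) * sin (Im z)).

Definition analytic_at (f : C -> C) (z0 : C) : Prop :=
  exists a : nat -> C,
    locally z0 (fun z => is_pseries a (z - z0)%C (f z)).

(* The series is the sum over n >= 0 of (n+1)^(-s).  As C minus {1} is
   connected, the two conditions determine [zeta] except at s = 1, where its
   value is irrelevant. *)
Definition is_riemann_zeta (zeta : C -> C) : Prop :=
  (forall s : C, 1 < Re s ->
     is_series (fun n => Cexp (- s * RtoC (ln (INR (n + 1))))%C) (zeta s)) /\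
  (forall s : C, s <> RtoC 1 -> analytic_at zeta s).

(* f(q) ~ g(q) + sum_{k >= 1} c_k (log q)^k as q -> 1-, where f and g are
   real-valued and the coefficients are allowed to be complex because they
   involve values of the complex function zeta. *)
Definition asymp_log_q (f g : R -> R) (c : nat -> C) : Prop :=
  forall N : nat, exists M : R,
    at_left 1 (fun q =>
      Cmod (RtoC (f q) -
            (RtoC (g q) + sum_n_m (fun k => c k * RtoC (ln q) ^ k) 1 N))%C
      <= M * Rabs (ln q) ^ (N + 1)).

(* Main.v *)
Require Import Defs.
From Stdlib Require Import Reals Factorial Lra Lia Psatz Arith ClassicalEpsilon.
From Coquelicot Require Import Coquelicot.
Open Scope R_scope.

(** Write [q = e^-t], so that [ln q = -t], and let [b_k = B_k(0) / k!].

    Expanding the factors of the infinite product in powers of [q^x] and exchanging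
    the two summations ([lambert_swap]) turns [ln Gamma_q] into a power series in
    [q^x]; its derivative is the series for [psi_q], and both are Lambert series.
    The same exchange gives
    [psi_q(x) = - t * (sum of g(m t) over m >= 1)] with the kernel
    [g(v) = e^(-vx) / (1 - e^-v) - e^-v / v] ([q_digamma_lattice_sum]). The kernel
    is smooth up to [v = 0], where its Taylor coefficients are given by [B_k(x)],
    and it decays exponentially with all its derivatives. The Euler--Maclaurin
    formula ([euler_maclaurin]) therefore expands [psi_q(x)] in powers of [t], with
    coefficients [b_k (k-1)! (B_k(x) / k! - 1 / k!)]. In this formula the constants
    [b_k] enter only through the recurrence that makes them the Taylor coefficients
    of [t / (e^t - 1)]. What remains is to find the constant term and to recognize
    the values of zeta.

    The constant term is the limit of [psi_q(x)] as [q] tends to 1. Both functions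
    satisfy a one-step recurrence in [x] and come from log-convex functions, so each
    is squeezed, up to [O(1/n)], between elementary expressions at [x + n]: for
    [psi_q] termwise ([lambert_log_bounds]), for [psi] by integrating the weighted
    AM-GM inequality ([Gamma_log_convex]). The bounds for [Gamma] also show that it
    is differentiable, without differentiating under the integral. Letting [q] tend
    to 1 for fixed [n] gives the limit [psi(x)] ([q_digamma_limit]).

    The values of zeta come from Landau's formula,
    that the sum of [s (s+1) ... (s+j-1) / j! * (zeta(s+j) - 1)] over [j >= 1] is 1,
    which for real [s > 0] is the binomial expansion of [(n-1)^-s - n^-s] summed
    over [n >= 2]. Its tails are analytic, because power series with controlled
    sums of absolute values ([majorized]) may be summed termwise. An
    identity theorem along segments ([locally_zero_segment]) therefore carries the
    formula, around the pole, to real [s] just to the right of a non-positive integer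
    [-m]. In the limit [s = -m] it becomes a finite linear relation between
    [zeta(0), ..., zeta(1-m)] ([landau_at_neg]); these relations form a triangular
    system, which the Bernoulli numbers also solve ([zeta_neg_value]).

    This proves the second expansion. The first one differs from it by the power
    series of [ln (t / (1 - e^-t))], whose derivative is [1/t - 1/(e^t - 1)]
    ([ln_gen_pseries]). *)

(** * Sums and double series *)

(** The hierarchy of algebraic structures hides the carrier of an equation from
    [ring] and [field]; this restores it. *)
Ltac as_R_eq := match goal with |- @eq _ ?a ?b => change (@eq R a b) end.

Ltac as_Rplus := change (@plus R_AbelianMonoid) with Rplus.

Lemma Rabs_of_ball (x eps y : R) : ball x eps y -> Rabs (y - x) < eps.
Proof. exact (fun H => H). Qed.

Lemma ball_of_Rabs (x eps y : R) : Rabs (y - x) < eps -> ball x eps y.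
Proof. exact (fun H => H). Qed.

Lemma pow_unit_bounds (q : R) (n : nat) : 0 < q < 1 -> 0 < q ^ n <= 1.
Proof.
  intros Hq. split; [apply pow_lt; lra|]. rewrite <- (pow1 n). apply pow_incr. lra.
Qed.

Lemma exp_le (x y : R) : x <= y -> exp x <= exp y.
Proof. intros [H| ->]; [left; now apply exp_increasing | apply Rle_refl]. Qed.

Lemma mean_value (f df : R -> R) (a b : R) : a <= b ->
  (forall v, a <= v <= b -> is_derive f v (df v)) ->
  exists c, a <= c <= b /\ f b - f a = df c * (b - a).
Proof.
  intros Hab Hd. destruct (MVT_gen f a b df) as (c & Hc & E).
  - intros v Hv. rewrite Rmin_left, Rmax_right in Hv by lra. apply Hd. lra.
  - intros v Hv. rewrite Rmin_left, Rmax_right in Hv by lra.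
    apply continuity_pt_filterlim, (ex_derive_continuous f). eexists. now apply Hd.
  - rewrite Rmin_left, Rmax_right in Hc by lra. now exists c.
Qed.

Lemma is_lim_seq_inv_shift (x : R) : is_lim_seq (fun n => / (x + INR n)) 0.
Proof.
  replace (Finite 0) with (Rbar_inv p_infty) by reflexivity.
  apply is_lim_seq_inv; [|discriminate].
  eapply is_lim_seq_plus; [apply is_lim_seq_const | apply is_lim_seq_INR | reflexivity].
Qed.

Lemma sum_n_nonneg (a : nat -> R) (N : nat) : (forall k, 0 <= a k) -> 0 <= sum_n a N.
Proof.
  intros Ha. induction N as [|N IH]; [rewrite sum_O; apply Ha|].
  rewrite sum_Sn. as_Rplus. specialize (Ha (S N)). lra.
Qed.

Lemma term_le_of_sums (a : nat -> R) (M : R) (k : nat) :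
  (forall j, 0 <= a j) -> (forall N, sum_n a N <= M) -> a k <= M.
Proof.
  intros Ha HM. eapply Rle_trans; [|apply (HM k)].
  destruct k as [|k]; [rewrite sum_O; apply Rle_refl|].
  rewrite sum_Sn. as_Rplus. pose proof (sum_n_nonneg a k Ha). lra.
Qed.

Lemma sum_n_Rmult_l (c : R) (a : nat -> R) (N : nat) :
  sum_n (fun k => c * a k) N = c * sum_n a N.
Proof.
  induction N as [|N IH]; [now rewrite !sum_O|].
  rewrite !sum_Sn, IH. unfold plus; simpl. ring.
Qed.

Section NormSeries.
Context {K : AbsRing} {V : NormedModule K}.

Lemma is_lim_seq_norm (u : nat -> V) (l : V) :
  filterlim u eventually (locally l) ->
  is_lim_seq (fun n => norm (u n)) (norm l).
Proof.
  intros H. apply (filterlim_comp _ _ _ u norm eventually (locally l)).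
  - exact H.
  - apply filterlim_norm.
Qed.

Lemma is_series_zero : is_series (fun _ : nat => zero : V) zero.
Proof.
  apply (filterlim_ext (fun _ => zero : V)); [|apply filterlim_const].
  intros k. induction k as [|k IH]; [now rewrite sum_O|].
  rewrite sum_Sn, <- IH. symmetry. apply plus_zero_r.
Qed.

Lemma norm_is_series_le (a : nat -> V) (l : V) (M : R) :
  is_series a l -> (forall N, norm (sum_n a N) <= M) -> norm l <= M.
Proof.
  intros Ha HM.
  assert (H : is_lim_seq (fun N => norm (sum_n a N)) (norm l)).
  { apply is_lim_seq_norm, Ha. }
  apply (is_lim_seq_le (fun N => norm (sum_n a N)) (fun _ => M) (norm l) M);
    [exact HM | exact H | apply is_lim_seq_const].
Qed.

Lemma sum_n_le_Series (m : nat -> R) (N : nat) :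
  (forall n, 0 <= m n) -> ex_series m -> sum_n m N <= Series m.
Proof.
  intros Hm Hex.
  apply (is_lim_seq_incr_compare (sum_n m) (Series m)).
  - exact (Series_correct m Hex).
  - intros n. rewrite sum_Sn. unfold plus; simpl. specialize (Hm (S n)). lra.
Qed.

(** Dominated convergence for series: beyond a fixed index the tails are small
    uniformly in [k], and the finitely many remaining terms tend to zero. *)
Lemma tannery (e : nat -> nat -> V) (L : nat -> V) (m : nat -> R) :
  (forall k, is_series (e k) (L k)) ->
  (forall k n, norm (e k n) <= m n) -> ex_series m ->
  (forall n, is_lim_seq (fun k => norm (e k n)) 0) ->
  is_lim_seq (fun k => norm (L k)) 0.
Proof.
  intros HL Hm Hex He.
  assert (Hm0 : forall n, 0 <= m n).
  { intros n. apply Rle_trans with (norm (e 0%nat n)); [apply norm_ge_0 | apply Hm]. }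
  assert (Hfin : forall n0, is_lim_seq (fun k => sum_n (fun n => norm (e k n)) n0) 0).
  { induction n0 as [|n0 IH].
    - apply is_lim_seq_ext with (fun k => norm (e k 0%nat)); [|apply He].
      intros k. now rewrite sum_O.
    - apply is_lim_seq_ext with
        (fun k => sum_n (fun n => norm (e k n)) n0 + norm (e k (S n0))).
      + intros k. now rewrite sum_Sn.
      + replace (Finite 0) with (Finite (0 + 0)) by (f_equal; ring).
        apply is_lim_seq_plus'; [exact IH | apply He]. }
  apply is_lim_seq_spec. intros eps.
  assert (Heps2 : 0 < eps / 3) by (destruct eps as [eps Heps]; simpl; lra).
  destruct (Cauchy_ex_series m Hex (mkposreal _ Heps2)) as [n0 Hn0].
  simpl in Hn0.
  specialize (Hfin n0). apply is_lim_seq_spec in Hfin.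
  destruct (Hfin (mkposreal _ Heps2)) as [k0 Hk0]. simpl in Hk0.
  exists k0. intros k Hk. specialize (Hk0 k Hk).
  rewrite Rminus_0_r, Rabs_pos_eq in Hk0 |- *.
  - apply Rle_lt_trans with (eps / 3 + eps / 3);
      [|destruct eps as [eps Heps]; simpl; lra].
    apply (norm_is_series_le (e k)); [apply HL|].
    intros N.
    eapply Rle_trans; [apply norm_sum_n_m|].
    destruct (le_lt_dec N n0) as [HN|HN].
    + apply Rle_trans with (sum_n (fun n => norm (e k n)) n0); [|lra].
      unfold sum_n. clear - HN. induction HN; [apply Rle_refl|].
      rewrite sum_n_Sm by lia. unfold plus; simpl.
      pose proof (norm_ge_0 (e k (S m))). lra.
    + rewrite (sum_n_m_Chasles _ 0 n0 N) by lia. unfold plus; simpl.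
      apply Rplus_le_compat; [unfold sum_n in Hk0; lra|].
      eapply Rle_trans; [apply sum_n_m_le; intros n; apply (Hm k n)|].
      assert (Hn1 : (n0 <= S n0)%nat) by lia.
      assert (Hn2 : (n0 <= N)%nat) by lia.
      specialize (Hn0 (S n0) N Hn1 Hn2).
      unfold norm in Hn0; simpl in Hn0; unfold abs in Hn0; simpl in Hn0.
      apply Rabs_def2 in Hn0. apply Rlt_le, Hn0.
  - apply (sum_n_nonneg (fun n => norm (e k n))). intros n. apply norm_ge_0.
  - apply norm_ge_0.
Qed.

Lemma norm_term_le (a : nat -> V) (M : R) (k : nat) :
  (forall N, sum_n (fun k => norm (a k)) N <= M) -> norm (a k) <= M.
Proof.
  apply (term_le_of_sums (fun k => norm (a k))). intros j. apply norm_ge_0.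
Qed.

(** The partial row sums tend to the row sums and are dominated by [M], so
    [tannery] applies to the differences. The second conclusion makes the column
    sums absolutely summable again, so that the exchange can be iterated. *)
Lemma series_swap (a : nat -> nat -> V) (r c : nat -> V) (l : V) (M : nat -> R) :
  (forall n, is_series (a n) (r n)) -> (forall k, is_series (fun n => a n k) (c k)) ->
  is_series r l ->
  (forall n N, sum_n (fun k => norm (a n k)) N <= M n) -> ex_series M ->
  is_series c l /\ (forall N, sum_n (fun k => norm (c k)) N <= Series M).
Proof.
  intros Hr Hc Hl HM Hex.
  assert (Hpart : forall n N, norm (sum_n (a n) N) <= M n).
  { intros n N. eapply Rle_trans; [apply norm_sum_n_m | apply HM]. }
  assert (Hrn : forall n, norm (r n) <= M n).
  { intros n. apply (norm_is_series_le (a n)); [apply Hr | apply Hpart]. }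
  assert (Hsum : forall N, is_series (fun n => sum_n (a n) N) (sum_n c N)).
  { induction N as [|N IH].
    - rewrite sum_O. apply is_series_ext with (fun n => a n 0%nat); [|apply Hc].
      intros n; now rewrite sum_O.
    - rewrite sum_Sn.
      apply is_series_ext with (fun n => plus (sum_n (a n) N) (a n (S N))).
      + intros n; now rewrite sum_Sn.
      + apply is_series_plus; [exact IH | apply Hc]. }
  split.
  - assert (H : is_lim_seq (fun N => norm (plus (sum_n c N) (opp l))) 0).
    { apply (tannery (fun N n => plus (sum_n (a n) N) (opp (r n))) _
               (fun n => M n + M n)).
      - intros N. apply is_series_minus; [apply Hsum | exact Hl].
      - intros N n. eapply Rle_trans; [apply norm_triangle|].
        rewrite norm_opp. apply Rplus_le_compat; [apply Hpart | apply Hrn].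
      - apply (ex_series_plus M M); exact Hex.
      - intros n.
        replace (Finite 0) with (Finite (norm (plus (r n) (opp (r n))))).
        2:{ f_equal. rewrite <- (norm_zero (V := V)). f_equal.
          apply (plus_opp_r (G := NormedModule.AbelianGroup K V)). }
        apply is_lim_seq_norm.
        { apply (filterlim_comp_2 (G := locally (r n)) (H := locally (opp (r n)))).
          - apply Hr.
          - apply filterlim_const.
          - apply (filterlim_plus ). } }
    unfold is_series.
    apply (filterlim_ext (fun N => plus (plus (sum_n c N) (opp l)) l)).
    { intros N. rewrite <- plus_assoc.
      etransitivity; [apply f_equal, (plus_opp_l (G := NormedModule.AbelianGroup K V))|].
      apply plus_zero_r. }
    pattern l at 3. rewrite <- (plus_zero_l l).
    apply (filterlim_comp_2 (G := locally (zero : V)) (H := locally l)).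
    + apply (filterlim_norm_zero ). exact H.
    + apply filterlim_const.
    + apply (filterlim_plus ).
  - intros N.
    assert (Hn : forall P, is_lim_seq
        (fun n => sum_n (fun k => norm (sum_n (fun i => a i k) n)) P)
        (sum_n (fun k => norm (c k)) P)).
    { induction P as [|P IH].
      - rewrite sum_O. apply is_lim_seq_ext with
          (fun n => norm (sum_n (fun i => a i 0%nat) n)).
        + intros n; now rewrite sum_O.
        + apply is_lim_seq_norm, Hc.
      - rewrite sum_Sn. apply is_lim_seq_ext with
          (fun n => sum_n (fun k => norm (sum_n (fun i => a i k) n)) P
                    + norm (sum_n (fun i => a i (S P)) n)).
        + intros n; now rewrite sum_Sn.
        + apply is_lim_seq_plus'; [exact IH|].
          apply is_lim_seq_norm, Hc. }
    apply (is_lim_seq_le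
             (fun n => sum_n (fun k => norm (sum_n (fun i => a i k) n)) N)
             (fun _ => Series M)
             (sum_n (fun k => norm (c k)) N) (Series M));
      [|apply Hn | apply is_lim_seq_const].
    intros n.
    apply Rle_trans with (sum_n M n).
    + apply Rle_trans with (sum_n (fun k => sum_n (fun i => norm (a i k)) n) N).
      * apply sum_n_m_le. intros k. apply norm_sum_n_m.
      * rewrite sum_n_switch. apply sum_n_m_le. intros i. apply HM.
    + apply sum_n_le_Series; [|exact Hex].
      intros i. apply Rle_trans with (norm (r i)); [apply norm_ge_0 | apply Hrn].
Qed.

End NormSeries.

(** For nonnegative entries the row sums dominate their own partial sums. *)
Lemma series_swap_pos (a : nat -> nat -> R) (r : nat -> R) (l : R) :
  (forall n k, 0 <= a n k) ->
  (forall n, is_series (a n) (r n)) -> is_series r l ->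
  (forall k, is_series (fun n => a n k) (Series (fun n => a n k))) /\
  is_series (fun k => Series (fun n => a n k)) l.
Proof.
  intros Hpos Hr Hl.
  assert (HM : forall n N, sum_n (fun k => norm (a n k)) N <= r n).
  { intros n N. rewrite <- (is_series_unique _ _ (Hr n)).
    rewrite (sum_n_ext _ (a n)).
    - apply sum_n_le_Series; [apply Hpos | exists (r n); apply Hr].
    - intros k. apply Rabs_pos_eq, Hpos. }
  assert (Hex : ex_series r) by now exists l.
  assert (Hc : forall k, is_series (fun n => a n k) (Series (fun n => a n k))).
  { intros k. apply Series_correct, (ex_series_le (V := R_CompleteNormedModule) _ r); [|exact Hex].
    intros n. apply norm_term_le, HM. }
  split; [exact Hc|].
  apply (series_swap a r _ l r Hr Hc Hl HM Hex).
Qed.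

Lemma is_series_telescope (u : nat -> R) :
  is_lim_seq u 0 -> is_series (fun m => u m - u (S m)) (u 0%nat).
Proof.
  intros Hu.
  assert (H : is_lim_seq (fun N => u 0%nat - u (S N)) (u 0%nat)).
  { replace (Finite (u 0%nat)) with (Finite (u 0%nat - 0)) by (f_equal; ring).
    apply is_lim_seq_minus'; [apply is_lim_seq_const|].
    now apply is_lim_seq_incr_1 in Hu. }
  assert (E : forall N, u 0%nat - u (S N) = sum_n (fun m => u m - u (S m)) N).
  { induction N as [|N IH]; [now rewrite sum_O|].
    rewrite sum_Sn, <- IH. as_Rplus. ring. }
  exact (is_lim_seq_ext _ _ _ E H).
Qed.

(** * Power series with bounded coefficients *)

Lemma CV_radius_ge (a : nat -> R) (r M : R) :
  (forall n, Rabs (a n * r ^ n) <= M) -> Rbar_le r (CV_radius a).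
Proof.
  intros H. destruct (CV_radius_bounded a) as [Hub _].
  apply Hub. now exists M.
Qed.

Lemma CV_radius_gt (a : nat -> R) (M z : R) :
  (forall n, Rabs (a n) <= M) -> Rabs z < 1 -> Rbar_lt (Rabs z) (CV_radius a).
Proof.
  intros H Hz. apply Rbar_lt_le_trans with 1; [exact Hz|].
  apply CV_radius_ge with M. intros n. rewrite pow1, Rmult_1_r. apply H.
Qed.

Lemma ex_pseries_bounded (a : nat -> R) (M z : R) :
  (forall n, Rabs (a n) <= M) -> Rabs z < 1 -> ex_series (fun n => a n * z ^ n).
Proof.
  intros H Hz. apply ex_pseries_R, CV_disk_correct.
  apply CV_disk_inside. now apply CV_radius_gt with M.
Qed.

(** * The logarithmic series *)

Definition log_coef (n : nat) : R := match n with O => 0 | S m => / INR (S m) end.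

Lemma log_coef_bound n : Rabs (log_coef n) <= 1.
Proof.
  destruct n as [|n]; unfold log_coef; [rewrite Rabs_R0; lra|].
  rewrite Rabs_pos_eq.
  - rewrite <- Rinv_1. apply Rinv_le_contravar; [lra|]. apply (le_INR 1). lia.
  - left. apply Rinv_0_lt_compat, lt_0_INR. lia.
Qed.

Lemma PSeries_log (z : R) : 0 <= z < 1 -> PSeries log_coef z = - ln (1 - z).
Proof.
  intros [Hz0 Hz1].
  destruct (Req_dec z 0) as [->|Hz].
  { rewrite PSeries_0, Rminus_0_r, ln_1. simpl. ring. }
  assert (H : PSeries log_coef 0 + ln (1 - 0) = PSeries log_coef z + ln (1 - z)).
  { apply (eq_is_derive (fun u => PSeries log_coef u + ln (1 - u))); [|lra].
    intros u Hu.
    assert (Hu1 : Rabs u < 1) by (rewrite Rabs_pos_eq; lra).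
    assert (E : / (1 - u) + (-1) / (1 - u) = 0) by (field; lra).
    change (@zero _) with 0. rewrite <- E.
    apply (is_derive_plus (PSeries log_coef) (fun u => ln (1 - u))).
    - replace (/ (1 - u)) with (PSeries (PS_derive log_coef) u).
      + apply is_derive_PSeries, (CV_radius_gt _ 1); [apply log_coef_bound | exact Hu1].
      + rewrite <- (Series_geom u Hu1). apply Series_ext. intros n.
        unfold PS_derive, log_coef. rewrite Rinv_r; [ring|]. apply not_0_INR; lia.
    - auto_derive; [lra | field; lra]. }
  rewrite PSeries_0, Rminus_0_r, ln_1 in H. simpl in H. lra.
Qed.

Lemma is_series_log (z : R) :
  0 <= z < 1 -> is_series (fun m => / INR (S m) * z ^ S m) (- ln (1 - z)).
Proof.
  intros Hz. rewrite <- PSeries_log by exact Hz.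
  assert (Hex : ex_series (fun n => log_coef n * z ^ n)).
  { apply (ex_pseries_bounded _ 1); [apply log_coef_bound|].
    rewrite Rabs_pos_eq; lra. }
  unfold PSeries. rewrite Series_incr_1 by exact Hex.
  replace (log_coef 0 * z ^ 0 + Series (fun k => log_coef (S k) * z ^ S k))
    with (Series (fun k => log_coef (S k) * z ^ S k)) by (simpl; ring).
  apply Series_correct, (ex_series_incr_1 (fun n => log_coef n * z ^ n)), Hex.
Qed.

Lemma is_series_geom_1 (z : R) :
  0 <= z < 1 -> is_series (fun m => 1 * z ^ S m) (z / (1 - z)).
Proof.
  intros Hz.
  apply is_series_ext with (fun m => z * z ^ m); [intros n; simpl; ring|].
  apply (is_series_scal_l z (fun m => z ^ m)), is_series_geom.
  rewrite Rabs_pos_eq; lra.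
Qed.

(** * Lambert series *)

Lemma one_minus_pow_pos (q : R) n : 0 < q < 1 -> 0 < 1 - q ^ S n.
Proof.
  intros Hq. assert (q ^ S n < 1); [|lra].
  pose proof (pow_unit_bounds q n Hq). simpl. nra.
Qed.

Lemma one_minus_pow_ge (q : R) n : 0 < q < 1 -> / (1 - q ^ S n) <= / (1 - q).
Proof.
  intros Hq. apply Rinv_le_contravar; [lra|].
  pose proof (pow_unit_bounds q n Hq). simpl. nra.
Qed.

(** In the direction of [n] the sums are geometric, so the columns of the double
    series are summed explicitly. *)
Lemma lambert_swap (q z : R) (u : nat -> R) (s : R -> R) :
  0 < q < 1 -> 0 < z < 1 -> (forall m, 0 <= u m <= 1) ->
  (forall y, 0 <= y < 1 -> is_series (fun m => u m * y ^ S m) (s y)) ->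
  ex_series (fun m => u m / (1 - q ^ S m) * z ^ S m) /\
  is_series (fun n => s (q ^ n * z))
            (Series (fun m => u m / (1 - q ^ S m) * z ^ S m)).
Proof.
  intros Hq Hz Hu Hs.
  assert (Hex : ex_series (fun m => u m / (1 - q ^ S m) * z ^ S m)).
  { apply ex_series_ext with (fun m => (u m / (1 - q ^ S m) * z) * z ^ m);
      [intros n; simpl; ring|].
    apply (ex_pseries_bounded _ (/ (1 - q))); [|rewrite Rabs_pos_eq; lra].
    intros n. pose proof (one_minus_pow_pos q n Hq) as H1.
    pose proof (one_minus_pow_ge q n Hq) as H2.
    pose proof (Rinv_0_lt_compat _ H1) as H3.
    specialize (Hu n). unfold Rdiv.
    assert (0 <= u n * / (1 - q ^ S n) <= / (1 - q)).
    { split; [nra|]. apply Rle_trans with (1 * / (1 - q ^ S n)); nra. }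
    rewrite Rabs_pos_eq; nra. }
  split; [exact Hex|].
  assert (Hqz : forall n, 0 <= q ^ n * z < 1).
  { intros n. pose proof (pow_unit_bounds q n Hq). nra. }
  destruct (series_swap_pos (fun m n => u m * (q ^ n * z) ^ S m)
              (fun m => u m / (1 - q ^ S m) * z ^ S m)
              (Series (fun m => u m / (1 - q ^ S m) * z ^ S m))) as [_ H].
  - intros m n. apply Rmult_le_pos; [apply Hu | apply pow_le, Hqz].
  - intros m.
    apply is_series_ext with (fun n => (u m * z ^ S m) * (q ^ S m) ^ n).
    { intros n. change ((u m * z ^ S m) * (q ^ S m) ^ n = u m * (q ^ n * z) ^ S m).
      rewrite Rpow_mult_distr, <- !pow_mult, (Nat.mul_comm n). ring. }
    replace (u m / (1 - q ^ S m) * z ^ S m) with ((u m * z ^ S m) * / (1 - q ^ S m))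
      by (unfold Rdiv; ring).
    apply (is_series_scal_l (u m * z ^ S m) (fun n => (q ^ S m) ^ n)), is_series_geom.
    rewrite Rabs_pos_eq; [|apply pow_le; lra].
    pose proof (one_minus_pow_pos q m Hq). lra.
  - apply Series_correct, Hex.
  - eapply is_series_ext; [|exact H]. intros n. simpl.
    apply is_series_unique, Hs, Hqz.
Qed.

(** The power series [sum z^m / (m (1 - q^m))], which is minus the logarithm
    of the infinite product of the factors [1 - q^n z]. *)
Definition qlog_coef (q : R) (n : nat) : R :=
  match n with O => 0 | S m => / INR (S m) / (1 - q ^ S m) end.

Lemma qlog_coef_bound q n : 0 < q < 1 -> Rabs (qlog_coef q n) <= / (1 - q).
Proof.
  intros Hq. assert (0 < / (1 - q)) by (apply Rinv_0_lt_compat; lra).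
  destruct n as [|n]; unfold qlog_coef; [rewrite Rabs_R0; lra|].
  pose proof (log_coef_bound (S n)) as H1. unfold log_coef in H1.
  pose proof (one_minus_pow_pos q n Hq) as H2.
  pose proof (one_minus_pow_ge q n Hq) as H3.
  pose proof (Rinv_0_lt_compat _ H2) as H4.
  unfold Rdiv. rewrite Rabs_mult, (Rabs_pos_eq (/ (1 - q ^ S n))) by lra.
  apply Rle_trans with (1 * / (1 - q ^ S n)); [|lra].
  apply Rmult_le_compat_r; [lra | exact H1].
Qed.

Lemma is_series_qlog (q z : R) : 0 < q < 1 -> 0 < z < 1 ->
  is_series (fun n => - ln (1 - q ^ n * z)) (PSeries (qlog_coef q) z).
Proof.
  intros Hq Hz.
  destruct (lambert_swap q z (fun m => / INR (S m)) (fun y => - ln (1 - y)) Hq Hz)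
    as [Hex H].
  - intros m. split.
    + left; apply Rinv_0_lt_compat, lt_0_INR; lia.
    + eapply Rle_trans; [apply Rle_abs | apply (log_coef_bound (S m))].
  - apply is_series_log.
  - replace (PSeries (qlog_coef q) z) with
      (Series (fun m => / INR (S m) / (1 - q ^ S m) * z ^ S m)); [exact H|].
    unfold PSeries. rewrite (Series_incr_1_aux (fun k => qlog_coef q k * z ^ k))
      by (simpl; ring).
    reflexivity.
Qed.

Lemma is_series_lambert (q z : R) : 0 < q < 1 -> 0 < z < 1 ->
  ex_series (fun m => 1 / (1 - q ^ S m) * z ^ S m) /\
  is_series (fun n => q ^ n * z / (1 - q ^ n * z))
            (Series (fun m => 1 / (1 - q ^ S m) * z ^ S m)).
Proof.
  intros Hq Hz. apply (lambert_swap q z (fun _ => 1) (fun y => y / (1 - y)) Hq Hz).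
  - intros _; lra.
  - apply is_series_geom_1.
Qed.

Lemma is_derive_qlog (q z : R) : 0 < q < 1 -> 0 < z < 1 ->
  is_derive (PSeries (qlog_coef q)) z
    (Series (fun m => 1 / (1 - q ^ S m) * z ^ S m) / z).
Proof.
  intros Hq Hz.
  replace (Series (fun m => 1 / (1 - q ^ S m) * z ^ S m) / z)
    with (PSeries (PS_derive (qlog_coef q)) z).
  - apply is_derive_PSeries, (CV_radius_gt _ (/ (1 - q)));
      [intros n; now apply qlog_coef_bound | rewrite Rabs_pos_eq; lra].
  - unfold Rdiv. rewrite <- Series_scal_r. apply Series_ext. intros n.
    unfold PS_derive, qlog_coef. pose proof (one_minus_pow_pos q n Hq).
    assert (INR (S n) <> 0) by (apply not_0_INR; lia).
    simpl pow in *. field. repeat split; lra.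
Qed.

(** * The q-gamma function *)

Lemma Rpower_lt_1 (q y : R) : 0 < q < 1 -> 0 < y -> 0 < Rpower q y < 1.
Proof.
  intros Hq Hy. split; [apply exp_pos|].
  unfold Rpower. rewrite <- exp_0. apply exp_increasing.
  assert (ln q < 0) by (rewrite <- ln_1; apply ln_increasing; lra). nra.
Qed.

Lemma Rpower_shift (q y : R) n : 0 < q -> Rpower q (INR n + y) = q ^ n * Rpower q y.
Proof. intros Hq. now rewrite Rpower_plus, Rpower_pow. Qed.

Lemma ln_prod_f_R0 (f : nat -> R) (N : nat) :
  (forall n, 0 < f n) -> prod_f_R0 f N = exp (sum_n (fun n => ln (f n)) N).
Proof.
  intros Hf. induction N as [|N IH].
  - rewrite sum_O. simpl. now rewrite exp_ln.
  - rewrite sum_Sn. unfold plus; simpl. rewrite exp_plus, exp_ln, IH; [reflexivity | apply Hf].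
Qed.

(** The finite products are exponentials of finite sums, so their limit is the
    exponential of a difference of two series. *)
Lemma ln_q_Gamma (q y : R) : 0 < q < 1 -> 0 < y ->
  ln (q_Gamma q y) = (1 - y) * ln (1 - q)
     + (PSeries (qlog_coef q) (Rpower q y) - PSeries (qlog_coef q) q).
Proof.
  intros Hq Hy. unfold q_Gamma.
  pose proof (Rpower_lt_1 q y Hq Hy) as Hz.
  assert (Hqn := fun n => pow_unit_bounds q n Hq).
  set (l := PSeries (qlog_coef q) (Rpower q y) - PSeries (qlog_coef q) q).
  assert (Hl : is_lim_seq (prod_f_R0
      (fun n => (1 - q ^ (n + 1)) / (1 - Rpower q (INR n + y)))) (exp l)).
  { apply is_lim_seq_ext with
      (fun N => exp (sum_n (fun n => - ln (1 - q ^ n * Rpower q y) + - - ln (1 - q ^ n * q)) N)).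
    - intros N. rewrite ln_prod_f_R0.
      + f_equal. apply sum_n_ext. intros n.
        rewrite Rpower_shift by lra.
        replace (q ^ (n + 1)) with (q ^ n * q) by (rewrite pow_add; simpl; ring).
        specialize (Hqn n). rewrite ln_div by nra.
        as_R_eq. ring.
      + intros n. rewrite Rpower_shift by lra.
        replace (q ^ (n + 1)) with (q ^ n * q) by (rewrite pow_add; simpl; ring).
        specialize (Hqn n). apply Rdiv_lt_0_compat; nra.
    - apply (is_lim_seq_continuous exp).
      + apply derivable_continuous_pt, derivable_pt_exp.
      + apply (is_series_minus (fun n => - ln (1 - q ^ n * Rpower q y))
                 (fun n => - ln (1 - q ^ n * q))); apply is_series_qlog; auto. }
  rewrite (is_lim_seq_unique _ _ Hl). simpl real.
  rewrite ln_mult; [|apply exp_pos | apply exp_pos].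
  unfold Rpower at 1. now rewrite !ln_exp.
Qed.

Lemma is_series_q_digamma_term (q x : R) : 0 < q < 1 -> 0 < x ->
  is_series (q_digamma_term q x)
    (Series (fun m => 1 / (1 - q ^ S m) * Rpower q x ^ S m)).
Proof.
  intros Hq Hx.
  destruct (is_series_lambert q (Rpower q x) Hq (Rpower_lt_1 q x Hq Hx)) as [_ H].
  eapply is_series_ext; [|exact H]. intros n. unfold q_digamma_term.
  now rewrite Rpower_shift by lra.
Qed.

(** After [ln_q_Gamma] this is the chain rule for a power series evaluated at
    [q^y]. *)
Lemma is_derive_ln_q_Gamma (q x : R) : 0 < q < 1 -> 0 < x ->
  is_derive (fun y => ln (q_Gamma q y)) x
    (- ln (1 - q) + ln q * Series (q_digamma_term q x)).
Proof.
  intros Hq Hx.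
  pose proof (Rpower_lt_1 q x Hq Hx) as Hz.
  apply is_derive_ext_loc with (fun y => (1 - y) * ln (1 - q)
     + (PSeries (qlog_coef q) (Rpower q y) - PSeries (qlog_coef q) q)).
  { exists (mkposreal x Hx). intros y Hy. symmetry. apply ln_q_Gamma; [exact Hq|].
    apply Rabs_of_ball in Hy. simpl in Hy. apply Rabs_def2 in Hy. lra. }
  rewrite (is_series_unique _ _ (is_series_q_digamma_term q x Hq Hx)).
  set (L := Series _).
  replace (- ln (1 - q) + ln q * L) with
    (- ln (1 - q) + (Rpower q x * ln q) * (L / Rpower q x)) by (field; lra).
  apply (is_derive_plus (fun y => (1 - y) * ln (1 - q))).
  - auto_derive; [trivial | ring].
  - replace (Rpower q x * ln q * (L / Rpower q x)) with
      (minus (scal (Rpower q x * ln q) (L / Rpower q x)) zero)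
      by (unfold minus, scal, zero, plus, opp; simpl; unfold mult; simpl; ring).
    apply (is_derive_minus (fun y => PSeries (qlog_coef q) (Rpower q y))
             (fun _ => PSeries (qlog_coef q) q)).
    + apply (is_derive_comp (PSeries (qlog_coef q)) (fun y => Rpower q y)).
      * now apply is_derive_qlog.
      * unfold Rpower. auto_derive; [trivial | ring].
    + apply (is_derive_const (PSeries (qlog_coef q) q)).
Qed.

Lemma q_digamma_eq (q x : R) : 0 < q < 1 -> 0 < x ->
  q_digamma q x = - ln (1 - q) + ln q * Series (q_digamma_term q x).
Proof. intros Hq Hx. apply is_derive_unique. now apply is_derive_ln_q_Gamma. Qed.

(** * The q-digamma function as q tends to 1 *)

Lemma ex_series_Rmult_l (c : R) (a : nat -> R) :
  ex_series a -> ex_series (fun n => c * a n).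
Proof. exact (ex_series_scal_l (K := R_AbsRing) (V := R_NormedModule) c a). Qed.

Lemma ln_le_sub_1 (u : R) : 0 < u -> ln u <= u - 1.
Proof.
  intros Hu. pose proof (exp_ineq1_le (ln u)) as H. rewrite exp_ln in H by exact Hu. lra.
Qed.

Lemma ln_ge_1_sub_inv (u : R) : 0 < u -> 1 - / u <= ln u.
Proof.
  intros Hu. pose proof (ln_le_sub_1 (/ u) (Rinv_0_lt_compat _ Hu)) as H.
  rewrite ln_Rinv in H by exact Hu. lra.
Qed.

Lemma is_lim_seq_geom_scal (q z : R) : 0 < q < 1 -> is_lim_seq (fun n => q ^ n * z) 0.
Proof.
  intros Hq. replace (Finite 0) with (Finite (0 * z)) by (f_equal; ring).
  apply is_lim_seq_mult'; [|apply is_lim_seq_const].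
  apply is_lim_seq_geom. rewrite Rabs_pos_eq; lra.
Qed.

Lemma is_series_log_telescope (q z : R) : 0 < q < 1 -> 0 < z < 1 ->
  is_series (fun n => ln ((1 - q ^ S n * z) / (1 - q ^ n * z))) (- ln (1 - z)).
Proof.
  intros Hq Hz.
  assert (Hqn := fun n => pow_unit_bounds q n Hq).
  set (u := fun n => - ln (1 - q ^ n * z)).
  assert (Hu : is_lim_seq u 0).
  { replace (Finite 0) with (Finite (- ln (1 - 0))) by (f_equal; rewrite Rminus_0_r, ln_1; ring).
    apply (is_lim_seq_opp _ (ln (1 - 0))), (is_lim_seq_continuous ln).
    - apply derivable_continuous_pt. exists (/ (1 - 0)). apply derivable_pt_lim_ln. lra.
    - apply is_lim_seq_minus'; [apply is_lim_seq_const | now apply is_lim_seq_geom_scal]. }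
  replace (- ln (1 - z)) with (u 0%nat) by (unfold u; now rewrite pow_O, Rmult_1_l).
  eapply is_series_ext; [|apply is_series_telescope, Hu].
  intros n. unfold u. pose proof (Hqn n). pose proof (Hqn (S n)).
  rewrite ln_div by nra. as_R_eq. ring.
Qed.

(** The increment of [ln Gamma_q] from [y] to [y + 1] lies between its
    derivatives at these points, where [z = q^y]. It is proved termwise from the
    bounds [1 - 1/R] and [R - 1] for [ln R], where [R] is the ratio of
    consecutive factors. *)
Lemma lambert_log_bounds (q z : R) : 0 < q < 1 -> 0 < z < 1 ->
  let L := Series (fun n => q ^ n * z / (1 - q ^ n * z)) in
  - ln (1 - z) <= - ln q * L <= - ln (1 - z) + - ln q * (z / (1 - z)).
Proof.
  intros Hq Hz L.
  assert (Hqn := fun n => pow_unit_bounds q n Hq).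
  assert (Hex : ex_series (fun n => q ^ n * z / (1 - q ^ n * z))).
  { eexists. now apply is_series_lambert. }
  assert (Hlq : ln q < 0) by (rewrite <- ln_1; apply ln_increasing; lra).
  assert (Hq1 : 1 - q <= - ln q) by (pose proof (ln_le_sub_1 q); lra).
  assert (Hq2 : - ln q <= / q - 1) by (pose proof (ln_ge_1_sub_inv q); lra).
  pose proof (is_series_log_telescope q z Hq Hz) as Ht.
  assert (Hterm : forall n,
    - ln q * (q ^ S n * z / (1 - q ^ S n * z))
      <= ln ((1 - q ^ S n * z) / (1 - q ^ n * z))
      <= - ln q * (q ^ n * z / (1 - q ^ n * z))).
  { intros n. simpl pow. pose proof (Hqn n) as Hn. set (w := q ^ n * z).
    assert (Hw : 0 < w < 1) by (unfold w; nra).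
    replace (q * q ^ n * z) with (q * w) by (unfold w; ring).
    assert (Hqw : 0 < q * w < 1) by nra.
    assert (HR : 0 < (1 - q * w) / (1 - w)) by (apply Rdiv_lt_0_compat; lra).
    split.
    - eapply Rle_trans; [|apply ln_ge_1_sub_inv, HR].
      replace (1 - / ((1 - q * w) / (1 - w))) with ((/ q - 1) * (q * w / (1 - q * w)))
        by (field; lra).
      apply Rmult_le_compat_r; [left; apply Rdiv_lt_0_compat; lra | exact Hq2].
    - eapply Rle_trans; [apply ln_le_sub_1, HR|].
      replace ((1 - q * w) / (1 - w) - 1) with ((1 - q) * (w / (1 - w)))
        by (field; lra).
      apply Rmult_le_compat_r; [left; apply Rdiv_lt_0_compat; lra | exact Hq1]. }
  assert (Hpos : forall n, 0 <= - ln q * (q ^ n * z / (1 - q ^ n * z))).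
  { intros n. pose proof (Hqn n). apply Rmult_le_pos; [lra|].
    left; apply Rdiv_lt_0_compat; nra. }
  split.
  - rewrite <- (is_series_unique _ _ Ht). unfold L. rewrite <- Series_scal_l.
    apply Series_le; [|apply ex_series_Rmult_l, Hex].
    intros n. split; [|apply Hterm].
    eapply Rle_trans; [apply (Hpos (S n)) | apply Hterm].
  - unfold L. rewrite Series_incr_1 by exact Hex.
    rewrite Rmult_plus_distr_l, pow_O, Rmult_1_l, Rplus_comm.
    apply Rplus_le_compat_r.
    rewrite <- (is_series_unique _ _ Ht), <- Series_scal_l.
    apply Series_le; [|eexists; exact Ht].
    intros n. split; [apply (Hpos (S n)) | apply Hterm].
Qed.

Lemma is_lim_one_minus_exp (y : R) :
  is_lim (fun t => (1 - exp (- (t * y))) / t) 0 y.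
Proof.
  assert (H : is_derive (fun t => - exp (- (t * y))) 0 y).
  { auto_derive; [trivial|]. rewrite Rmult_0_l, Ropp_0, exp_0. ring. }
  apply is_derive_Reals in H.
  apply is_lim_spec. intros eps.
  destruct (H eps (cond_pos eps)) as [d Hd]. exists d.
  intros t Ht Ht0.
  specialize (Hd t Ht0). rewrite Rplus_0_l, Rmult_0_l, Ropp_0, exp_0 in Hd.
  replace ((1 - exp (- (t * y))) / t) with ((- exp (- (t * y)) - - (1)) / t)
    by (field; exact Ht0).
  apply Hd. apply Rabs_of_ball in Ht. now rewrite Rminus_0_r in Ht.
Qed.

Lemma is_lim_div_R (f g : R -> R) (x : Rbar) (lf lg : R) :
  is_lim f x lf -> is_lim g x lg -> lg <> 0 ->
  is_lim (fun y => f y / g y) x (lf / lg).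
Proof.
  intros Hf Hg Hlg.
  apply (is_lim_div f g x lf lg); [exact Hf | exact Hg | | exact I].
  intros H. apply Hlg. now injection H.
Qed.

(** By the recurrence, [psi_q(x)] is [psi_q(x + n + 1)] minus [n + 1] explicit
    terms, and [lambert_log_bounds] replaces the former by a logarithm. *)
Lemma q_digamma_approx (x : R) (n : nat) : 0 < x ->
  exists f : R -> R,
    is_lim f 0 (ln (x + INR (S n)) - sum_n (fun k => / (x + INR k)) n) /\
    forall t, 0 < t -> Rabs (q_digamma (exp (- t)) x - f t) <= / (x + INR (S n)).
Proof.
  intros Hx.
  assert (Hxk : forall k, 0 < x + INR k) by (intros k; pose proof (pos_INR k); lra).
  set (E := fun y t => (1 - exp (- (t * y))) / t).
  exists (fun t => ln (E (x + INR (S n)) t / E 1 t)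
            - sum_n (fun k => exp (- (t * (x + INR k))) / E (x + INR k) t) n).
  split.
  - apply (is_lim_minus' _ _ 0 (ln (x + INR (S n)))).
    + replace (ln (x + INR (S n))) with (ln ((x + INR (S n)) / 1)) by (f_equal; field).
      apply (is_lim_comp_continuous (fun t => E (x + INR (S n)) t / E 1 t) ln 0 ((x + INR (S n)) / 1)).
      * apply (is_lim_div_R _ _ 0 (x + INR (S n)) 1);
          [apply is_lim_one_minus_exp | apply is_lim_one_minus_exp | lra].
      * apply (ex_derive_continuous ln). auto_derive. specialize (Hxk (S n)). lra.
    + assert (Hone : forall k, is_lim
          (fun t => exp (- (t * (x + INR k))) / E (x + INR k) t) 0 (/ (x + INR k))).
      { intros k. replace (/ (x + INR k)) with (1 / (x + INR k))
          by (field; specialize (Hxk k); lra).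
        apply (is_lim_div_R _ _ 0 1 (x + INR k));
          [|apply is_lim_one_minus_exp | specialize (Hxk k); lra].
        evar_last; [apply is_lim_continuity|].
        - apply derivable_continuous_pt, ex_derive_Reals_0. auto_derive. trivial.
        - cbv beta. now rewrite Rmult_0_l, Ropp_0, exp_0. }
      induction n as [|n IH].
      * rewrite sum_O. eapply is_lim_ext; [|apply (Hone 0%nat)].
        intros t; now rewrite sum_O.
      * rewrite sum_Sn. eapply is_lim_ext; [intros t; symmetry; apply sum_Sn|].
        apply (is_lim_plus' _ _ 0 (sum_n (fun k => / (x + INR k)) n) (/ (x + INR (S n))));
          [exact IH | apply Hone].
  - intros t Ht. set (q := exp (- t)). set (y := x + INR (S n)).
    assert (Hq : 0 < q < 1).
    { split; [apply exp_pos|]. unfold q. rewrite <- exp_0. apply exp_increasing. lra. }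
    assert (Hlq : ln q = - t) by apply ln_exp.
    assert (Hpw : forall u, exp (- (t * u)) = Rpower q u).
    { intros u. unfold Rpower. rewrite Hlq. f_equal. ring. }
    assert (Hy : 0 < y) by apply Hxk.
    pose proof (Rpower_lt_1 q y Hq Hy) as Hz.
    rewrite q_digamma_eq by assumption.
    assert (Hex : ex_series (q_digamma_term q x)).
    { eexists. now apply is_series_q_digamma_term. }
    rewrite (Series_incr_n _ (S n)) by (lia || exact Hex). simpl Init.Nat.pred.
    rewrite (Series_ext _ (fun k => q ^ k * Rpower q y / (1 - q ^ k * Rpower q y))).
    2:{ intros k. unfold q_digamma_term. rewrite plus_INR.
        replace (INR (S n) + INR k + x) with (INR k + y) by (unfold y; ring).
        now rewrite Rpower_shift by lra. }
    destruct (lambert_log_bounds q (Rpower q y) Hq Hz) as [H1 H2].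
    set (L := Series _) in *.
    rewrite <- sum_n_Reals.
    rewrite (sum_n_ext (fun k => exp (- (t * (x + INR k))) / E (x + INR k) t)
               (fun k => t * q_digamma_term q x k)).
    2:{ intros k. unfold E, q_digamma_term. rewrite Hpw, (Rplus_comm (INR k)).
        pose proof (Rpower_lt_1 q (x + INR k) Hq (Hxk k)).
        as_R_eq. field. lra. }
    rewrite sum_n_Rmult_l.
    unfold E at 1 2. rewrite !Hpw, Rpower_1 by lra.
    fold y. replace ((1 - Rpower q y) / t / ((1 - q) / t))
      with ((1 - Rpower q y) / (1 - q)) by (field; lra).
    rewrite ln_div by lra. rewrite Hlq in *.
    set (s := sum_n (q_digamma_term q x) n).
    assert (Hbd : t * (Rpower q y / (1 - Rpower q y)) <= / y).
    { assert (He : Rpower q y * (1 + t * y) <= 1).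
      { rewrite <- Hpw. pose proof (exp_ineq1_le (t * y)) as He.
        apply Rle_trans with (exp (- (t * y)) * exp (t * y)).
        2:{ rewrite <- exp_plus, Rplus_opp_l, exp_0. lra. }
        apply Rmult_le_compat_l; [left; apply exp_pos | exact He]. }
      apply Rmult_le_reg_r with (y * (1 - Rpower q y)); [nra|].
      field_simplify; [nra | lra | lra]. }
    apply Rabs_le. split; nra || lra.
Qed.

(** * The digamma function as a limit of partial sums *)

Definition zero_to_infinity : (R * R -> Prop) -> Prop :=
  filter_prod (at_right 0) (Rbar_locally p_infty).

Lemma zero_to_infinity_intro (P : R * R -> Prop) (a0 b0 : R) :
  0 < a0 -> (forall a b, 0 < a < a0 -> b0 < b -> P (a, b)) -> zero_to_infinity P.
Proof.
  intros Ha0 H.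
  apply (Filter_prod _ _ _ (fun a => 0 < a < a0) (fun b => b0 < b)).
  - exists (mkposreal a0 Ha0). intros a Ha Ha1. split; [exact Ha1|].
    apply Rabs_of_ball in Ha. simpl in Ha. apply Rabs_def2 in Ha. lra.
  - now exists b0.
  - exact H.
Qed.

Lemma is_RInt_gen_le (f g : R -> R) (lf lg : R) :
  (forall t, 0 < t -> 0 <= f t <= g t) ->
  is_RInt_gen f (at_right 0) (Rbar_locally p_infty) lf ->
  is_RInt_gen g (at_right 0) (Rbar_locally p_infty) lg -> lf <= lg.
Proof.
  intros Hfg Hf Hg. eapply Rle_trans; [apply Rle_abs|].
  apply (RInt_gen_norm (Fa := at_right 0) (Fb := Rbar_locally p_infty)
           (V := R_CompleteNormedModule) f g lf lg); [| |exact Hf|exact Hg].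
  - apply (zero_to_infinity_intro _ 1 1); [lra|]. intros a b Ha Hb. simpl. lra.
  - apply (zero_to_infinity_intro _ 1 1); [lra|]. intros a b Ha Hb t Ht. simpl in Ht.
    destruct (Hfg t) as [H1 H2]; [lra|].
    unfold norm; simpl. unfold abs; simpl. now rewrite Rabs_pos_eq.
Qed.

Lemma ex_RInt_pos (f : R -> R) (a b : R) :
  (forall t, 0 < t -> continuous f t) -> 0 < a <= b -> ex_RInt f a b.
Proof.
  intros Hc Hab. apply (ex_RInt_continuous (V := R_CompleteNormedModule)).
  intros t Ht. apply Hc. rewrite Rmin_left in Ht by lra. lra.
Qed.

(** The integrals increase with the interval, so they converge to their
    supremum. *)
Lemma is_RInt_gen_bounded (f : R -> R) (M : R) :
  (forall t, 0 < t -> continuous f t) -> (forall t, 0 < t -> 0 <= f t) ->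
  (forall a b, 0 < a <= b -> RInt f a b <= M) ->
  exists l, is_RInt_gen f (at_right 0) (Rbar_locally p_infty) l /\
            forall a b, 0 < a <= b -> RInt f a b <= l.
Proof.
  intros Hc Hpos HM.
  destruct (completeness (fun y => exists a b, 0 < a <= b /\ y = RInt f a b)) as [l Hl].
  - exists M. intros y (a & b & Hab & ->). now apply HM.
  - exists (RInt f 1 1), 1, 1. split; [lra | reflexivity].
  - destruct Hl as [Hub Hlub].
    assert (Hle : forall a b, 0 < a <= b -> RInt f a b <= l).
    { intros a b Hab. apply Hub. now exists a, b. }
    exists l. split; [|exact Hle].
    intros P [eps HP]. unfold filtermapi.
    assert (Hex : exists a0 b0, 0 < a0 <= b0 /\ l - eps < RInt f a0 b0).
    { apply NNPP. intros Hn. assert (l <= l - eps); [|destruct eps; simpl in *; lra].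
      apply Hlub. intros y (a & b & Hab & ->). apply Rnot_lt_le. intros Hlt.
      apply Hn. now exists a, b. }
    destruct Hex as (a0 & b0 & Hab0 & Hl0).
    apply (zero_to_infinity_intro _ a0 b0); [lra|].
    intros a b Ha Hb. simpl. exists (RInt f a b).
    assert (Hi : ex_RInt f a b) by (apply ex_RInt_pos; [exact Hc | lra]).
    split; [apply (RInt_correct (V := R_CompleteNormedModule)), Hi|].
    apply HP.
    assert (H1 : RInt f a0 b0 <= RInt f a b).
    { rewrite <- (RInt_Chasles f a a0 b), <- (RInt_Chasles f a0 b0 b);
        try (apply ex_RInt_pos; [exact Hc | lra]).
      assert (0 <= RInt f a a0) by
        (apply RInt_ge_0; [lra | apply ex_RInt_pos; [exact Hc | lra] | intros; apply Hpos; lra]).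
      assert (0 <= RInt f b0 b) by
        (apply RInt_ge_0; [lra | apply ex_RInt_pos; [exact Hc | lra] | intros; apply Hpos; lra]).
      unfold plus; simpl. lra. }
    assert (H2 : RInt f a b <= l) by (apply Hle; lra).
    apply ball_of_Rabs.
    apply Rabs_def1; destruct eps; simpl in *; lra.
Qed.

Definition Gamma_integrand (x t : R) : R := Rpower t (x - 1) * exp (- t).

Lemma Gamma_integrand_pos x t : 0 < Gamma_integrand x t.
Proof. apply Rmult_lt_0_compat; apply exp_pos. Qed.

Lemma continuous_Gamma_integrand x t : 0 < t -> continuous (Gamma_integrand x) t.
Proof.
  intros Ht. apply (ex_derive_continuous (Gamma_integrand x)).
  unfold Gamma_integrand, Rpower. auto_derive. exact Ht.
Qed.

(** The maximum of [e^-t (1 + t)^(x + 1)] over [t]. *)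
Definition exp_pow_bound (x : R) : R := exp (- x + (x + 1) * ln (x + 1)).

Lemma exp_neg_le (x t : R) : 0 < x -> 0 < t ->
  exp (- t) <= exp_pow_bound x * exp (- ((x + 1) * ln (1 + t))).
Proof.
  intros Hx Ht. unfold exp_pow_bound. rewrite <- exp_plus.
  apply exp_le.
  pose proof (ln_le_sub_1 ((1 + t) / (x + 1))) as H.
  assert (Hd : 0 < (1 + t) / (x + 1)) by (apply Rdiv_lt_0_compat; lra).
  specialize (H Hd). rewrite ln_div in H by lra.
  apply (Rmult_le_compat_l (x + 1)) in H; [|lra].
  replace ((x + 1) * ((1 + t) / (x + 1) - 1)) with (t - x) in H by (field; lra).
  lra.
Qed.

(** The bounded function [(t / (1 + t))^x / x] has the derivative [t^(x-1)
    (1+t)^(-x-1)], which dominates the Gamma integrand up to a constant. *)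
Lemma RInt_Gamma_integrand_le (x a b : R) : 0 < x -> 0 < a <= b ->
  RInt (Gamma_integrand x) a b <= exp_pow_bound x / x.
Proof.
  intros Hx Hab.
  set (K := exp_pow_bound x).
  assert (HK : 0 < K) by apply exp_pos.
  set (H := fun t => K / x * exp (x * (ln t - ln (1 + t)))).
  set (h := fun t => K * exp (x * (ln t - ln (1 + t))) * (/ t - / (1 + t))).
  assert (HI : is_RInt h a b (H b - H a)).
  { apply (is_RInt_derive H h).
    - intros t Ht. rewrite Rmin_left, Rmax_right in Ht by lra. unfold H, h.
      auto_derive; [lra|]. unfold Rminus. field. lra.
    - intros t Ht. rewrite Rmin_left, Rmax_right in Ht by lra.
      apply (ex_derive_continuous h). unfold h. auto_derive. lra. }
  apply Rle_trans with (RInt h a b).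
  - apply RInt_le; [lra| | |].
    + apply ex_RInt_pos; [|exact Hab]. intros t Ht. now apply continuous_Gamma_integrand.
    + eexists; exact HI.
    + intros t Ht. unfold Gamma_integrand, h, Rpower.
      replace (/ t - / (1 + t)) with (exp (- ln t) * exp (- ln (1 + t))).
      2:{ rewrite !exp_Ropp, !exp_ln by lra. field. lra. }
      eapply Rle_trans.
      { apply Rmult_le_compat_l; [left; apply exp_pos | apply (exp_neg_le x t); lra]. }
      fold K. right.
      transitivity (K * exp ((x - 1) * ln t - (x + 1) * ln (1 + t))).
      * rewrite <- Rmult_assoc, (Rmult_comm _ K), Rmult_assoc, <- exp_plus.
        reflexivity.
      * rewrite Rmult_assoc, <- !exp_plus. do 2 f_equal. ring.
  - rewrite (is_RInt_unique _ _ _ _ HI). unfold H.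
    assert (Hle : exp (x * (ln b - ln (1 + b))) <= 1).
    { apply Rle_trans with (exp 0); [apply exp_le | rewrite exp_0; lra].
      assert (ln b < ln (1 + b)) by (apply ln_increasing; lra). nra. }
    pose proof (exp_pos (x * (ln a - ln (1 + a)))).
    assert (0 < K / x) by (apply Rdiv_lt_0_compat; lra). nra.
Qed.

Lemma is_RInt_gen_Gamma (x : R) : 0 < x ->
  is_RInt_gen (Gamma_integrand x) (at_right 0) (Rbar_locally p_infty) (Gamma x) /\
  0 < Gamma x.
Proof.
  intros Hx.
  destruct (is_RInt_gen_bounded (Gamma_integrand x) (exp_pow_bound x / x)) as (l & Hl & Hle).
  - intros t Ht. now apply continuous_Gamma_integrand.
  - intros t _. left. apply Gamma_integrand_pos.
  - intros a b Hab. now apply RInt_Gamma_integrand_le.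
  - assert (Hgl : Gamma x = l).
    { change (RInt_gen (V := R_CompleteNormedModule) (Gamma_integrand x)
                (at_right 0) (Rbar_locally p_infty) = l).
      exact (is_RInt_gen_unique (V := R_CompleteNormedModule) _ _ Hl). }
    rewrite Hgl. split; [exact Hl|].
    apply Rlt_le_trans with (RInt (Gamma_integrand x) 1 2); [|apply Hle; lra].
    apply RInt_gt_0; [lra | intros; apply Gamma_integrand_pos |].
    intros t Ht. apply continuous_Gamma_integrand. lra.
Qed.

Lemma Gamma_boundary_zero (x : R) : 0 < x -> forall eps : posreal, exists a0, 0 < a0 /\
  forall a, 0 < a < a0 -> exp (x * ln a) * exp (- a) < eps.
Proof.
  intros Hx eps. exists (exp (ln eps / x)). split; [apply exp_pos|].
  intros a Ha.
  apply Rle_lt_trans with (exp (x * ln a) * 1).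
  - apply Rmult_le_compat_l; [left; apply exp_pos|].
    rewrite <- exp_0. apply exp_le. lra.
  - rewrite Rmult_1_r.
    assert (He : exp (x * (ln eps / x)) = eps).
    { replace (x * (ln eps / x)) with (ln eps) by (field; lra). apply exp_ln, cond_pos. }
    apply Rlt_le_trans with (exp (x * (ln eps / x))); [|right; exact He].
    apply exp_increasing, Rmult_lt_compat_l; [exact Hx|].
    rewrite <- (ln_exp (ln eps / x)). apply ln_increasing; lra.
Qed.

Lemma Gamma_boundary_infinity (x : R) : 0 < x -> forall eps : posreal, exists b0, 0 < b0 /\
  forall b, b0 < b -> exp (x * ln b) * exp (- b) < eps.
Proof.
  intros Hx eps. set (K := exp_pow_bound x).
  assert (HK : 0 < K) by apply exp_pos. pose proof (cond_pos eps) as He.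
  exists (K / eps). assert (0 < K / eps) by (apply Rdiv_lt_0_compat; lra).
  split; [assumption|]. intros b Hb.
  eapply Rle_lt_trans.
  { apply Rmult_le_compat_l; [left; apply exp_pos | apply (exp_neg_le x b); lra]. }
  fold K.
  apply Rle_lt_trans with (K * exp (- ln (1 + b))).
  - rewrite <- Rmult_assoc, (Rmult_comm _ K), Rmult_assoc, <- exp_plus.
    apply Rmult_le_compat_l; [lra|]. apply exp_le.
    assert (ln b < ln (1 + b)) by (apply ln_increasing; lra). nra.
  - rewrite exp_Ropp, exp_ln by lra.
    apply Rmult_lt_reg_r with (1 + b); [lra|].
    rewrite Rmult_assoc, Rinv_l, Rmult_1_r by lra.
    apply (Rmult_lt_compat_l eps) in Hb; [|exact He].
    replace (eps * (K / eps)) with K in Hb by (field; lra). nra.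
Qed.

(** Integration by parts; the boundary terms vanish at both ends. *)
Lemma Gamma_succ (x : R) : 0 < x -> Gamma (x + 1) = x * Gamma x.
Proof.
  intros Hx.
  destruct (is_RInt_gen_Gamma x Hx) as [H0 _].
  destruct (is_RInt_gen_Gamma (x + 1)) as [H1 _]; [lra|].
  pose proof (is_RInt_gen_minus (V := R_NormedModule) _ _ _ _ H1
                (is_RInt_gen_scal (V := R_NormedModule) _ x _ H0)) as H2.
  assert (H3 : is_RInt_gen (fun t => minus (Gamma_integrand (x + 1) t)
                 (scal x (Gamma_integrand x t))) (at_right 0) (Rbar_locally p_infty) 0).
  { intros P [eps HP]. unfold filtermapi.
    destruct (Gamma_boundary_zero x Hx (pos_div_2 eps)) as (a0 & Ha0 & Ha).
    destruct (Gamma_boundary_infinity x Hx (pos_div_2 eps)) as (b0 & Hb0 & Hb).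
    apply (zero_to_infinity_intro _ (Rmin a0 1) (Rmax b0 1)).
    { apply Rmin_glb_lt; lra. }
    intros a b [Ha1 Ha2] Hb1. simpl.
    pose proof (Rmin_l a0 1). pose proof (Rmin_r a0 1).
    pose proof (Rmax_l b0 1). pose proof (Rmax_r b0 1).
    set (F := fun t => - (exp (x * ln t) * exp (- t))).
    exists (F b - F a). split.
    - apply (is_RInt_derive F).
      + intros t Ht. rewrite Rmin_left in Ht by lra.
        unfold F, Gamma_integrand, Rpower. auto_derive; [lra|].
        unfold minus, scal, plus, opp; simpl. unfold mult; simpl.
        replace (x + 1 - 1) with x by ring.
        replace (exp ((x - 1) * ln t)) with (exp (x * ln t) * / t).
        2:{ replace ((x - 1) * ln t) with (x * ln t + - ln t) by ring.
            rewrite exp_plus, exp_Ropp, exp_ln by lra. reflexivity. }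
        ring.
      + intros t Ht. rewrite Rmin_left in Ht by lra.
        apply (continuous_minus (Gamma_integrand (x + 1))).
        * apply continuous_Gamma_integrand. lra.
        * apply (continuous_scal_r x (Gamma_integrand x)), continuous_Gamma_integrand. lra.
    - apply HP. specialize (Ha a). specialize (Hb b). unfold F.
      apply ball_of_Rabs.
      assert (E1 : 0 < exp (x * ln a) * exp (- a)) by (apply Rmult_lt_0_compat; apply exp_pos).
      assert (E2 : 0 < exp (x * ln b) * exp (- b)) by (apply Rmult_lt_0_compat; apply exp_pos).
      simpl in Ha, Hb.
      assert (Ha' := Ha ltac:(lra)). assert (Hb' := Hb ltac:(lra)).
      apply Rabs_def1; lra. }
  pose proof (is_RInt_gen_unique (V := R_CompleteNormedModule) _ _ H2) as E2.
  pose proof (is_RInt_gen_unique (V := R_CompleteNormedModule) _ _ H3) as E3.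
  pose proof (eq_trans (eq_sym E2) E3) as E.
  change (Gamma (x + 1) + - (x * Gamma x) = 0) in E. lra.
Qed.

Lemma exp_convex (h u : R) : 0 <= h <= 1 -> exp (h * u) <= 1 - h + h * exp u.
Proof.
  intros Hh.
  pose proof (exp_ineq1_le (- (h * u))) as H1.
  pose proof (exp_ineq1_le ((1 - h) * u)) as H2.
  replace (exp u) with (exp (h * u) * exp ((1 - h) * u)) by
    (rewrite <- exp_plus; f_equal; ring).
  assert (H3 : exp (h * u) * exp (- (h * u)) = 1) by
    (rewrite <- exp_plus, Rplus_opp_r; apply exp_0).
  pose proof (exp_pos (h * u)) as H4.
  set (E := exp (h * u)) in *. set (A := exp (- (h * u))) in *.
  set (B := exp ((1 - h) * u)) in *.
  assert (H5 : 1 <= (1 - h) * A + h * B) by nra.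
  apply Rle_trans with (E * ((1 - h) * A + h * B)).
  - rewrite <- (Rmult_1_r E) at 1. apply Rmult_le_compat_l; lra.
  - right. replace (1 - h) with ((1 - h) * (E * A)) at 2 by (rewrite H3; ring). ring.
Qed.

(** The weighted AM-GM inequality for the powers of [t / y], integrated. *)
Lemma Gamma_log_convex (y h : R) : 0 < y -> 0 <= h <= 1 ->
  Gamma (y + h) <= Rpower y h * Gamma y.
Proof.
  intros Hy Hh.
  destruct (is_RInt_gen_Gamma y Hy) as [H0 _].
  destruct (is_RInt_gen_Gamma (y + 1)) as [H1 _]; [lra|].
  destruct (is_RInt_gen_Gamma (y + h)) as [H2 _]; [lra|].
  rewrite Gamma_succ in H1 by exact Hy.
  pose proof (is_RInt_gen_plus (V := R_NormedModule) _ _ _ _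
     (is_RInt_gen_scal (V := R_NormedModule) _ (Rpower y h * (1 - h)) _ H0)
     (is_RInt_gen_scal (V := R_NormedModule) _ (Rpower y h * (h / y)) _ H1)) as H3.
  replace (Rpower y h * Gamma y) with
    (Rpower y h * (1 - h) * Gamma y + Rpower y h * (h / y) * (y * Gamma y)) by (field; lra).
  refine (is_RInt_gen_le _ _ _ _ _ H2 H3).
  intros t Ht. split; [left; apply Gamma_integrand_pos|].
  unfold plus, scal; simpl. unfold mult; simpl. unfold Gamma_integrand, Rpower.
  pose proof (exp_convex h (ln t - ln y) Hh) as Hc.
  replace (exp (ln t - ln y)) with (t / y) in Hc.
  2:{ unfold Rminus. rewrite exp_plus, exp_Ropp, !exp_ln by lra. reflexivity. }
  replace (exp ((y + 1 - 1) * ln t)) with (exp ((y - 1) * ln t) * t).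
  2:{ replace ((y + 1 - 1) * ln t) with ((y - 1) * ln t + ln t) by ring.
      rewrite exp_plus, exp_ln by lra. reflexivity. }
  replace (exp ((y + h - 1) * ln t)) with
    (exp ((y - 1) * ln t) * (exp (h * ln y) * exp (h * (ln t - ln y)))).
  2:{ rewrite <- !exp_plus. f_equal. ring. }
  set (P := exp ((y - 1) * ln t)) in *. set (Q := exp (- t)).
  set (Y := exp (h * ln y)).
  assert (HP : 0 < P) by apply exp_pos. assert (HQ : 0 < Q) by apply exp_pos.
  assert (HY : 0 < Y) by apply exp_pos.
  replace (Y * (1 - h) * (P * Q) + Y * (h / y) * (P * t * Q))
    with ((P * (Y * (1 - h + h * (t / y)))) * Q) by (field; lra).
  apply Rmult_le_compat_r; [lra|]. apply Rmult_le_compat_l; [lra|].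
  apply Rmult_le_compat_l; lra.
Qed.

Lemma lnGamma_succ (x : R) : 0 < x -> ln (Gamma (x + 1)) = ln x + ln (Gamma x).
Proof.
  intros Hx. rewrite Gamma_succ by exact Hx.
  apply ln_mult; [exact Hx | now apply is_RInt_gen_Gamma].
Qed.

(** The lower bound is the upper bound at [y + h] with step [1 - h], through the
    functional equation. *)
Lemma lnGamma_increment (y h : R) : 0 < y -> 0 <= h <= 1 ->
  h * ln y - h / y <= ln (Gamma (y + h)) - ln (Gamma y) <= h * ln y.
Proof.
  intros Hy Hh.
  assert (Hstep : forall z k, 0 < z -> 0 <= k <= 1 ->
            ln (Gamma (z + k)) <= k * ln z + ln (Gamma z)).
  { intros z k Hz Hk.
    destruct (is_RInt_gen_Gamma z Hz) as [_ G1].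
    destruct (is_RInt_gen_Gamma (z + k)) as [_ G2]; [lra|].
    replace (k * ln z + ln (Gamma z)) with (ln (Rpower z k * Gamma z)).
    - apply ln_le; [exact G2 | now apply Gamma_log_convex].
    - rewrite ln_mult; [|apply exp_pos | exact G1]. unfold Rpower. now rewrite ln_exp. }
  split.
  - pose proof (Hstep (y + h) (1 - h) ltac:(lra) ltac:(lra)) as H.
    replace (y + h + (1 - h)) with (y + 1) in H by ring.
    rewrite lnGamma_succ in H by exact Hy.
    assert (Hln : ln (y + h) - ln y <= h / y).
    { rewrite <- ln_div by lra.
      eapply Rle_trans; [apply ln_le_sub_1, Rdiv_lt_0_compat; lra|].
      right. field. lra. }
    assert (0 <= h / y) by (apply Rmult_le_pos; [lra | left; apply Rinv_0_lt_compat; lra]).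
    nra.
  - pose proof (Hstep y h Hy Hh). lra.
Qed.

Lemma lnGamma_slope (Y h : R) : 1 < Y -> h <> 0 -> Rabs h <= 1 ->
  Rabs ((ln (Gamma (Y + h)) - ln (Gamma Y)) / h - ln Y) <= 2 / (Y - 1).
Proof.
  intros HY Hh0 Hh1.
  assert (Hi : 0 < / Y <= / (Y - 1)).
  { split; [apply Rinv_0_lt_compat; lra | apply Rinv_le_contravar; lra]. }
  unfold Rdiv at 2.
  destruct (Rlt_le_dec 0 h) as [Hh|Hh].
  - rewrite Rabs_pos_eq in Hh1 by lra.
    destruct (lnGamma_increment Y h) as [H1 H2]; [lra | lra |].
    set (D := ln (Gamma (Y + h)) - ln (Gamma Y)) in *.
    assert (HD : D / h * h = D) by (field; lra).
    assert (H3 : D / h <= ln Y) by (apply Rmult_le_reg_r with h; lra).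
    assert (H4 : ln Y - / Y <= D / h).
    { apply Rmult_le_reg_r with h; [lra|]. rewrite HD. unfold Rdiv in H1. lra. }
    apply Rabs_le. lra.
  - assert (Hneg : h < 0) by lra. rewrite Rabs_left in Hh1 by lra.
    destruct (lnGamma_increment (Y + h) (- h)) as [H1 H2]; [lra | lra |].
    replace (Y + h + - h) with Y in * by ring.
    set (D := ln (Gamma (Y + h)) - ln (Gamma Y)).
    assert (HD : D / h * - h = - D) by (field; lra).
    assert (Hi2 : 0 < / (Y + h) <= / (Y - 1)).
    { split; [apply Rinv_0_lt_compat; lra | apply Rinv_le_contravar; lra]. }
    assert (H3 : D / h <= ln (Y + h)).
    { apply Rmult_le_reg_r with (- h); [lra|]. rewrite HD. unfold D. lra. }
    assert (H4 : ln (Y + h) - / (Y + h) <= D / h).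
    { apply Rmult_le_reg_r with (- h); [lra|]. rewrite HD. unfold D.
      unfold Rdiv in H1. lra. }
    assert (Hln : ln Y - ln (Y + h) <= / (Y + h)).
    { rewrite <- ln_div by lra.
      eapply Rle_trans; [apply ln_le_sub_1, Rdiv_lt_0_compat; lra|].
      apply Rmult_le_reg_r with (Y + h); [lra|]. field_simplify; lra. }
    assert (Hln2 : ln (Y + h) <= ln Y) by (apply ln_le; lra).
    apply Rabs_le. lra.
Qed.

Definition digamma_partial (x : R) (n : nat) : R :=
  ln (x + INR (S n)) - sum_n (fun k => / (x + INR k)) n.

Lemma lnGamma_shift (x : R) (n : nat) : 0 < x ->
  ln (Gamma (x + INR (S n))) = ln (Gamma x) + sum_n (fun k => ln (x + INR k)) n.
Proof.
  intros Hx. induction n as [|n IH].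
  - rewrite sum_O. simpl INR. rewrite Rplus_0_r, lnGamma_succ by exact Hx. ring.
  - rewrite sum_Sn. as_Rplus. rewrite (S_INR (S n)).
    rewrite <- Rplus_assoc, lnGamma_succ.
    + rewrite IH. as_R_eq. ring.
    + pose proof (pos_INR (S n)). lra.
Qed.

(** The functional equation moves the difference quotient at [x] to [x + n + 1],
    where [lnGamma_slope] pins it to the logarithm up to [O(1/n)]; the finitely
    many remaining terms are differentiable. *)
Lemma lnGamma_slope_partial (x : R) (n : nat) : 0 < x ->
  exists d : posreal, forall h, h <> 0 -> Rabs h < d ->
    Rabs ((ln (Gamma (x + h)) - ln (Gamma x)) / h - digamma_partial x n) <= 3 / (x + INR n).
Proof.
  intros Hx.
  assert (Hxk : forall k, 0 < x + INR k) by (intros k; pose proof (pos_INR k); lra).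
  assert (Hd : is_derive (fun h => sum_n (fun k => ln (x + h + INR k)) n) 0
                 (sum_n (fun k => / (x + INR k)) n)).
  { apply (is_derive_sum_n (V := R_NormedModule) (fun k h => ln (x + h + INR k))).
    intros k _. specialize (Hxk k). auto_derive; [lra|]. field. lra. }
  apply is_derive_Reals in Hd.
  assert (He : 0 < / (x + INR n)) by (apply Rinv_0_lt_compat, Hxk).
  destruct (Hd _ He) as [d Hd'].
  assert (Hm : 0 < Rmin (Rmin d 1) x).
  { apply Rmin_glb_lt; [apply Rmin_glb_lt; [apply cond_pos | lra] | lra]. }
  exists (mkposreal _ Hm). intros h Hh0 Hh. simpl in Hh.
  pose proof (Rmin_l (Rmin d 1) x). pose proof (Rmin_r (Rmin d 1) x).
  pose proof (Rmin_l d 1). pose proof (Rmin_r d 1).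
  assert (Hh' : - x < h) by (apply Rabs_def2 in Hh; lra).
  specialize (Hd' h Hh0 ltac:(lra)).
  rewrite Rplus_0_l in Hd'.
  rewrite (sum_n_ext (fun k => ln (x + 0 + INR k)) (fun k => ln (x + INR k))) in Hd'
    by (intros k; now rewrite Rplus_0_r).
  pose proof (lnGamma_slope (x + INR (S n)) h) as Hs.
  assert (Hn1 : x + INR (S n) - 1 = x + INR n) by (rewrite S_INR; ring).
  rewrite Hn1 in Hs.
  specialize (Hs ltac:(specialize (Hxk n); lra) Hh0 ltac:(lra)).
  replace (x + INR (S n) + h) with (x + h + INR (S n)) in Hs by ring.
  rewrite !lnGamma_shift in Hs by lra.
  unfold digamma_partial. unfold Rdiv in Hs at 2. unfold Rdiv at 2.
  set (s1 := sum_n (fun k => ln (x + h + INR k)) n) in *.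
  set (s0 := sum_n (fun k => ln (x + INR k)) n) in *.
  set (s := sum_n (fun k => / (x + INR k)) n) in *.
  change R in (type of s1), (type of s0), (type of s).
  replace ((ln (Gamma (x + h)) - ln (Gamma x)) / h - (ln (x + INR (S n)) - s))
    with (((ln (Gamma (x + h)) + s1 - (ln (Gamma x) + s0)) / h - ln (x + INR (S n)))
          - ((s1 - s0) / h - s)) by (field; exact Hh0).
  eapply Rle_trans; [apply Rabs_triang|]. rewrite Rabs_Ropp. lra.
Qed.

(** Comparing with a common difference quotient shows that the partial sums form
    a Cauchy sequence, and then that the difference quotients have the same
    limit. *)
Lemma is_derive_lnGamma (x : R) : 0 < x ->
  exists D : R, is_derive (fun y => ln (Gamma y)) x D /\
    forall n, Rabs (D - digamma_partial x n) <= 3 / (x + INR n).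
Proof.
  intros Hx.
  assert (Hxk : forall k, 0 < x + INR k) by (intros k; pose proof (pos_INR k); lra).
  assert (Hmon : forall n m, (n <= m)%nat -> 3 / (x + INR m) <= 3 / (x + INR n)).
  { intros n m Hnm. apply Rmult_le_compat_l; [lra|].
    apply Rinv_le_contravar; [apply Hxk|]. apply le_INR in Hnm. lra. }
  assert (Hlim : is_lim_seq (fun n => 3 / (x + INR n)) 0).
  { unfold Rdiv. replace (Finite 0) with (Rbar_mult 3 0) by (simpl; f_equal; ring).
    apply is_lim_seq_scal_l, is_lim_seq_inv_shift. }
  assert (Hpair : forall n m,
    Rabs (digamma_partial x n - digamma_partial x m) <= 3 / (x + INR n) + 3 / (x + INR m)).
  { intros n m.
    destruct (lnGamma_slope_partial x n Hx) as [d1 H1].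
    destruct (lnGamma_slope_partial x m Hx) as [d2 H2].
    set (h := Rmin d1 d2 / 2).
    assert (Hm : 0 < Rmin d1 d2) by (apply Rmin_glb_lt; apply cond_pos).
    pose proof (Rmin_l d1 d2). pose proof (Rmin_r d1 d2).
    specialize (H1 h ltac:(unfold h; lra) ltac:(rewrite Rabs_pos_eq; unfold h; lra)).
    specialize (H2 h ltac:(unfold h; lra) ltac:(rewrite Rabs_pos_eq; unfold h; lra)).
    set (s := (ln (Gamma (x + h)) - ln (Gamma x)) / h) in *.
    replace (digamma_partial x n - digamma_partial x m)
      with (- (s - digamma_partial x n) + (s - digamma_partial x m)) by ring.
    eapply Rle_trans; [apply Rabs_triang|]. rewrite Rabs_Ropp. lra. }
  assert (Hex : ex_finite_lim_seq (digamma_partial x)).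
  { apply ex_lim_seq_cauchy_corr. intros eps.
    apply is_lim_seq_spec in Hlim.
    destruct (Hlim (pos_div_2 eps)) as [N HN]. exists N. intros n m Hn Hm.
    eapply Rle_lt_trans; [apply Hpair|].
    pose proof (HN n Hn) as A1. pose proof (HN m Hm) as A2. simpl in A1, A2.
    rewrite Rminus_0_r in A1, A2. apply Rabs_def2 in A1. apply Rabs_def2 in A2. lra. }
  destruct Hex as [D HD].
  assert (Happ : forall n, Rabs (D - digamma_partial x n) <= 3 / (x + INR n)).
  { intros n.
    apply (is_lim_seq_le (fun m => Rabs (digamma_partial x m - digamma_partial x n))
             (fun m => 3 / (x + INR m) + 3 / (x + INR n))
             (Rabs (D - digamma_partial x n)) (3 / (x + INR n))).
    - intros m. apply Hpair.
    - apply (is_lim_seq_abs _ (D - digamma_partial x n)).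
      apply is_lim_seq_minus'; [exact HD | apply is_lim_seq_const].
    - replace (Finite (3 / (x + INR n))) with (Finite (0 + 3 / (x + INR n)))
        by (f_equal; apply Rplus_0_l).
      apply is_lim_seq_plus'; [exact Hlim | apply is_lim_seq_const]. }
  exists D. split; [|exact Happ].
  apply is_derive_Reals. intros eps Heps.
  apply is_lim_seq_spec in Hlim.
  assert (Heps2 : 0 < eps / 3) by lra.
  destruct (Hlim (mkposreal _ Heps2)) as [N HN]. specialize (HN N (le_n N)). simpl in HN.
  rewrite Rminus_0_r in HN. apply Rabs_def2 in HN.
  destruct (lnGamma_slope_partial x N Hx) as [d Hd].
  exists d. intros h Hh0 Hh. specialize (Hd h Hh0 Hh). specialize (Happ N).
  set (s := (ln (Gamma (x + h)) - ln (Gamma x)) / h) in *.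
  replace (s - D) with ((s - digamma_partial x N) + - (D - digamma_partial x N)) by ring.
  eapply Rle_lt_trans; [apply Rabs_triang|]. rewrite Rabs_Ropp. lra.
Qed.

Lemma digamma_approx (x : R) (n : nat) : 0 < x ->
  Rabs (digamma x - digamma_partial x n) <= 3 / (x + INR n).
Proof.
  intros Hx. destruct (is_derive_lnGamma x Hx) as (D & HD & Happ).
  replace (digamma x) with D; [apply Happ|].
  destruct (is_RInt_gen_Gamma x Hx) as [_ HG].
  assert (H : is_derive Gamma x (D * Gamma x)).
  { apply is_derive_ext_loc with (fun y => exp (ln (Gamma y))).
    - exists (mkposreal x Hx). intros y Hy.
      apply Rabs_of_ball in Hy. simpl in Hy. apply Rabs_def2 in Hy. apply exp_ln, is_RInt_gen_Gamma. lra.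
    - replace (D * Gamma x) with (scal D (exp (ln (Gamma x)))) by now rewrite exp_ln.
      apply (is_derive_comp exp (fun y => ln (Gamma y))); [|exact HD].
      apply is_derive_Reals, derivable_pt_lim_exp. }
  unfold digamma. rewrite (is_derive_unique _ _ _ H). field. lra.
Qed.

(** * Euler--Maclaurin summation over the multiples of t *)

(** The functions [d 1, d 2, ...] are a summand and its derivatives, and [d 0]
    is the primitive that vanishes at infinity, so that [- d 0 0] is the
    integral of the summand over the half-line. *)
Record decaying_jet (d : nat -> R -> R) : Prop := {
  jet_derive : forall j v, 0 <= v -> is_derive (d j) v (d (S j) v);
  jet_decay : exists del, 0 < del /\
    forall j, exists C, 0 <= C /\ forall v, 0 <= v -> Rabs (d j v) <= C * exp (- (del * v)) }.

Lemma decaying_jet_shift (d : nat -> R -> R) (k : nat) :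
  decaying_jet d -> decaying_jet (fun j => d (j + k)%nat).
Proof.
  intros [Hd (del & Hdel & Hb)]. split.
  - intros j v Hv. now apply (Hd (j + k)%nat).
  - exists del. split; [exact Hdel|]. intros j. apply Hb.
Qed.

Lemma sum_n_zero_below (F : nat -> R) (n : nat) :
  (forall j, F (S j) = 0) -> sum_n F n = F 0%nat.
Proof.
  intros HF. induction n as [|n IH]; [apply sum_O|].
  rewrite sum_Sn, IH, HF. apply Rplus_0_r.
Qed.

Lemma sum_n_first (a : nat -> R) (n : nat) :
  sum_n a (S n) = a 0%nat + sum_n (fun j => a (S j)) n.
Proof.
  induction n as [|n IH].
  - rewrite sum_Sn, !sum_O. reflexivity.
  - rewrite sum_Sn, IH, sum_Sn. as_Rplus. as_R_eq. ring.
Qed.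

(** Expanding at the right end [b] of the interval makes the nodes of the summed
    formula start at [t] instead of 0. *)
Lemma taylor_backward (a b C : R) (n : nat) : forall (d : nat -> R -> R),
  (forall j v, a <= v <= b -> is_derive (d j) v (d (S j) v)) ->
  (forall v, a <= v <= b -> Rabs (d (S n) v) <= C) ->
  forall s, 0 <= s <= b - a ->
  Rabs (d 0%nat (b - s) - sum_n (fun j => (- s) ^ j / INR (fact j) * d j b) n) <= C * s ^ S n.
Proof.
  induction n as [|n IH]; intros d Hd HC s Hs.
  - rewrite sum_O. simpl fact. simpl INR. rewrite !pow_O, pow_1.
    destruct (mean_value (d 0%nat) (d 1%nat) (b - s) b) as (c & Hc & E);
      [lra | intros v Hv; apply Hd; lra |].
    replace (d 0%nat (b - s) - 1 / 1 * d 0%nat b) with (- (d 0%nat b - d 0%nat (b - s))) by field.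
    rewrite Rabs_Ropp, E. replace (b - (b - s)) with s by ring.
    rewrite Rabs_mult, (Rabs_pos_eq s) by lra.
    apply Rmult_le_compat_r; [lra|]. apply HC. lra.
  - set (phi := fun s => d 0%nat (b - s) - sum_n (fun j => (- s) ^ j / INR (fact j) * d j b) (S n)).
    set (dphi := fun s => - (d 1%nat (b - s) - sum_n (fun j => (- s) ^ j / INR (fact j) * d (S j) b) n)).
    assert (Hphi : forall u, 0 <= u <= b - a -> is_derive phi u (dphi u)).
    { intros u Hu. unfold phi, dphi.
      assert (E : - (d 1%nat (b - u) - sum_n (fun j => (- u) ^ j / INR (fact j) * d (S j) b) n)
         = -1 * d 1%nat (b - u) - sum_n (fun j => INR j * (-1) * (- u) ^ pred j / INR (fact j) * d j b) (S n)).
      { rewrite sum_n_first.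
        rewrite (sum_n_ext (fun j => INR (S j) * (-1) * (- u) ^ pred (S j) / INR (fact (S j)) * d (S j) b)
                   (fun j => -1 * ((- u) ^ j / INR (fact j) * d (S j) b))).
        2:{ intros j. rewrite fact_simpl, mult_INR. simpl pred. as_R_eq. field.
            split; [apply INR_fact_neq_0 | apply not_0_INR; lia]. }
        rewrite sum_n_Rmult_l. change (INR 0) with 0. unfold Rdiv. ring. }
      rewrite E.
      apply (is_derive_minus (fun u => d 0%nat (b - u))
               (fun u => sum_n (fun j => (- u) ^ j / INR (fact j) * d j b) (S n))).
      - apply (is_derive_comp (d 0%nat) (fun u => b - u)).
        + apply Hd. lra.
        + auto_derive; [trivial | ring].
      - apply (is_derive_sum_n (V := R_NormedModule)
                 (fun j u => (- u) ^ j / INR (fact j) * d j b)).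
        intros j _. auto_derive; [trivial|]. unfold Rdiv. ring. }
    assert (Hdphi : forall u, 0 <= u <= b - a -> Rabs (dphi u) <= C * u ^ S n).
    { intros u Hu. unfold dphi. rewrite Rabs_Ropp.
      apply (IH (fun j => d (S j))); [intros; now apply Hd | exact HC | exact Hu]. }
    destruct (mean_value phi dphi 0 s) as (c & Hc & E);
      [lra | intros v Hv; apply Hphi; lra |].
    assert (E0 : phi 0 = 0).
    { unfold phi. rewrite sum_n_zero_below.
      - rewrite Rminus_0_r. simpl. field.
      - intros j. rewrite Ropp_0, pow_i by lia. unfold Rdiv. ring. }
    fold (phi s). rewrite E0, !Rminus_0_r in E. rewrite E.
    rewrite Rabs_mult, (Rabs_pos_eq s) by lra.
    assert (HC0 : 0 <= C).
    { eapply Rle_trans; [apply Rabs_pos | apply (HC b)]. lra. }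
    apply Rle_trans with (C * c ^ S n * s).
    * apply Rmult_le_compat_r; [lra|]. apply Hdphi. lra.
    * rewrite <- (tech_pow_Rmult s (S n)), (Rmult_comm s), <- Rmult_assoc.
      apply Rmult_le_compat_r; [lra|]. apply Rmult_le_compat_l; [exact HC0|].
      apply pow_incr. lra.
Qed.

Lemma exp_mult_INR (u : R) (m : nat) : exp (- (u * INR m)) = exp (- u) ^ m.
Proof.
  induction m as [|m IH].
  - simpl. rewrite Rmult_0_r, Ropp_0. apply exp_0.
  - rewrite S_INR, <- tech_pow_Rmult, <- IH, <- exp_plus. f_equal. ring.
Qed.

Lemma exp_neg_lt_1 (u : R) : 0 < u -> 0 < exp (- u) < 1.
Proof.
  intros Hu. split; [apply exp_pos|]. rewrite <- exp_0. apply exp_increasing. lra.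
Qed.

(** The geometric series [1 / (1 - e^(-del t))] is at most [(1+del)/(del*t)], so
    summation costs one power of [t]. *)
Lemma Series_decay (del C t : R) (f : nat -> R) : 0 < del -> 0 <= C -> 0 < t <= 1 ->
  (forall m, Rabs (f m) <= C * exp (- (del * (INR m * t)))) ->
  ex_series f /\ Rabs (Series f) <= C * ((1 + del) / del) / t.
Proof.
  intros Hdel HC Ht Hf.
  assert (Hr := exp_neg_lt_1 (del * t) ltac:(nra)).
  assert (Hg : is_series (fun m => C * exp (- (del * (INR m * t))))
                 (C * / (1 - exp (- (del * t))))).
  { apply is_series_ext with (fun m => C * exp (- (del * t)) ^ m).
    - intros m. rewrite <- exp_mult_INR. do 3 f_equal. ring.
    - apply (is_series_scal_l C (fun m => exp (- (del * t)) ^ m)), is_series_geom.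
      rewrite Rabs_pos_eq; lra. }
  assert (Hex : ex_series (fun m => Rabs (f m))).
  { apply (ex_series_le (V := R_CompleteNormedModule) _
             (fun m => C * exp (- (del * (INR m * t))))).
    - intros m. unfold norm; simpl. unfold abs; simpl. rewrite Rabs_Rabsolu. apply Hf.
    - eexists; exact Hg. }
  split; [now apply ex_series_Rabs|].
  eapply Rle_trans; [apply Series_Rabs, Hex|].
  apply Rle_trans with (C * / (1 - exp (- (del * t)))).
  - rewrite <- (is_series_unique _ _ Hg). apply Series_le; [|eexists; exact Hg].
    intros m. split; [apply Rabs_pos | apply Hf].
  - unfold Rdiv at 1. rewrite Rmult_assoc. apply Rmult_le_compat_l; [exact HC|].
    pose proof (exp_ineq1_le (del * t)) as H.
    assert (H1 : exp (- (del * t)) <= / (1 + del * t)).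
    { rewrite exp_Ropp. apply Rinv_le_contravar; [nra | exact H]. }
    assert (H2 : del * t / (1 + del * t) <= 1 - exp (- (del * t))).
    { replace (del * t / (1 + del * t)) with (1 - / (1 + del * t)) by (field; nra). lra. }
    apply Rle_trans with (/ (del * t / (1 + del * t))).
    + apply Rinv_le_contravar; [apply Rdiv_lt_0_compat; nra | exact H2].
    + replace (/ (del * t / (1 + del * t))) with ((1 + del * t) / del * / t) by (field; nra).
      apply Rmult_le_compat_r; [left; apply Rinv_0_lt_compat; lra|].
      apply Rmult_le_compat_r; [left; apply Rinv_0_lt_compat; lra | nra].
Qed.

Definition lattice_sum (f : R -> R) (t : R) : R := Series (fun m => f (INR (S m) * t)).

Lemma ex_lattice_sum (d : nat -> R -> R) (j : nat) (t : R) : decaying_jet d -> 0 < t <= 1 ->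
  ex_series (fun m => d j (INR (S m) * t)).
Proof.
  intros [_ (del & Hdel & Hb)] Ht. destruct (Hb j) as (C & HC & HbC).
  apply (Series_decay del C t); [exact Hdel | exact HC | exact Ht |].
  intros m. pose proof (pos_INR m). eapply Rle_trans; [apply HbC|].
  - rewrite S_INR. nra.
  - apply Rmult_le_compat_l; [exact HC|]. apply exp_le. rewrite S_INR. nra.
Qed.

Lemma Series_sum_n (F : nat -> nat -> R) (N : nat) :
  (forall j, (j <= N)%nat -> ex_series (F j)) ->
  is_series (fun m => sum_n (fun j => F j m) N) (sum_n (fun j => Series (F j)) N).
Proof.
  induction N as [|N IH]; intros Hex.
  - rewrite sum_O. apply is_series_ext with (F 0%nat); [intros m; now rewrite sum_O|].
    apply Series_correct, Hex. lia.
  - rewrite sum_Sn.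
    apply is_series_ext with (fun m => plus (sum_n (fun j => F j m) N) (F (S N) m));
      [intros m; now rewrite sum_Sn|].
    apply (is_series_plus (V := R_NormedModule)).
    + apply IH. intros j Hj. apply Hex. lia.
    + apply Series_correct, Hex. lia.
Qed.

(** Taylor's formula on each mesh interval, summed over the mesh: the
    differences of values of [d 0] telescope to [d 0 0]. *)
Lemma mesh_taylor (d : nat -> R -> R) (N : nat) : decaying_jet d ->
  exists K, 0 <= K /\ forall t, 0 < t <= 1 ->
    Rabs (d 0%nat 0 + sum_n (fun i => (- t) ^ i / INR (fact (S i)) *
                                      (t * lattice_sum (d (S i)) t)) N) <= K * t ^ S N.
Proof.
  intros Hjet. pose proof Hjet as [Hd (del & Hdel & Hb)].
  destruct (Hb (S (S N))) as (C & HC & HbC).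
  exists (C * ((1 + del) / del)).
  assert (Hcd : 0 <= (1 + del) / del) by (left; apply Rdiv_lt_0_compat; lra).
  split; [nra|]. intros t Ht.
  set (T := fun j m => (- t) ^ j / INR (fact j) * d j (INR (S m) * t)).
  set (rho := fun m => d 0%nat (INR m * t) - sum_n (fun j => T j m) (S N)).
  assert (Hrho : forall m, Rabs (rho m) <= C * t ^ S (S N) * exp (- (del * (INR m * t)))).
  { intros m. unfold rho, T. pose proof (pos_INR m) as Hm.
    pose proof (taylor_backward (INR m * t) (INR (S m) * t) (C * exp (- (del * (INR m * t))))
                  (S N) d) as HT.
    assert (E : INR (S m) * t - t = INR m * t) by (rewrite S_INR; ring).
    specialize (HT ltac:(intros; apply Hd; nra)).
    rewrite <- E at 1.
    replace (C * t ^ S (S N) * exp (- (del * (INR m * t))))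
      with (C * exp (- (del * (INR m * t))) * t ^ S (S N)) by ring.
    apply HT.
    - intros v Hv. eapply Rle_trans; [apply HbC; nra|].
      apply Rmult_le_compat_l; [exact HC|]. apply exp_le. nra.
    - rewrite S_INR. lra. }
  destruct (Series_decay del (C * t ^ S (S N)) t rho) as [Hexr Hr];
    [exact Hdel | apply Rmult_le_pos; [exact HC | apply pow_le; lra] | exact Ht | exact Hrho |].
  assert (HTex : forall j, ex_series (T j)).
  { intros j. apply ex_series_Rmult_l, ex_lattice_sum; assumption. }
  assert (Hlim : is_lim_seq (fun m => d 0%nat (INR m * t)) 0).
  { apply is_lim_seq_incr_1, ex_series_lim_0. now apply ex_lattice_sum. }
  pose proof (is_series_telescope _ Hlim) as Htel.
  cbv beta in Htel. change (INR 0) with 0 in Htel. rewrite Rmult_0_l in Htel.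
  assert (Hsplit : forall m, d 0%nat (INR m * t) - d 0%nat (INR (S m) * t)
             = sum_n (fun j => T (S j) m) N + rho m).
  { intros m. unfold rho. rewrite sum_n_first. unfold T at 2. simpl fact. simpl INR.
    rewrite pow_O. as_R_eq. field. }
  assert (E : d 0%nat 0 = sum_n (fun j => Series (T (S j))) N + Series rho).
  { rewrite <- (is_series_unique _ _ Htel). apply is_series_unique.
    apply is_series_ext with (fun m => sum_n (fun j => T (S j) m) N + rho m);
      [intros m; symmetry; apply Hsplit|].
    apply (is_series_plus (V := R_NormedModule)).
    - apply (Series_sum_n (fun j => T (S j))). intros j _. apply HTex.
    - now apply Series_correct. }
  assert (E2 : sum_n (fun i => (- t) ^ i / INR (fact (S i)) * (t * lattice_sum (d (S i)) t)) N
               = -1 * sum_n (fun j => Series (T (S j))) N).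
  { rewrite <- sum_n_Rmult_l. apply sum_n_ext. intros j. unfold T, lattice_sum.
    rewrite Series_scal_l, <- tech_pow_Rmult. as_R_eq. unfold Rdiv. ring. }
  rewrite E2, E.
  replace (sum_n (fun j => Series (T (S j))) N + Series rho + -1 * sum_n (fun j => Series (T (S j))) N)
    with (Series rho) by ring.
  eapply Rle_trans; [exact Hr|]. right. simpl pow. field. lra.
Qed.

Lemma sum_n_triangle (F : nat -> nat -> R) (N : nat) :
  sum_n (fun k => sum_n (fun i => F k (i + k)%nat) (N - k)) N
  = sum_n (fun l => sum_n (fun k => F k l) l) N.
Proof.
  induction N as [|N IH].
  - now rewrite !sum_O.
  - rewrite (sum_Sn (fun l => sum_n (fun k => F k l) l)), <- IH, (sum_Sn (fun k => F k (S N))).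
    rewrite sum_Sn, Nat.sub_diag, sum_O, Nat.add_0_l.
    rewrite plus_assoc. f_equal.
    rewrite <- sum_n_plus. apply sum_n_ext_loc. intros k Hk.
    replace (S N - k)%nat with (S (N - k)) by lia. rewrite sum_Sn.
    do 2 f_equal. lia.
Qed.

Lemma Rabs_sum_n_le (F G : nat -> R) (N : nat) :
  (forall k, (k <= N)%nat -> Rabs (F k) <= G k) -> Rabs (sum_n F N) <= sum_n G N.
Proof.
  induction N as [|N IH]; intros H.
  - rewrite !sum_O. apply H. lia.
  - rewrite !sum_Sn. as_Rplus.
    eapply Rle_trans; [apply Rabs_triang|]. apply Rplus_le_compat.
    + apply IH. intros k Hk. apply H. lia.
    + apply H. lia.
Qed.

(** [mesh_taylor] is applied to the shifted jets [d (. + k)] to order [N - k],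
    with the weight [b k (-t)^k]. The hypothesis on [b], which says that its
    generating function is the inverse of that of the coefficients [1 / (j+1)!],
    collapses the double sum to its first term. *)
Lemma euler_maclaurin (b : nat -> R) (d : nat -> R -> R) (N : nat) :
  (forall l, sum_n (fun k => b k / INR (fact (S (l - k)))) l = if Nat.eqb l 0 then 1 else 0) ->
  decaying_jet d ->
  exists K, forall t, 0 < t <= 1 ->
    Rabs (t * lattice_sum (d 1%nat) t + sum_n (fun k => b k * (- t) ^ k * d k 0) N)
      <= K * t ^ S N.
Proof.
  intros Hb Hjet.
  assert (HK : exists K : nat -> R, forall k, (k <= N)%nat -> 0 <= K k /\ forall t, 0 < t <= 1 ->
    Rabs (d k 0 + sum_n (fun i => (- t) ^ i / INR (fact (S i)) *
                         (t * lattice_sum (d (S (i + k))) t)) (N - k)) <= K k * t ^ S (N - k)).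
  { assert (Hex : forall k, exists K, 0 <= K /\ forall t, 0 < t <= 1 ->
      Rabs (d k 0 + sum_n (fun i => (- t) ^ i / INR (fact (S i)) *
                         (t * lattice_sum (d (S (i + k))) t)) (N - k)) <= K * t ^ S (N - k)).
    { intros k. apply (mesh_taylor (fun j => d (j + k)%nat) (N - k)).
      now apply decaying_jet_shift. }
    exists (fun k => proj1_sig (constructive_indefinite_description _ (Hex k))).
    intros k _. exact (proj2_sig (constructive_indefinite_description _ (Hex k))). }
  destruct HK as [K HK].
  exists (sum_n (fun k => Rabs (b k) * K k) N). intros t Ht.
  set (s := fun l => t * lattice_sum (d (S l)) t).
  set (E := fun k => d k 0 + sum_n (fun i => (- t) ^ i / INR (fact (S i)) * s (i + k)%nat) (N - k)).
  assert (Hmain : t * lattice_sum (d 1%nat) t + sum_n (fun k => b k * (- t) ^ k * d k 0) N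
                  = sum_n (fun k => b k * (- t) ^ k * E k) N).
  { transitivity (sum_n (fun k => b k * (- t) ^ k * d k 0 +
       sum_n (fun i => b k / INR (fact (S (i + k - k))) * ((- t) ^ (i + k) * s (i + k)%nat)) (N - k)) N).
    - rewrite (sum_n_plus (fun k => b k * (- t) ^ k * d k 0)).
      rewrite (sum_n_triangle (fun k l => b k / INR (fact (S (l - k))) * ((- t) ^ l * s l)) N).
      rewrite (sum_n_ext (fun l => sum_n (fun k => b k / INR (fact (S (l - k))) * ((- t) ^ l * s l)) l)
                 (fun l => (- t) ^ l * s l * (if Nat.eqb l 0 then 1 else 0))).
      2:{ intros l. rewrite <- Hb, <- sum_n_Rmult_l. apply sum_n_ext. intros k. as_R_eq. ring. }
      rewrite (sum_n_zero_below (fun l => (- t) ^ l * s l * (if Nat.eqb l 0 then 1 else 0)))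
        by (intros j; simpl; ring).
      as_Rplus. unfold s. simpl. ring.
    - apply sum_n_ext. intros k. unfold E. rewrite Rmult_plus_distr_l. as_R_eq. f_equal.
      rewrite <- sum_n_Rmult_l. apply sum_n_ext. intros i.
      rewrite Nat.add_sub, pow_add. as_R_eq. unfold Rdiv. ring. }
  rewrite Hmain.
  eapply Rle_trans; [apply Rabs_sum_n_le with (G := fun k => t ^ S N * (Rabs (b k) * K k))|].
  - intros k Hk. destruct (HK k Hk) as [HK0 HKt]. specialize (HKt t Ht). fold (s 0%nat) in HKt.
    change (Rabs (E k) <= K k * t ^ S (N - k)) in HKt.
    rewrite !Rabs_mult, <- RPow_abs, Rabs_Ropp, (Rabs_pos_eq t) by lra.
    replace (t ^ S N) with (t ^ k * t ^ S (N - k)) by (rewrite <- pow_add; f_equal; lia).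
    replace (t ^ k * t ^ S (N - k) * (Rabs (b k) * K k))
      with (Rabs (b k) * t ^ k * (K k * t ^ S (N - k))) by ring.
    apply Rmult_le_compat_l; [|exact HKt].
    apply Rmult_le_pos; [apply Rabs_pos | apply pow_le; lra].
  - rewrite sum_n_Rmult_l. right. ring.
Qed.

(** * Power series near the origin *)

Lemma CV_radius_ge_of_series (a : nat -> R) (t l : R) :
  is_pseries a t l -> Rbar_le (Rabs t) (CV_radius a).
Proof.
  intros H. apply is_pseries_R in H.
  assert (Hl : is_lim_seq (fun n => a n * t ^ n) 0) by (apply ex_series_lim_0; now exists l).
  destruct (filterlim_bounded (V := R_NormedModule) (fun n => a n * t ^ n)) as [M HM];
    [now exists 0|].
  apply CV_radius_ge with M. intros n. rewrite RPow_abs, Rabs_mult, Rabs_Rabsolu, <- Rabs_mult.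
  apply HM.
Qed.

Lemma CV_radius_gt_of_series (a : nat -> R) (r t l : R) :
  0 < r -> Rabs t < r -> is_pseries a r l -> Rbar_lt (Rabs t) (CV_radius a).
Proof.
  intros Hr Ht H. apply Rbar_lt_le_trans with (Rabs r).
  - simpl. now rewrite (Rabs_pos_eq r) by lra.
  - now apply CV_radius_ge_of_series with l.
Qed.

Lemma PSeries_right_limit_0 (a : nat -> R) (r : R) :
  0 < r -> Rbar_lt 0 (CV_radius a) -> (forall t, 0 < t < r -> PSeries a t = 0) -> a 0%nat = 0.
Proof.
  intros Hr Hcv H.
  assert (Hc : continuity_pt (PSeries a) 0) by
    (apply PSeries_continuity; now rewrite Rabs_R0).
  apply NNPP. intros Hn.
  destruct (Hc (Rabs (a 0%nat))) as (d & Hd & Hd'); [now apply Rabs_pos_lt|].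
  set (t := Rmin d r / 2).
  assert (Hm : 0 < Rmin d r) by (apply Rmin_glb_lt; lra).
  pose proof (Rmin_l d r). pose proof (Rmin_r d r).
  assert (Ht : 0 < t < r /\ t < d) by (unfold t; lra).
  specialize (Hd' t). simpl in Hd'. unfold Rdist, D_x, no_cond in Hd'.
  rewrite PSeries_0, (H t), !Rminus_0_r, Rminus_0_l, Rabs_Ropp, (Rabs_pos_eq t) in Hd' by lra.
  assert (Habs : Rabs (a 0%nat) < Rabs (a 0%nat)); [|lra].
  apply Hd'. split; [split; [trivial | lra] | lra].
Qed.

(** One-sided, because in the identity theorem the zeros are known on one side
    of a point only. *)
Lemma PSeries_right_zero (r : R) (n : nat) : forall a : nat -> R,
  0 < r -> Rbar_lt 0 (CV_radius a) -> (forall t, 0 < t < r -> PSeries a t = 0) -> a n = 0.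
Proof.
  induction n as [|n IH]; intros a Hr Hcv H; [now apply (PSeries_right_limit_0 a r)|].
  assert (Ha0 : a 0%nat = 0) by now apply (PSeries_right_limit_0 a r).
  apply (IH (PS_decr_1 a)); [exact Hr | now rewrite CV_radius_decr_1 |].
  intros t Ht. pose proof (PSeries_decr_1_aux a t Ha0) as E. rewrite H in E by exact Ht.
  apply Rmult_eq_reg_l with t; [|lra]. lra.
Qed.

Lemma pseries_right_zero (a : nat -> R) (r : R) : 0 < r ->
  (forall t, 0 < t < r -> is_pseries a t 0) -> forall n, a n = 0.
Proof.
  intros Hr H n. apply (PSeries_right_zero r); [exact Hr | |].
  - rewrite <- Rabs_R0. apply (CV_radius_gt_of_series _ (r / 2) 0 0); [lra | |apply H; lra].
    rewrite Rabs_R0; lra.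
  - intros t Ht. now apply is_pseries_unique, H.
Qed.

Lemma pseries_right_unique (a b : nat -> R) (f : R -> R) (r : R) : 0 < r ->
  (forall t, 0 < t < r -> is_pseries a t (f t)) ->
  (forall t, 0 < t < r -> is_pseries b t (f t)) -> forall n, a n = b n.
Proof.
  intros Hr Ha Hb n.
  assert (H0 : PS_minus a b n = 0).
  { apply (pseries_right_zero _ r Hr). intros t Ht.
    replace 0 with (plus (f t) (opp (f t))) by apply (plus_opp_r (f t)).
    apply (is_pseries_minus (V := R_NormedModule)); auto. }
  unfold PS_minus, PS_plus, PS_opp in H0. change (a n + - b n = 0) in H0. lra.
Qed.

Lemma locally'_0_ball (P : R -> Prop) :
  locally' 0 P -> exists r, 0 < r /\ forall t, t <> 0 -> Rabs t < r -> P t.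
Proof.
  intros [d Hd]. exists d. split; [apply cond_pos|]. intros t Ht0 Ht. apply Hd; [|exact Ht0].
  apply ball_of_Rabs.
  now rewrite Rminus_0_r.
Qed.

(** * The coefficients [B n x / n!] *)

Definition bern (B : nat -> R -> R) (x : R) (n : nat) : R := B n x / INR (fact n).

Lemma is_pseries_exp (t : R) : is_pseries (fun n => / INR (fact n)) t (exp t).
Proof. apply is_exp_Reals. Qed.

Lemma exp_sub_1_neq_0 (t : R) : t <> 0 -> exp t - 1 <> 0.
Proof.
  intros Ht H. apply Ht. apply exp_inv. rewrite exp_0. lra.
Qed.

Lemma is_pseries_exp_sub_1 (t : R) : t <> 0 ->
  is_pseries (fun n => / INR (fact (S n))) t ((exp t - 1) / t).
Proof.
  intros Ht. replace ((exp t - 1) / t) with (scal (/ t) (plus (exp t) (opp (/ INR (fact 0))))).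
  - apply (is_pseries_decr_1 (V := R_NormedModule) (fun n => / INR (fact n)) t (/ t)).
    + apply Rinv_l, Ht.
    + apply is_pseries_exp.
  - unfold scal, plus, opp; simpl. unfold mult; simpl. field. exact Ht.
Qed.

(** The Cauchy product of the series of [t e^(xt) / (e^t - 1)] and
    [(e^t - 1) / t] is the series of [e^(xt)]. *)
Lemma bern_mult (B : nat -> R -> R) (x : R) : is_bernoulli_polynomials B -> forall n,
  PS_mult (bern B x) (fun n => / INR (fact (S n))) n = x ^ n * / INR (fact n).
Proof.
  intros HB. destruct (locally'_0_ball _ (HB x)) as (r & Hr & H).
  apply (pseries_right_unique _ (fun n => x ^ n * / INR (fact n))
           (fun t => exp (x * t)) (r / 2)); [lra | |].
  - intros t Ht.
    replace (exp (x * t)) with ((t * exp (x * t) / (exp t - 1)) * ((exp t - 1) / t))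
      by (field; split; [lra | apply exp_sub_1_neq_0; lra]).
    apply is_pseries_mult.
    + apply H; [lra | rewrite Rabs_pos_eq; lra].
    + apply is_pseries_exp_sub_1. lra.
    + eapply (CV_radius_gt_of_series _ (r / 2)); [lra | rewrite Rabs_pos_eq; lra|].
      apply H; [lra | rewrite Rabs_pos_eq; lra].
    + eapply (CV_radius_gt_of_series _ (r / 2)); [lra | rewrite Rabs_pos_eq; lra|].
      apply is_pseries_exp_sub_1. lra.
  - intros t Ht. apply is_pseries_R. pose proof (is_pseries_exp (x * t)) as He.
    apply is_pseries_R in He. eapply is_series_ext; [|exact He].
    intros n. cbv beta. rewrite Rpow_mult_distr. as_R_eq. ring.
Qed.

Lemma bern_recurrence (B : nat -> R -> R) : is_bernoulli_polynomials B -> forall l,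
  sum_n (fun k => bern B 0 k / INR (fact (S (l - k)))) l = if Nat.eqb l 0 then 1 else 0.
Proof.
  intros HB l. rewrite sum_n_Reals. etransitivity; [apply (bern_mult B 0 HB l)|].
  destruct l as [|l]; simpl Nat.eqb.
  - simpl. as_R_eq. field.
  - rewrite pow_i by lia. as_R_eq. ring.
Qed.

Lemma bern_0 (B : nat -> R -> R) (x : R) : is_bernoulli_polynomials B -> bern B x 0 = 1.
Proof.
  intros HB. pose proof (bern_mult B x HB 0) as E. unfold PS_mult in E. simpl in E. lra.
Qed.

(** * The kernel [e^(-vx) / (1 - e^-v) - e^-v / v] *)

(** Functions on the positive half-line that are visibly stable under
    differentiation and decay like [e^(-del v)]. *)
Inductive kernel_class (del : R) : (R -> R) -> Prop :=
| kernel_monomial (a c : R) (i j : nat) : del <= a ->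
    kernel_class del (fun v => c * exp (- (a * v)) * (/ (1 - exp (- v))) ^ i * (/ v) ^ j)
| kernel_sum (f g : R -> R) : kernel_class del f -> kernel_class del g ->
    kernel_class del (fun v => f v + g v).

Lemma kernel_class_derive (del : R) (f : R -> R) : kernel_class del f ->
  exists f', kernel_class del f' /\ forall v, 0 < v -> is_derive f v (f' v).
Proof.
  induction 1 as [a c i j Ha | f g _ (f' & Hf & Hf') _ (g' & Hg & Hg')].
  - exists (fun v => (- (a * c) * exp (- (a * v)) * (/ (1 - exp (- v))) ^ i * (/ v) ^ j
       + - (INR i * c) * exp (- ((a + 1) * v)) * (/ (1 - exp (- v))) ^ (S i) * (/ v) ^ j)
       + - (INR j * c) * exp (- (a * v)) * (/ (1 - exp (- v))) ^ i * (/ v) ^ (S j)).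
    split.
    + repeat apply kernel_sum; apply kernel_monomial; lra.
    + intros v Hv. pose proof (exp_neg_lt_1 v Hv) as He.
      auto_derive; [repeat split; lra|].
      replace (- ((a + 1) * v)) with (- (a * v) + - v) by ring. rewrite exp_plus.
      replace (1 + - exp (- v)) with (1 - exp (- v)) by ring.
      set (W := / (1 - exp (- v))). set (Z := / v).
      assert (HW : - (-1 * - exp (- v)) / ((1 - exp (- v)) * (1 - exp (- v)))  = - (exp (- v)) * W * W)
        by (unfold W; field; lra).
      destruct i as [|i]; destruct j as [|j]; simpl pred; simpl pow;
        try (change (INR 0) with 0); unfold W, Z; field; lra.
  - exists (fun v => f' v + g' v). split; [now apply kernel_sum|].
    intros v Hv. apply (is_derive_plus f g); auto.
Qed.

Lemma kernel_class_decay (del : R) (f : R -> R) : kernel_class del f ->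
  exists C, 0 <= C /\ forall v, 1 <= v -> Rabs (f v) <= C * exp (- (del * v)).
Proof.
  induction 1 as [a c i j Ha | f g _ (C & HC & HfC) _ (D & HD & HgD)].
  - assert (He := exp_neg_lt_1 1 ltac:(lra)).
    set (W := / (1 - exp (- (1)))).
    assert (HW : 0 < W) by (apply Rinv_0_lt_compat; lra).
    exists (Rabs c * W ^ i). split; [apply Rmult_le_pos; [apply Rabs_pos | apply pow_le; lra]|].
    intros v Hv. assert (Hev := exp_neg_lt_1 v ltac:(lra)).
    assert (Hle : exp (- v) <= exp (- (1))) by (apply exp_le; lra).
    assert (H1 : 0 <= (/ (1 - exp (- v))) ^ i <= W ^ i).
    { split; [apply pow_le; left; apply Rinv_0_lt_compat; lra|].
      apply pow_incr. split; [left; apply Rinv_0_lt_compat; lra|].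
      apply Rinv_le_contravar; lra. }
    assert (H2 : 0 <= (/ v) ^ j <= 1).
    { assert (0 < / v <= 1).
      { split; [apply Rinv_0_lt_compat; lra|]. rewrite <- Rinv_1.
        apply Rinv_le_contravar; lra. }
      split; [apply pow_le; lra|]. rewrite <- (pow1 j). apply pow_incr. lra. }
    assert (H3 : 0 < exp (- (a * v)) <= exp (- (del * v))).
    { split; [apply exp_pos | apply exp_le; nra]. }
    rewrite !Rabs_mult, (Rabs_pos_eq (exp _)), (Rabs_pos_eq ((/ v) ^ j)),
      (Rabs_pos_eq ((/ (1 - exp (- v))) ^ i)) by lra.
    pose proof (Rabs_pos c) as Hc.
    apply Rle_trans with (Rabs c * exp (- (a * v)) * (/ (1 - exp (- v))) ^ i * 1).
    + apply Rmult_le_compat_l; [|apply H2].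
      apply Rmult_le_pos; [apply Rmult_le_pos; lra | apply H1].
    + rewrite Rmult_1_r.
      replace (Rabs c * W ^ i * exp (- (del * v))) with (Rabs c * exp (- (del * v)) * W ^ i) by ring.
      apply Rmult_le_compat; [apply Rmult_le_pos; lra | apply H1 | | apply H1].
      apply Rmult_le_compat_l; lra.
  - exists (C + D). split; [lra|]. intros v Hv.
    eapply Rle_trans; [apply Rabs_triang|]. specialize (HfC v Hv). specialize (HgD v Hv). lra.
Qed.

Lemma kernel_class_Derive_n (del : R) (G f : R -> R) :
  kernel_class del f -> (forall v, 0 < v -> G v = f v) ->
  forall n, exists fn, kernel_class del fn /\
    forall v, 0 < v -> Derive_n G n v = fn v /\ ex_derive (Derive_n G n) v.
Proof.
  intros Hf HG.
  assert (Hloc : forall (F H : R -> R) v, 0 < v -> (forall u, 0 < u -> F u = H u) ->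
            locally v (fun u => F u = H u)).
  { intros F H v Hv HFH. exists (mkposreal v Hv). intros u Hu. apply HFH.
    apply Rabs_of_ball in Hu. simpl in Hu. apply Rabs_def2 in Hu. lra. }
  assert (Hstep : forall n fn, kernel_class del fn ->
     (forall v, 0 < v -> Derive_n G n v = fn v) ->
     forall v, 0 < v -> Derive_n G n v = fn v /\ ex_derive (Derive_n G n) v).
  { intros n fn Hfn E v Hv. split; [now apply E|].
    destruct (kernel_class_derive del fn Hfn) as (f' & _ & Hd).
    apply ex_derive_ext_loc with fn.
    - apply Hloc; [exact Hv|]. intros u Hu. symmetry. now apply E.
    - eexists. now apply Hd. }
  assert (Hn : forall n, exists fn, kernel_class del fn /\ forall v, 0 < v -> Derive_n G n v = fn v).
  { induction n as [|n (fn & Hfn & E)]; [now exists f|].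
    destruct (kernel_class_derive del fn Hfn) as (f' & Hf' & Hd).
    exists f'. split; [exact Hf'|]. intros v Hv. simpl.
    rewrite (Derive_ext_loc _ fn); [now apply is_derive_unique, Hd|].
    now apply Hloc. }
  intros n. destruct (Hn n) as (fn & Hfn & E). exists fn. split; [exact Hfn|].
  now apply Hstep.
Qed.

(** The exponential bound beyond 1 is explicit; on the unit interval continuity
    is enough. *)
Lemma decay_from_1 (f : R -> R) (del C : R) : 0 < del -> 0 <= C ->
  (forall v, 0 <= v -> ex_derive f v) ->
  (forall v, 1 <= v -> Rabs (f v) <= C * exp (- (del * v))) ->
  exists C', 0 <= C' /\ forall v, 0 <= v -> Rabs (f v) <= C' * exp (- (del * v)).
Proof.
  intros Hdel HC Hd Hf.
  destruct (bounded_continuity (V := R_NormedModule) f 0 1) as [M HM].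
  { intros v Hv. apply (ex_derive_continuous f). apply Hd. lra. }
  assert (HM0 : 0 <= M).
  { left. eapply Rle_lt_trans; [|apply (HM 0); lra]. apply norm_ge_0. }
  exists (C + M * exp del). pose proof (exp_pos del) as He.
  split; [nra|]. intros v Hv. pose proof (exp_pos (- (del * v))) as Hev.
  destruct (Rle_lt_dec 1 v) as [H1|H1].
  - specialize (Hf v H1). assert (0 <= M * exp del * exp (- (del * v))) by
      (repeat apply Rmult_le_pos; lra). lra.
  - specialize (HM v ltac:(lra)). change (norm (f v)) with (Rabs (f v)) in HM.
    assert (1 <= exp del * exp (- (del * v))).
    { rewrite <- exp_plus, <- exp_0. apply exp_le. nra. }
    assert (0 <= C * exp (- (del * v))) by (apply Rmult_le_pos; lra). nra.
Qed.

Lemma nondecreasing_of_derive (F f : R -> R) :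
  (forall v, 0 <= v -> is_derive F v (f v)) -> (forall v, 0 <= v -> 0 <= f v) ->
  forall u v, 0 <= u <= v -> F u <= F v.
Proof.
  intros Hd Hf u v Huv.
  destruct (mean_value F f u v) as (c & Hc & E); [lra | intros w Hw; apply Hd; lra |].
  specialize (Hf c ltac:(lra)). nra.
Qed.

(** Adding and subtracting [C/del e^(-del v)] makes a primitive monotone, so the
    two modified primitives squeeze a limit at infinity. *)
Lemma decay_primitive (F f : R -> R) (del C : R) : 0 < del -> 0 <= C ->
  (forall v, 0 <= v -> is_derive F v (f v)) ->
  (forall v, 0 <= v -> Rabs (f v) <= C * exp (- (del * v))) ->
  exists A, forall v, 0 <= v -> Rabs (F v - A) <= C / del * exp (- (del * v)).
Proof.
  intros Hdel HC Hd Hf.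
  set (e := fun v => C / del * exp (- (del * v))).
  assert (He : forall v, is_derive e v (- (C * exp (- (del * v))))).
  { intros v. unfold e. auto_derive; [trivial | field; lra]. }
  assert (Hlow : forall u v, 0 <= u <= v -> F u - e u <= F v - e v).
  { apply (nondecreasing_of_derive (fun v => F v - e v) (fun v => f v - - (C * exp (- (del * v))))).
    - intros v Hv. apply (is_derive_minus F e); [now apply Hd | apply He].
    - intros v Hv. specialize (Hf v Hv). apply Rabs_le_between in Hf. lra. }
  assert (Hup : forall u v, 0 <= u <= v -> - (F u + e u) <= - (F v + e v)).
  { apply (nondecreasing_of_derive (fun v => - (F v + e v))
             (fun v => - (f v + - (C * exp (- (del * v)))))).
    - intros v Hv. apply (is_derive_opp (fun v => F v + e v)).
      apply (is_derive_plus F e); [now apply Hd | apply He].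
    - intros v Hv. specialize (Hf v Hv). apply Rabs_le_between in Hf. lra. }
  assert (Hpos : forall v, 0 <= e v).
  { intros v. apply Rmult_le_pos; [|left; apply exp_pos].
    apply Rmult_le_pos; [exact HC | left; now apply Rinv_0_lt_compat]. }
  assert (Hcross : forall u v, 0 <= u -> 0 <= v -> F u - e u <= F v + e v).
  { intros u v Hu Hv. pose proof (Hpos (Rmax u v)).
    pose proof (Rmax_l u v). pose proof (Rmax_r u v).
    pose proof (Hlow u (Rmax u v) ltac:(lra)). pose proof (Hup v (Rmax u v) ltac:(lra)). lra. }
  destruct (completeness (fun y => exists u, 0 <= u /\ y = F u - e u)) as [A [HA1 HA2]].
  - exists (F 0 + e 0). intros y (u & Hu & ->). apply Hcross; lra.
  - exists (F 0 - e 0), 0. split; [lra | reflexivity].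
  - exists A. intros v Hv. fold (e v). apply Rabs_le. split.
    + assert (A <= F v + e v); [|lra]. apply HA2. intros y (u & Hu & ->). now apply Hcross.
    + assert (F v - e v <= A); [|lra]. apply HA1. now exists v.
Qed.

(** * The expansion of the q-digamma function *)

Definition kernel_coef (B : nat -> R -> R) (x : R) (n : nat) : R :=
  (-1) ^ S n * (bern B x (S n) - / INR (fact (S n))).

(** The summand whose sum over the multiples of [t] is [- psi_q(x) / t]. *)
Definition kernel_formula (x v : R) : R :=
  exp (- (x * v)) / (1 - exp (- v)) - exp (- v) / v.

Definition kernel (B : nat -> R -> R) (x v : R) : R :=
  if Req_EM_T v 0 then kernel_coef B x 0 else kernel_formula x v.

Lemma kernel_neq_0 (B : nat -> R -> R) (x v : R) : v <> 0 -> kernel B x v = kernel_formula x v.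
Proof. intros Hv. unfold kernel. destruct (Req_EM_T v 0); [contradiction | reflexivity]. Qed.

Lemma kernel_pseries (B : nat -> R -> R) (x : R) : is_bernoulli_polynomials B ->
  exists r, 0 < r /\ Rbar_lt r (CV_radius (kernel_coef B x)) /\
    forall v, Rabs v < r -> kernel B x v = PSeries (kernel_coef B x) v.
Proof.
  intros HB. destruct (locally'_0_ball _ (HB x)) as (r & Hr & H).
  assert (Hp : forall v, v <> 0 -> Rabs v < r ->
            is_pseries (kernel_coef B x) v (kernel_formula x v)).
  { intros v Hv0 Hv.
    assert (Hv' : - v <> 0) by lra.
    pose proof (H (- v) Hv' ltac:(now rewrite Rabs_Ropp)) as H1.
    pose proof (is_pseries_minus (V := R_NormedModule) _ _ _ _ _ H1 (is_pseries_exp (- v))) as H2.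
    pose proof (is_pseries_decr_1 (V := R_NormedModule) _ (- v) (/ (- v)) _
                  (Rinv_l _ Hv') H2) as H3.
    apply (is_pseries_R (PS_decr_1 _)) in H3.
    apply is_pseries_R.
    pose proof (is_series_scal (V := R_NormedModule) (-1) _ _ H3) as H4.
    replace (kernel_formula x v) with
      (scal (-1) (scal (/ - v) (plus (plus (- v * exp (x * - v) / (exp (- v) - 1))
          (opp (exp (- v)))) (opp (PS_minus (fun n => B n x / INR (fact n))
              (fun n => / INR (fact n)) 0%nat))))).
    - eapply is_series_ext; [|exact H4]. intros n.
      unfold kernel_coef, bern, PS_decr_1, PS_minus, PS_plus, PS_opp, scal, plus, opp; simpl.
      unfold mult; simpl. replace (- v) with (-1 * v) by ring. rewrite Rpow_mult_distr.
      as_R_eq. unfold Rdiv. ring.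
    - pose proof (bern_0 B x HB) as Hb0. unfold bern in Hb0.
      assert (He : exp (- v) - 1 <> 0) by now apply exp_sub_1_neq_0.
      unfold PS_minus, PS_plus, PS_opp, scal, plus, opp; simpl. unfold mult; simpl.
      simpl in Hb0. rewrite Hb0. unfold kernel_formula.
      replace (x * - v) with (- (x * v)) by ring. field. repeat split; lra. }
  assert (Hcv : Rbar_lt (r / 4) (CV_radius (kernel_coef B x))).
  { rewrite <- (Rabs_pos_eq (r / 4)) by lra.
    apply (CV_radius_gt_of_series _ (r / 2) _ (kernel_formula x (r / 2))); [lra | |];
      [|apply Hp; [lra|]]; rewrite Rabs_pos_eq; lra. }
  exists (r / 4). split; [lra|]. split; [exact Hcv|].
  intros v Hv. unfold kernel. destruct (Req_EM_T v 0) as [->|Hv0].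
  - now rewrite PSeries_0.
  - symmetry. apply is_pseries_unique, Hp; [exact Hv0 | lra].
Qed.

Lemma kernel_class_kernel (x : R) : 0 < x -> exists f,
  kernel_class (Rmin x 1) f /\ forall v, kernel_formula x v = f v.
Proof.
  intros Hx.
  exists (fun v => 1 * exp (- (x * v)) * (/ (1 - exp (- v))) ^ 1 * (/ v) ^ 0
            + -1 * exp (- (1 * v)) * (/ (1 - exp (- v))) ^ 0 * (/ v) ^ 1).
  split.
  - apply kernel_sum; apply kernel_monomial; [apply Rmin_l | apply Rmin_r].
  - intros v. unfold kernel_formula. rewrite Rmult_1_l. simpl. unfold Rdiv.
    rewrite Rmult_1_l. ring.
Qed.

Lemma ex_derive_kernel (B : nat -> R -> R) (x : R) (n : nat) (v : R) :
  is_bernoulli_polynomials B -> 0 < x -> 0 <= v -> ex_derive (Derive_n (kernel B x) n) v.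
Proof.
  intros HB Hx Hv. destruct (Req_dec v 0) as [->|Hv0].
  - destruct (kernel_pseries B x HB) as (r & Hr & Hcv & H).
    apply (ex_derive_n_ext_loc (PSeries (kernel_coef B x)) (kernel B x) (S n)).
    + exists (mkposreal r Hr). intros u Hu. symmetry. apply H.
      apply Rabs_of_ball in Hu. now rewrite Rminus_0_r in Hu.
    + apply ex_derive_n_PSeries. rewrite Rabs_R0.
      apply Rbar_lt_trans with r; [simpl; lra | exact Hcv].
  - destruct (kernel_class_kernel x Hx) as (f & Hf & E).
    destruct (kernel_class_Derive_n (Rmin x 1) (kernel B x) f Hf) with (n := n) as (fn & _ & Hfn).
    + intros u Hu. rewrite kernel_neq_0 by lra. apply E.
    + apply Hfn. lra.
Qed.

Lemma kernel_decay (B : nat -> R -> R) (x : R) (n : nat) :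
  is_bernoulli_polynomials B -> 0 < x ->
  exists C, 0 <= C /\
    forall v, 0 <= v -> Rabs (Derive_n (kernel B x) n v) <= C * exp (- (Rmin x 1 * v)).
Proof.
  intros HB Hx.
  destruct (kernel_class_kernel x Hx) as (f & Hf & E).
  destruct (kernel_class_Derive_n (Rmin x 1) (kernel B x) f Hf) with (n := n) as (fn & Hfn & Hd).
  { intros u Hu. rewrite kernel_neq_0 by lra. apply E. }
  destruct (kernel_class_decay _ _ Hfn) as (C & HC & HCd).
  apply (decay_from_1 _ _ C); [apply Rmin_glb_lt; lra | exact HC | |].
  - intros v Hv. now apply ex_derive_kernel.
  - intros v Hv. destruct (Hd v) as [-> _]; [lra|]. now apply HCd.
Qed.

Lemma is_derive_RInt_kernel (B : nat -> R -> R) (x v : R) :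
  is_bernoulli_polynomials B -> 0 < x -> 0 <= v ->
  is_derive (fun v => RInt (kernel B x) 0 v) v (kernel B x v).
Proof.
  intros HB Hx Hv. destruct (kernel_pseries B x HB) as (r & Hr & Hcv & H).
  assert (Hc : forall u, - r < u -> continuous (kernel B x) u).
  { intros u Hu. destruct (Rle_lt_dec 0 u) as [Hu0|Hu0].
    - apply (ex_derive_continuous (kernel B x)). now apply (ex_derive_kernel B x 0).
    - apply (continuous_ext_loc _ (PSeries (kernel_coef B x))).
      + assert (Hd : 0 < r - Rabs u) by (rewrite Rabs_left; lra).
        exists (mkposreal _ Hd). intros w Hw. symmetry. apply H.
        apply Rabs_of_ball in Hw. simpl in Hw. replace w with ((w - u) + u) by ring.
        eapply Rle_lt_trans; [apply Rabs_triang | lra].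
      + apply continuity_pt_filterlim, PSeries_continuity.
        apply Rbar_lt_trans with r; [simpl; rewrite Rabs_left; lra | exact Hcv]. }
  apply (is_derive_RInt (V := R_NormedModule) (kernel B x) _ 0).
  - exists (mkposreal r Hr). intros u Hu.
    apply Rabs_of_ball in Hu. simpl in Hu. apply Rabs_def2 in Hu.
    apply (RInt_correct (V := R_CompleteNormedModule)),
      (ex_RInt_continuous (V := R_CompleteNormedModule)).
    intros w Hw. apply Hc. unfold Rmin in Hw. destruct (Rle_dec 0 u); lra.
  - apply Hc. lra.
Qed.

(** The primitive is normalized by its limit at infinity, which makes it part of
    the jet; its value at 0 is identified later, as the limit of [psi_q]. *)
Lemma kernel_jet (B : nat -> R -> R) (x : R) : is_bernoulli_polynomials B -> 0 < x ->
  exists d, decaying_jet d /\ (forall v, 0 < v -> d 1%nat v = kernel_formula x v) /\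
    forall k, d (S k) 0 = INR (fact k) * kernel_coef B x k.
Proof.
  intros HB Hx. set (del := Rmin x 1).
  assert (Hdel : 0 < del) by (apply Rmin_glb_lt; lra).
  destruct (kernel_decay B x 0 HB Hx) as (C & HC & HCd).
  destruct (decay_primitive (fun v => RInt (kernel B x) 0 v) (kernel B x) del C Hdel HC)
    as [A HA].
  { intros v Hv. now apply is_derive_RInt_kernel. }
  { exact HCd. }
  exists (fun j => match j with
                   | O => fun v => RInt (kernel B x) 0 v - A
                   | S j => Derive_n (kernel B x) j
                   end).
  split; [|split].
  - split.
    + intros [|j] v Hv.
      * replace (Derive_n (kernel B x) 0 v) with (kernel B x v - 0) by (simpl; ring).
        apply (is_derive_minus (fun v => RInt (kernel B x) 0 v) (fun _ => A));
          [now apply is_derive_RInt_kernel | apply (is_derive_const A)].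
      * apply Derive_correct. now apply ex_derive_kernel.
    + exists del. split; [exact Hdel|]. intros [|j].
      * exists (C / del). split; [|exact HA].
        apply Rmult_le_pos; [exact HC | left; now apply Rinv_0_lt_compat].
      * now apply kernel_decay.
  - intros v Hv. simpl. apply kernel_neq_0. lra.
  - intros k. destruct (kernel_pseries B x HB) as (r & Hr & Hcv & H).
    rewrite (Derive_n_ext_loc _ (PSeries (kernel_coef B x))).
    + rewrite Derive_n_coef; [ring|]. apply Rbar_lt_trans with r; [simpl; lra | exact Hcv].
    + exists (mkposreal r Hr). intros u Hu. apply H.
      apply Rabs_of_ball in Hu. now rewrite Rminus_0_r in Hu.
Qed.

(** The term [e^-v / v] of the kernel accounts for [ln (1 - q)], through the
    logarithmic series. *)
Lemma q_digamma_lattice_sum (x t : R) (f : R -> R) : 0 < x -> 0 < t ->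
  (forall v, 0 < v -> f v = kernel_formula x v) ->
  q_digamma (exp (- t)) x = - (t * lattice_sum f t).
Proof.
  intros Hx Ht Hf. set (q := exp (- t)).
  assert (Hq : 0 < q < 1) by now apply exp_neg_lt_1.
  rewrite q_digamma_eq by assumption.
  rewrite (is_series_unique _ _ (is_series_q_digamma_term q x Hq Hx)).
  pose proof (Rpower_lt_1 q x Hq Hx) as Hz.
  destruct (is_series_lambert q (Rpower q x) Hq Hz) as [Hex _].
  pose proof (is_series_log q ltac:(lra)) as Hlog.
  unfold q at 2. rewrite ln_exp. unfold lattice_sum.
  rewrite (Series_ext (fun m => f (INR (S m) * t))
    (fun m => 1 / (1 - q ^ S m) * Rpower q x ^ S m - / t * (/ INR (S m) * q ^ S m))).
  - rewrite Series_minus, Series_scal_l; [|exact Hex |].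
    + rewrite (is_series_unique _ _ Hlog). field. lra.
    + apply ex_series_Rmult_l. eexists; exact Hlog.
  - intros m. assert (Hm : 0 < INR (S m)) by (apply lt_0_INR; lia).
    rewrite Hf by nra. unfold kernel_formula.
    assert (E1 : exp (- (INR (S m) * t)) = q ^ S m).
    { unfold q. rewrite <- exp_mult_INR. f_equal. ring. }
    assert (E2 : exp (- (x * (INR (S m) * t))) = Rpower q x ^ S m).
    { unfold Rpower, q. rewrite ln_exp. replace (x * - t) with (- (x * t)) by ring.
      rewrite <- exp_mult_INR. f_equal. ring. }
    rewrite E1, E2. pose proof (one_minus_pow_pos q m Hq).
    field. repeat split; lra.
Qed.

Lemma eq_of_approx (a b C : R) (u : nat -> R) :
  is_lim_seq u 0 -> (forall n, Rabs (a - b) <= C * u n) -> a = b.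
Proof.
  intros Hu H. assert (Hab : Rabs (a - b) <= 0).
  { apply (is_lim_seq_le (fun _ => Rabs (a - b)) (fun n => C * u n) (Rabs (a - b)) 0);
      [exact H | apply is_lim_seq_const |].
    replace (Finite 0) with (Rbar_mult C 0) by (simpl; f_equal; ring).
    now apply is_lim_seq_scal_l. }
  pose proof (Rabs_pos (a - b)). apply Rminus_diag_uniq, Rabs_eq_0. lra.
Qed.

(** Both [digamma x] and the limit of [psi_q(x)] are approximated by the same
    partial sums up to [O(1/n)]. *)
Lemma q_digamma_limit (x l K : R) : 0 < x ->
  (forall t, 0 < t <= 1 -> Rabs (q_digamma (exp (- t)) x - l) <= K * t) -> l = digamma x.
Proof.
  intros Hx H.
  apply (eq_of_approx _ _ 6 (fun n => / (x + INR n))); [apply is_lim_seq_inv_shift|].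
  intros n.
  pose proof (pos_INR n) as Hn0.
  assert (Hn : 0 < / (x + INR n)) by (apply Rinv_0_lt_compat; lra).
  destruct (q_digamma_approx x n Hx) as (f & Hf & Hqf).
  fold (digamma_partial x n) in Hf.
  apply is_lim_spec in Hf.
  destruct (Hf (mkposreal _ Hn)) as [d Hd]. simpl in Hd.
  set (K' := Rabs K + 1).
  assert (HK' : 0 < K') by (unfold K'; pose proof (Rabs_pos K); lra).
  set (s := Rmin (Rmin d 1) (/ (x + INR n) / K')).
  assert (Hs : 0 < s).
  { apply Rmin_glb_lt; [apply Rmin_glb_lt; [apply cond_pos | lra] | now apply Rdiv_lt_0_compat]. }
  pose proof (Rmin_l (Rmin d 1) (/ (x + INR n) / K')) as S1. fold s in S1.
  pose proof (Rmin_r (Rmin d 1) (/ (x + INR n) / K')) as S2. fold s in S2.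
  pose proof (Rmin_l d 1). pose proof (Rmin_r d 1).
  set (t := s / 2).
  specialize (H t ltac:(unfold t; lra)).
  specialize (Hqf t ltac:(unfold t; lra)).
  assert (Hft : Rabs (f t - digamma_partial x n) < / (x + INR n)).
  { apply Hd; [|unfold t; lra].
    apply ball_of_Rabs.
    rewrite Rminus_0_r, Rabs_pos_eq; unfold t; lra. }
  pose proof (digamma_approx x n Hx) as Hdig.
  assert (Hinv : / (x + INR (S n)) <= / (x + INR n)).
  { apply Rinv_le_contravar; [lra|]. rewrite S_INR. lra. }
  assert (HKt : K * t <= / (x + INR n)).
  { apply Rle_trans with (K' * s).
    - apply Rle_trans with (K' * t); [|unfold t; nra].
      apply Rmult_le_compat_r; [unfold t; lra|]. unfold K'. pose proof (Rle_abs K). lra.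
    - apply (Rmult_le_compat_l K') in S2; [|lra].
      replace (K' * (/ (x + INR n) / K')) with (/ (x + INR n)) in S2 by (field; lra). exact S2. }
  unfold Rdiv in Hdig.
  apply Rabs_le_between in H. apply Rabs_le_between in Hqf.
  apply Rabs_def2 in Hft. apply Rabs_le_between in Hdig.
  apply Rabs_le. lra.
Qed.

(** The number [zeta(1-k) / k! * (1 - B_k(x)) * (-1)^k], with the zeta value
    expressed by a Bernoulli number. *)
Definition expansion_coef (B : nat -> R -> R) (x : R) (k : nat) : R :=
  bern B 0 k * INR (fact (pred k)) * (bern B x k - / INR (fact k)).

Lemma sum_n_head (F : nat -> R) (N : nat) : sum_n F N = F 0%nat + sum_n_m F 1 N.
Proof. unfold sum_n. rewrite sum_Sn_m by lia. reflexivity. Qed.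

Lemma q_digamma_expansion (B : nat -> R -> R) (x : R) (N : nat) :
  is_bernoulli_polynomials B -> 0 < x ->
  exists K, forall t, 0 < t <= 1 ->
    Rabs (q_digamma (exp (- t)) x
          - (digamma x + sum_n_m (fun k => expansion_coef B x k * t ^ k) 1 N)) <= K * t ^ S N.
Proof.
  intros HB Hx.
  destruct (kernel_jet B x HB Hx) as (d & Hjet & Hd1 & Hd0).
  assert (Hexp : forall M, exists K, forall t, 0 < t <= 1 ->
    Rabs (q_digamma (exp (- t)) x
          - (d 0%nat 0 + sum_n_m (fun k => expansion_coef B x k * t ^ k) 1 M)) <= K * t ^ S M).
  { intros M.
    destruct (euler_maclaurin (bern B 0) d M (bern_recurrence B HB) Hjet) as [K HK].
    exists K. intros t Ht. specialize (HK t Ht).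
    rewrite (q_digamma_lattice_sum x t (d 1%nat)) by (assumption || lra).
    rewrite sum_n_head, bern_0, pow_O in HK by exact HB.
    rewrite (sum_n_m_ext_loc _ (fun k => expansion_coef B x k * t ^ k)) in HK.
    - rewrite <- Rabs_Ropp.
      match goal with |- Rabs ?a <= _ => match type of HK with Rabs ?b <= _ =>
        replace a with b by ring end end.
      exact HK.
    - intros [|k] Hk; [lia|]. rewrite Hd0. unfold expansion_coef, kernel_coef. simpl pred.
      replace (- t) with (-1 * t) by ring. rewrite Rpow_mult_distr.
      assert (E : (-1) ^ S k * (-1) ^ S k = 1).
      { rewrite <- Rpow_mult_distr. replace (-1 * -1) with 1 by ring. apply pow1. }
      transitivity (((-1) ^ S k * (-1) ^ S k) * (bern B 0 (S k) * INR (fact k) *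
         (bern B x (S k) - / INR (fact (S k))) * t ^ S k)); [as_R_eq; ring|].
      rewrite E. as_R_eq. ring. }
  assert (Hlim : d 0%nat 0 = digamma x).
  { destruct (Hexp 0%nat) as [K HK]. apply (q_digamma_limit x _ K Hx).
    intros t Ht. specialize (HK t Ht). rewrite pow_1 in HK.
    rewrite sum_n_m_zero in HK by lia. change (@zero _) with 0 in HK.
    now rewrite Rplus_0_r in HK. }
  rewrite <- Hlim. apply Hexp.
Qed.

(** * The expansion of ln (t / (1 - e^-t)) *)

Lemma PSeries_truncation (r : R) (N : nat) : forall a : nat -> R,
  0 < r -> Rbar_lt r (CV_radius a) ->
  exists K, forall t, 0 <= t <= r ->
    Rabs (PSeries a t - sum_n (fun k => a k * t ^ k) N) <= K * t ^ S N.
Proof.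
  assert (Hin : forall (a : nat -> R) t, Rbar_lt r (CV_radius a) -> 0 <= t <= r ->
            Rbar_lt (Rabs t) (CV_radius a)).
  { intros a t Ha Ht. apply Rbar_le_lt_trans with r; [|exact Ha].
    simpl. rewrite Rabs_pos_eq; lra. }
  induction N as [|N IH]; intros a Hr Ha.
  - destruct (bounded_continuity (V := R_NormedModule) (PSeries (PS_decr_1 a)) 0 r) as [K HK].
    { intros t Ht. apply continuity_pt_filterlim, PSeries_continuity.
      rewrite CV_radius_decr_1. now apply Hin. }
    exists K. intros t Ht. rewrite sum_O, pow_O, pow_1, Rmult_1_r.
    rewrite PSeries_decr_1 by (apply CV_radius_inside; now apply Hin).
    replace (a 0%nat + t * PSeries (PS_decr_1 a) t - a 0%nat)
      with (PSeries (PS_decr_1 a) t * t) by ring.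
    rewrite Rabs_mult, (Rabs_pos_eq t) by lra. apply Rmult_le_compat_r; [lra|].
    left. now apply HK.
  - destruct (IH (PS_decr_1 a) Hr) as [K HK]; [now rewrite CV_radius_decr_1|].
    exists K. intros t Ht. specialize (HK t Ht).
    rewrite sum_n_first, pow_O, Rmult_1_r.
    rewrite PSeries_decr_1 by (apply CV_radius_inside; now apply Hin).
    rewrite (sum_n_ext (fun j => a (S j) * t ^ S j) (fun j => t * (PS_decr_1 a j * t ^ j)))
      by (intros j; unfold PS_decr_1; simpl; as_R_eq; ring).
    rewrite sum_n_Rmult_l.
    match goal with |- Rabs ?x <= _ => replace x with
      ((PSeries (PS_decr_1 a) t - sum_n (fun k => PS_decr_1 a k * t ^ k) N) * t) by ring end.
    rewrite Rabs_mult, (Rabs_pos_eq t) by lra.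
    replace (K * t ^ S (S N)) with (K * t ^ S N * t) by (simpl; ring).
    apply Rmult_le_compat_r; lra.
Qed.

Definition log_gen_coef (b : nat -> R) (n : nat) : R :=
  match n with O => 0 | S _ => b n / INR n end.

Lemma ln_gen_bounds (t : R) : 0 < t -> 0 <= ln (t / (1 - exp (- t))) <= t.
Proof.
  intros Ht. pose proof (exp_neg_lt_1 t Ht) as He.
  pose proof (exp_ineq1_le (- t)) as H1. pose proof (exp_ineq1_le t) as H2.
  assert (H3 : exp (- t) <= / (1 + t)).
  { rewrite exp_Ropp. apply Rinv_le_contravar; lra. }
  assert (H4 : 1 <= t / (1 - exp (- t))).
  { apply Rmult_le_reg_r with (1 - exp (- t)); [lra|]. field_simplify; lra. }
  assert (H5 : t / (1 - exp (- t)) <= 1 + t).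
  { apply Rmult_le_reg_r with (1 - exp (- t)); [lra|].
    replace (t / (1 - exp (- t)) * (1 - exp (- t))) with t by (field; lra).
    assert ((1 + t) * exp (- t) <= 1); [|lra].
    apply (Rmult_le_compat_l (1 + t)) in H3; [|lra]. rewrite Rinv_r in H3; lra. }
  split.
  - rewrite <- ln_1. apply ln_le; lra.
  - eapply Rle_trans; [apply ln_le_sub_1; lra | lra].
Qed.

(** The derivative of [ln (t / (1 - e^-t))] is [1/t - 1/(e^t - 1)], whose power
    series is minus the formal derivative of [log_gen_coef]; so the two sides
    differ by a constant, and both tend to 0 at 0. *)
Lemma ln_gen_pseries (B : nat -> R -> R) : is_bernoulli_polynomials B ->
  exists r, 0 < r /\ Rbar_lt r (CV_radius (log_gen_coef (bern B 0))) /\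
    forall t, 0 < t <= r ->
      ln (t / (1 - exp (- t))) = - PSeries (log_gen_coef (bern B 0)) t.
Proof.
  intros HB. destruct (locally'_0_ball _ (HB 0)) as (r & Hr & H).
  set (b := bern B 0). set (c := log_gen_coef b).
  assert (Hdc : forall n, PS_derive c n = PS_decr_1 b n).
  { intros n. unfold PS_derive, PS_decr_1, c, log_gen_coef. field. apply not_0_INR. lia. }
  assert (Hb : forall t, 0 < t < r -> is_pseries b t (t / (exp t - 1))).
  { intros t Ht. specialize (H t ltac:(lra) ltac:(rewrite Rabs_pos_eq; lra)).
    now rewrite Rmult_0_l, exp_0, Rmult_1_r in H. }
  assert (Hcv : Rbar_lt (r / 4) (CV_radius c)).
  { rewrite <- CV_radius_derive. rewrite (CV_radius_ext _ (PS_decr_1 b)) by exact Hdc.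
    rewrite CV_radius_decr_1.
    rewrite <- (Rabs_pos_eq (r / 4)) by lra.
    apply (CV_radius_gt_of_series b (r / 2) _ (r / 2 / (exp (r / 2) - 1)));
      [lra | rewrite Rabs_pos_eq; lra | apply Hb; lra]. }
  exists (r / 4). split; [lra|]. split; [exact Hcv|].
  set (L := fun t => ln (t / (1 - exp (- t))) + PSeries c t).
  assert (HL : forall t, 0 < t <= r / 4 -> is_derive L t 0).
  { intros t Ht. pose proof (exp_neg_lt_1 t ltac:(lra)) as He.
    assert (Hpt : Rbar_lt (Rabs t) (CV_radius c)).
    { apply Rbar_le_lt_trans with (r / 4); [simpl; rewrite Rabs_pos_eq; lra | exact Hcv]. }
    assert (Ed : PSeries (PS_derive c) t = / t * (t / (exp t - 1) - 1)).
    { rewrite (PSeries_ext _ _ _ Hdc).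
      pose proof (is_pseries_unique _ _ _ (Hb t ltac:(lra))) as Eb.
      rewrite PSeries_decr_1 in Eb by (eexists; apply Hb; lra).
      unfold b in Eb at 1. rewrite bern_0 in Eb by exact HB. fold b in Eb.
      rewrite <- Eb. field. lra. }
    replace 0 with ((/ t - exp (- t) / (1 - exp (- t))) + PSeries (PS_derive c) t).
    - apply (is_derive_plus (fun t => ln (t / (1 - exp (- t)))) (PSeries c)).
      + auto_derive; [split; [lra|]; split; [apply Rdiv_lt_0_compat; lra | trivial]|].
        field. lra.
      + now apply is_derive_PSeries.
    - rewrite Ed. rewrite exp_Ropp in *.
      assert (exp t - 1 <> 0) by (apply exp_sub_1_neq_0; lra).
      pose proof (exp_pos t). field. repeat split; lra. }
  assert (Hconst : forall t u, 0 < t < u -> u <= r / 4 -> L t = L u).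
  { intros t u Htu Hu. apply eq_is_derive; [|lra].
    intros w Hw. apply HL. lra. }
  destruct (PSeries_truncation (r / 4) 0 c ltac:(lra) Hcv) as [K HK].
  intros t Ht. assert (E : L t = 0).
  { (* [L] is constant, and its value at the points [/ (/ t + n)] tends to 0 *)
    apply (eq_of_approx _ _ (1 + K) (fun n => / (/ t + INR n))); [apply is_lim_seq_inv_shift|].
    intros n. pose proof (pos_INR n) as Hn.
    assert (Hti : 0 < / t) by (apply Rinv_0_lt_compat; lra).
    set (u := / (/ t + INR n)).
    assert (Hu : 0 < u <= t).
    { split; [apply Rinv_0_lt_compat; lra|]. rewrite <- (Rinv_inv t).
      apply Rinv_le_contravar; lra. }
    replace (L t) with (L u).
    2:{ destruct (Req_dec u t) as [->|Hne]; [reflexivity | apply Hconst; lra]. }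
    specialize (HK u ltac:(lra)). rewrite sum_O, pow_1, Rmult_0_l, Rminus_0_r in HK.
    pose proof (ln_gen_bounds u ltac:(lra)) as Hln.
    rewrite Rminus_0_r. eapply Rle_trans; [apply Rabs_triang|].
    rewrite (Rabs_pos_eq (ln _)) by lra. lra. }
  unfold L in E. lra.
Qed.

Lemma ln_gen_expansion (B : nat -> R -> R) (N : nat) : is_bernoulli_polynomials B ->
  exists K r, 0 < r /\ forall t, 0 < t <= r ->
    Rabs (ln (t / (1 - exp (- t)))
          + sum_n_m (fun k => bern B 0 k * INR (fact (pred k)) / INR (fact k) * t ^ k) 1 N)
      <= K * t ^ S N.
Proof.
  intros HB. destruct (ln_gen_pseries B HB) as (r & Hr & Hcv & H).
  destruct (PSeries_truncation r N _ Hr Hcv) as [K HK].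
  exists K, r. split; [exact Hr|]. intros t Ht. specialize (HK t ltac:(lra)).
  rewrite H by exact Ht. rewrite sum_n_head in HK. simpl log_gen_coef at 2 in HK.
  rewrite (sum_n_m_ext_loc _ (fun k => bern B 0 k * INR (fact (pred k)) / INR (fact k) * t ^ k))
    in HK.
  - rewrite <- Rabs_Ropp.
    match goal with |- Rabs ?a <= _ => match type of HK with Rabs ?b <= _ =>
      replace a with b by ring end end.
    exact HK.
  - intros [|k] Hk; [lia|]. unfold log_gen_coef. simpl pred.
    rewrite fact_simpl, mult_INR. as_R_eq. field.
    split; [apply INR_fact_neq_0 | apply not_0_INR; lia].
Qed.

(** * Complex series *)

Notation is_Cseries := (@is_series C_AbsRing C_NormedModule).
Notation ex_Cseries := (@ex_series C_AbsRing C_NormedModule).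
Notation is_Cpseries := (@is_pseries C_AbsRing C_NormedModule).
Notation Csum_n := (@sum_n C_AbelianMonoid).

Lemma locally_Cmod (z0 : C) (P : C -> Prop) :
  locally (T := C_UniformSpace) z0 P <-> exists r, 0 < r /\ forall z, Cmod (z - z0) < r -> P z.
Proof.
  split.
  - intros H. apply (locally_norm_le_locally (V := C_NormedModule) z0) in H.
    destruct H as [eps H]. exists eps. split; [apply cond_pos|]. intros z Hz. now apply H.
  - intros (r & Hr & H). apply (locally_le_locally_norm (V := C_NormedModule) z0).
    exists (mkposreal r Hr). intros z Hz. now apply H.
Qed.

Lemma Re_sum_n (a : nat -> C) (N : nat) : Re (Csum_n a N) = sum_n (fun k => Re (a k)) N.
Proof.
  induction N as [|N IH]; [now rewrite !sum_O|]. rewrite !sum_Sn, <- IH. reflexivity.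
Qed.

Lemma Im_sum_n (a : nat -> C) (N : nat) : Im (Csum_n a N) = sum_n (fun k => Im (a k)) N.
Proof.
  induction N as [|N IH]; [now rewrite !sum_O|]. rewrite !sum_Sn, <- IH. reflexivity.
Qed.

Lemma is_Cseries_components (a : nat -> C) (l : C) :
  is_Cseries a l <-> is_series (fun k => Re (a k)) (Re l) /\ is_series (fun k => Im (a k)) (Im l).
Proof.
  split.
  - intros H. split.
    + apply (filterlim_ext (fun N => Re (Csum_n a N))); [intros N; apply Re_sum_n|].
      apply (filterlim_comp _ _ _ (Csum_n a) Re _ (locally (T := C_UniformSpace) l)); [exact H|].
      intros P [eps HP]. exists eps. intros z [Hz _]. now apply HP.
    + apply (filterlim_ext (fun N => Im (Csum_n a N))); [intros N; apply Im_sum_n|].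
      apply (filterlim_comp _ _ _ (Csum_n a) Im _ (locally (T := C_UniformSpace) l)); [exact H|].
      intros P [eps HP]. exists eps. intros z [_ Hz]. now apply HP.
  - intros [H1 H2] P [eps HP].
    assert (B1 : locally (Re l) (fun u => ball (Re l) eps u)) by (exists eps; trivial).
    assert (B2 : locally (Im l) (fun u => ball (Im l) eps u)) by (exists eps; trivial).
    assert (A1 : eventually (fun N => ball (Re l) eps (sum_n (fun k => Re (a k)) N)))
      by exact (H1 _ B1).
    assert (A2 : eventually (fun N => ball (Im l) eps (sum_n (fun k => Im (a k)) N)))
      by exact (H2 _ B2).
    refine (filter_imp _ _ _ (filter_and _ _ A1 A2)).
    intros N [E1 E2]. apply HP. split.
    + rewrite <- Re_sum_n in E1. exact E1.
    + rewrite <- Im_sum_n in E2. exact E2.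
Qed.

Lemma is_Cseries_unique (a : nat -> C) (l l' : C) : is_Cseries a l -> is_Cseries a l' -> l = l'.
Proof.
  intros H H'. apply is_Cseries_components in H. apply is_Cseries_components in H'.
  destruct H as [H1 H2]. destruct H' as [H1' H2'].
  apply is_series_unique in H1, H2, H1', H2'.
  destruct l, l'; simpl in *. congruence.
Qed.

Definition CSeries (a : nat -> C) : C := (Series (fun k => Re (a k)), Series (fun k => Im (a k))).

Lemma CSeries_correct (a : nat -> C) : ex_Cseries a -> is_Cseries a (CSeries a).
Proof.
  intros [l H]. apply is_Cseries_components in H. destruct H as [H1 H2].
  apply is_Cseries_components. split; apply Series_correct; eexists; eassumption.
Qed.

Lemma CSeries_unique (a : nat -> C) (l : C) : is_Cseries a l -> CSeries a = l.
Proof.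
  intros H. apply (is_Cseries_unique a); [apply CSeries_correct; now exists l | exact H].
Qed.

Lemma CSeries_ext (a b : nat -> C) : (forall n, a n = b n) -> CSeries a = CSeries b.
Proof. intros E. unfold CSeries. f_equal; apply Series_ext; intros n; now rewrite E. Qed.

Lemma ex_Cseries_le (a : nat -> C) (m : nat -> R) :
  (forall n, Cmod (a n) <= m n) -> ex_series m -> ex_Cseries a.
Proof. exact (ex_series_le (V := C_CompleteNormedModule) a m). Qed.

Lemma CSeries_first (a : nat -> C) : ex_Cseries a ->
  CSeries a = (a 0%nat + CSeries (fun k => a (S k)))%C.
Proof.
  intros [l H]. apply is_Cseries_components in H. destruct H as [H1 H2].
  unfold CSeries, Cplus. simpl.
  rewrite (Series_incr_1 (fun k => Re (a k))) by (eexists; exact H1).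
  rewrite (Series_incr_1 (fun k => Im (a k))) by (eexists; exact H2).
  reflexivity.
Qed.

Lemma pow_n_C (z : C) (n : nat) : pow_n (K := C_AbsRing) z n = (z ^ n)%C.
Proof. induction n as [|n IH]; [reflexivity|]. simpl. now rewrite IH. Qed.

Lemma is_Cpseries_Cpow (a : nat -> C) (z l : C) :
  is_Cpseries a z l <-> is_Cseries (fun k => a k * z ^ k)%C l.
Proof.
  assert (E : forall n, scal (V := C_NormedModule) (pow_n (K := C_AbsRing) z n) (a n)
                        = (a n * z ^ n)%C).
  { intros n. rewrite pow_n_C. apply Cmult_comm. }
  unfold is_pseries. split; apply is_series_ext; intros n; [|symmetry]; apply E.
Qed.

(** Reduces uniqueness and continuity of complex power series to the real case,
    along a line through the centre. *)
Lemma Cpseries_line (a : nat -> C) (w l : C) (t : R) : is_Cpseries a (RtoC t * w)%C l ->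
  is_pseries (fun k => Re (a k * w ^ k)%C) t (Re l) /\
  is_pseries (fun k => Im (a k * w ^ k)%C) t (Im l).
Proof.
  intros H. apply is_Cpseries_Cpow, is_Cseries_components in H. destruct H as [H1 H2].
  assert (E : forall k, (a k * (RtoC t * w) ^ k)%C = (RtoC (t ^ k) * (a k * w ^ k))%C).
  { intros k. rewrite Cpow_mult_l, RtoC_pow. ring. }
  split; apply is_pseries_R.
  - eapply is_series_ext; [|exact H1]. intros k. cbv beta. rewrite E. simpl. ring.
  - eapply is_series_ext; [|exact H2]. intros k. cbv beta. rewrite E. simpl. ring.
Qed.

(** * Analytic functions and the identity theorem *)

Definition locally_zero (h : C -> C) (z0 : C) : Prop :=
  locally (T := C_UniformSpace) z0 (fun z => h z = 0).

Lemma Cpow_neq_0 (w : C) (k : nat) : w <> 0 -> (w ^ k)%C <> 0.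
Proof.
  intros Hw H. apply Hw. apply Cmod_eq_0.
  assert (H' : Cmod w ^ k = 0) by (rewrite <- Cmod_pow, H; apply Cmod_0).
  destruct (Req_dec (Cmod w) 0) as [E|E]; [exact E|].
  exfalso. now apply (pow_nonzero (Cmod w) k).
Qed.

(** Along the ray both components of the power series vanish to one side of the
    centre, so all coefficients are zero. *)
Lemma locally_zero_of_ray (h : C -> C) (z0 w : C) (eps : R) :
  analytic_at h z0 -> w <> 0 -> 0 < eps ->
  (forall t, 0 < t < eps -> h (z0 + RtoC t * w)%C = 0) -> locally_zero h z0.
Proof.
  intros [a Ha] Hw Heps Hray.
  apply locally_Cmod in Ha. destruct Ha as (r & Hr & Ha).
  assert (Hmw : 0 < Cmod w) by now apply Cmod_gt_0.
  set (e := Rmin eps (r / Cmod w)).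
  assert (He : 0 < e) by (apply Rmin_glb_lt; [exact Heps | now apply Rdiv_lt_0_compat]).
  assert (Hps : forall t, 0 < t < e -> is_Cpseries a (RtoC t * w)%C (RtoC 0)).
  { intros t Ht. pose proof (Rmin_l eps (r / Cmod w)). pose proof (Rmin_r eps (r / Cmod w)).
    fold e in H, H0.
    assert (Ht0 := Hray t ltac:(lra)). rewrite <- Ht0.
    replace (RtoC t * w)%C with (z0 + RtoC t * w - z0)%C at 1 by ring.
    apply Ha. replace (z0 + RtoC t * w - z0)%C with (RtoC t * w)%C by ring.
    rewrite Cmod_mult, Cmod_R, Rabs_pos_eq by lra.
    apply Rlt_le_trans with (r / Cmod w * Cmod w).
    - apply Rmult_lt_compat_r; lra.
    - right. field. lra. }
  assert (Han : forall k, a k = 0).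
  { intros k.
    assert (E : (a k * w ^ k)%C = 0).
    { pose proof (pseries_right_zero _ e He (fun t Ht => proj1 (Cpseries_line a w 0 t (Hps t Ht))) k) as E1.
      pose proof (pseries_right_zero _ e He (fun t Ht => proj2 (Cpseries_line a w 0 t (Hps t Ht))) k) as E2.
      cbv beta in E1, E2. destruct (a k * w ^ k)%C as [u v]. simpl in E1, E2. now subst. }
    replace (a k) with (a k * w ^ k * / w ^ k)%C by (field; now apply Cpow_neq_0).
    rewrite E. ring. }
  apply locally_Cmod. exists r. split; [exact Hr|]. intros z Hz.
  specialize (Ha z Hz). apply is_Cpseries_Cpow in Ha.
  apply (is_Cseries_unique _ _ _ Ha).
  apply is_series_ext with (fun _ => zero).
  { intros k. rewrite Han. change (RtoC 0 = 0 * (z - z0) ^ k)%C. ring. }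
  exact (is_series_zero (V := C_NormedModule)).
Qed.

(** At the supremum of the parameters up to which [h] is locally zero,
    [locally_zero_of_ray] applies in the backward direction; openness then
    carries the zeros further. *)
Lemma locally_zero_segment (h : C -> C) (p w : C) : w <> 0 ->
  (forall t, 0 <= t <= 1 -> analytic_at h (p + RtoC t * w)%C) ->
  locally_zero h p -> locally_zero h (p + w)%C.
Proof.
  intros Hw Han Hp.
  assert (Hmw : 0 < Cmod w) by now apply Cmod_gt_0.
  assert (Hopen : forall t, locally_zero h (p + RtoC t * w)%C -> exists d, 0 < d /\
            forall u, Rabs (u - t) < d -> locally_zero h (p + RtoC u * w)%C).
  { intros t Ht. apply (locally_locally (T := C_UniformSpace)) in Ht.
    apply locally_Cmod in Ht. destruct Ht as (r & Hr & Ht).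
    exists (r / Cmod w). split; [now apply Rdiv_lt_0_compat|].
    intros u Hu. apply Ht.
    replace (p + RtoC u * w - (p + RtoC t * w))%C with (RtoC (u - t) * w)%C
      by (rewrite RtoC_minus; ring).
    rewrite Cmod_mult, Cmod_R.
    apply Rlt_le_trans with (r / Cmod w * Cmod w).
    - apply Rmult_lt_compat_r; lra.
    - right. field. lra. }
  set (good := fun T => 0 <= T <= 1 /\ forall t, 0 <= t <= T -> locally_zero h (p + RtoC t * w)%C).
  assert (Hp0 : locally_zero h (p + RtoC 0 * w)%C).
  { replace (p + RtoC 0 * w)%C with p by ring. exact Hp. }
  assert (Hgood0 : good 0).
  { split; [lra|]. intros t Ht. replace t with 0 by lra. exact Hp0. }
  destruct (completeness good) as [T [HT1 HT2]].
  { exists 1. intros t [Ht _]. lra. }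
  { now exists 0. }
  assert (HT0 : 0 <= T) by now apply HT1.
  assert (HTle : T <= 1) by (apply HT2; intros t [Ht _]; lra).
  assert (Hbelow : forall t, 0 <= t < T -> locally_zero h (p + RtoC t * w)%C).
  { intros t Ht. apply NNPP. intros Hn.
    assert (T <= t); [|lra]. apply HT2. intros u [Hu Hgu].
    apply Rnot_lt_le. intros Hlt. apply Hn, Hgu. lra. }
  assert (HTzero : locally_zero h (p + RtoC T * w)%C).
  { destruct (Req_dec T 0) as [->|HTn]; [exact Hp0|].
    apply (locally_zero_of_ray h _ (- w)%C T).
    - apply Han. lra.
    - intros E. apply Hw. replace w with (- - w)%C by ring. rewrite E. ring.
    - lra.
    - intros t Ht. replace (p + RtoC T * w + RtoC t * - w)%C with (p + RtoC (T - t) * w)%C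
        by (rewrite RtoC_minus; ring).
      apply (locally_singleton (T := C_UniformSpace) _ (fun z => h z = 0)), Hbelow. lra. }
  assert (E : T = 1).
  { apply Rle_antisym; [exact HTle|]. apply Rnot_lt_le. intros Hlt.
    destruct (Hopen T HTzero) as (d & Hd & HTd).
    set (T' := Rmin 1 (T + d / 2)).
    assert (HT' : T < T') by (apply Rmin_glb_lt; lra).
    assert (good T'); [|assert (T' <= T) by (now apply HT1); lra].
    pose proof (Rmin_l 1 (T + d / 2)) as M1. pose proof (Rmin_r 1 (T + d / 2)) as M2.
    fold T' in M1, M2. split; [lra|]. intros t Ht.
    destruct (Rlt_le_dec t T) as [H1|H1]; [apply Hbelow; lra|].
    apply HTd. rewrite Rabs_pos_eq; lra. }
  replace (p + w)%C with (p + RtoC T * w)%C by (rewrite E; ring). exact HTzero.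
Qed.

Lemma analytic_ext_loc (f g : C -> C) (z0 : C) :
  locally (T := C_UniformSpace) z0 (fun z => f z = g z) -> analytic_at f z0 -> analytic_at g z0.
Proof.
  intros E [a Ha]. exists a. generalize (filter_and _ _ E Ha). apply filter_imp.
  intros z [E' H]. now rewrite <- E'.
Qed.

Lemma analytic_plus (f g : C -> C) (z0 : C) :
  analytic_at f z0 -> analytic_at g z0 -> analytic_at (fun z => f z + g z)%C z0.
Proof.
  intros [a Ha] [b Hb]. exists (PS_plus a b).
  generalize (filter_and _ _ Ha Hb). apply filter_imp. intros z [H1 H2].
  now apply (is_pseries_plus (V := C_NormedModule)).
Qed.

Lemma analytic_const (c z0 : C) : analytic_at (fun _ => c) z0.
Proof.
  exists (fun k => match k with O => c | S _ => 0 end).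
  apply filter_forall. intros z. apply is_Cpseries_Cpow.
  apply (is_series_decr_1 (V := C_NormedModule)).
  replace (plus c _) with (zero : C_NormedModule).
  2:{ change (RtoC 0 = c + - (c * 1))%C. ring. }
  apply is_series_ext with (fun _ => zero).
  { intros k. change (RtoC 0 = 0 * (z - z0) ^ S k)%C. ring. }
  exact (is_series_zero (V := C_NormedModule)).
Qed.

(** The coefficients of the product with [c + u], where [u] is the variable. *)
Definition affine_coef (c : C) (a : nat -> C) : nat -> C :=
  PS_plus (V := C_NormedModule) (PS_scal (V := C_NormedModule) c a)
    (PS_incr_1 (V := C_NormedModule) a).

Lemma is_Cpseries_affine (a : nat -> C) (c u l : C) :
  is_Cpseries a u l -> is_Cpseries (affine_coef c a) u ((c + u) * l)%C.
Proof.
  intros H. replace ((c + u) * l)%C with (plus (scal c l : C_NormedModule) (scal u l)).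
  2:{ change (c * l + u * l = (c + u) * l)%C. ring. }
  apply (is_pseries_plus (V := C_NormedModule)).
  - apply (is_pseries_scal (V := C_NormedModule)); [apply Cmult_comm | exact H].
  - now apply (is_pseries_incr_1 (V := C_NormedModule)).
Qed.

Lemma analytic_affine (f : C -> C) (c z0 : C) :
  analytic_at f z0 -> analytic_at (fun z => (c + z) * f z)%C z0.
Proof.
  intros [a Ha]. exists (affine_coef (c + z0)%C a).
  revert Ha. apply filter_imp. intros z H.
  replace (c + z)%C with (c + z0 + (z - z0))%C by ring. now apply is_Cpseries_affine.
Qed.

Lemma analytic_scal (f : C -> C) (c z0 : C) :
  analytic_at f z0 -> analytic_at (fun z => c * f z)%C z0.
Proof.
  intros [a Ha]. exists (PS_scal (V := C_NormedModule) c a).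
  revert Ha. apply filter_imp. intros z H.
  apply (is_pseries_scal (V := C_NormedModule)); [apply Cmult_comm | exact H].
Qed.

Lemma analytic_shift (f : C -> C) (c z0 : C) :
  analytic_at f (z0 + c)%C -> analytic_at (fun z => f (z + c)%C) z0.
Proof.
  intros [a Ha]. exists a. apply locally_Cmod in Ha. destruct Ha as (r & Hr & Ha).
  apply locally_Cmod. exists r. split; [exact Hr|]. intros z Hz.
  replace (z - z0)%C with (z + c - (z0 + c))%C by ring.
  apply Ha. replace (z + c - (z0 + c))%C with (z - z0)%C by ring. exact Hz.
Qed.

(** * The complex exponential *)

Lemma Cexp_plus (u v : C) : Cexp (u + v)%C = (Cexp u * Cexp v)%C.
Proof.
  destruct u as [a b], v as [a' b'].
  apply injective_projections; simpl; rewrite exp_plus, ?cos_plus, ?sin_plus; ring.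
Qed.

Lemma Cmod_Cexp (u : C) : Cmod (Cexp u) = exp (Re u).
Proof.
  unfold Cmod, Cexp. simpl.
  match goal with |- sqrt ?r = _ => replace r with (Rsqr (exp (Re u))) end.
  - apply sqrt_Rsqr. left. apply exp_pos.
  - pose proof (sin2_cos2 (Im u)) as H. unfold Rsqr in *.
    transitivity (exp (Re u) * exp (Re u) * (sin (Im u) * sin (Im u) + cos (Im u) * cos (Im u)));
      [rewrite H; ring | ring].
Qed.

Lemma Cexp_RtoC (x : R) : Cexp (RtoC x) = RtoC (exp x).
Proof. unfold Cexp, RtoC. simpl. rewrite cos_0, sin_0. f_equal; ring. Qed.

Lemma ex_series_of_bounded (a : nat -> R) (M : R) :
  (forall k, 0 <= a k) -> (forall N, sum_n a N <= M) -> ex_series a.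
Proof.
  intros Ha HM. destruct (ex_finite_lim_seq_incr (sum_n a) M) as [l Hl]; [|exact HM|].
  - intros n. rewrite sum_Sn. as_Rplus.
    specialize (Ha (S n)). lra.
  - now exists l.
Qed.

Lemma exp_partial_sum_le (x : R) (N : nat) : 0 <= x ->
  sum_n (fun k => x ^ k / INR (fact k)) N <= exp x.
Proof.
  intros Hx. pose proof (is_pseries_exp x) as H. apply is_pseries_R in H.
  assert (H' : is_series (fun k => x ^ k / INR (fact k)) (exp x)).
  { eapply is_series_ext; [|exact H]. intros k. cbv beta. as_R_eq. unfold Rdiv. ring. }
  rewrite <- (is_series_unique _ _ H'). apply sum_n_le_Series; [|eexists; exact H'].
  intros k. apply Rmult_le_pos; [now apply pow_le | left; apply Rinv_0_lt_compat, INR_fact_lt_0].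
Qed.

Lemma exp_term_le (x : R) (k : nat) : 0 <= x -> x ^ k / INR (fact k) <= exp x.
Proof.
  intros Hx.
  apply (term_le_of_sums (fun k => x ^ k / INR (fact k))).
  - intros j. apply Rmult_le_pos; [now apply pow_le | left; apply Rinv_0_lt_compat, INR_fact_lt_0].
  - intros N. now apply exp_partial_sum_le.
Qed.

(** The two real components of [sum (u t)^k / k!] solve the differential equation
    of [e^(ut)]. *)
Lemma is_Cpseries_Cexp (u : C) : is_Cpseries (fun k => RtoC (/ INR (fact k))) u (Cexp u).
Proof.
  set (al := Re u). set (be := Im u).
  set (p := fun k => Re (u ^ k)%C / INR (fact k)). set (q := fun k => Im (u ^ k)%C / INR (fact k)).
  assert (Hcv : forall (c : nat -> R) t, (forall k, Rabs (c k) <= Cmod u ^ k / INR (fact k)) ->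
            Rbar_lt (Rabs t) (CV_radius c)).
  { intros c t Hc. apply Rbar_lt_le_trans with (Rabs t + 1); [simpl; lra|].
    pose proof (Rabs_pos t) as Ht.
    apply CV_radius_ge with (exp (Cmod u * (Rabs t + 1))). intros k.
    eapply Rle_trans; [|apply (exp_term_le _ k), Rmult_le_pos; [apply Cmod_ge_0 | lra]].
    rewrite Rabs_mult, (Rabs_pos_eq ((Rabs t + 1) ^ k)) by (apply pow_le; lra).
    rewrite Rpow_mult_distr. unfold Rdiv.
    replace (Cmod u ^ k * (Rabs t + 1) ^ k * / INR (fact k))
      with (Cmod u ^ k / INR (fact k) * (Rabs t + 1) ^ k) by (unfold Rdiv; ring).
    apply Rmult_le_compat_r; [apply pow_le; lra | apply Hc]. }
  assert (Hfac : forall k, 0 < / INR (fact k)) by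
    (intros k; apply Rinv_0_lt_compat, INR_fact_lt_0).
  assert (Hcomp : forall z k, Rabs z <= Cmod (u ^ k)%C ->
            Rabs (z / INR (fact k)) <= Cmod u ^ k / INR (fact k)).
  { intros z k Hz. unfold Rdiv. rewrite Rabs_mult, (Rabs_pos_eq (/ _)) by (left; apply Hfac).
    apply Rmult_le_compat_r; [left; apply Hfac|]. now rewrite <- Cmod_pow. }
  assert (Hp : forall t, Rbar_lt (Rabs t) (CV_radius p)).
  { intros t. apply Hcv. intros k. apply Hcomp.
    eapply Rle_trans; [apply Rmax_l | apply Rmax_Cmod]. }
  assert (Hq : forall t, Rbar_lt (Rabs t) (CV_radius q)).
  { intros t. apply Hcv. intros k. apply Hcomp.
    eapply Rle_trans; [apply Rmax_r | apply Rmax_Cmod]. }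
  assert (Hode : forall (c e : nat -> R) m t,
    (forall t, Rbar_lt (Rabs t) (CV_radius c)) -> (forall t, Rbar_lt (Rabs t) (CV_radius e)) ->
    (forall k, INR (S k) * c (S k) = al * c k + m * e k) ->
    is_derive (PSeries c) t (al * PSeries c t + m * PSeries e t)).
  { intros c e m t Hc He Hrec.
    rewrite <- !PSeries_scal, <- PSeries_plus;
      try (apply ex_pseries_scal; [apply Rmult_comm | now apply CV_radius_inside]).
    rewrite <- (PSeries_ext (PS_derive c)) by (intros k; apply Hrec).
    now apply is_derive_PSeries. }
  assert (Hfs : forall z k, INR (S k) * (z / INR (fact (S k))) = z / INR (fact k)).
  { intros z k. rewrite fact_simpl, mult_INR. field.
    split; [apply INR_fact_neq_0 | apply not_0_INR; lia]. }
  set (P := PSeries p). set (Q := PSeries q).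
  assert (HdP : forall t, is_derive P t (al * P t + - be * Q t)).
  { intros t. apply Hode; [exact Hp | exact Hq|]. intros k. unfold p, q. rewrite Hfs.
    change (Re (u ^ S k)%C) with (al * Re (u ^ k)%C - be * Im (u ^ k)%C). unfold Rdiv. ring. }
  assert (HdQ : forall t, is_derive Q t (al * Q t + be * P t)).
  { intros t. apply Hode; [exact Hq | exact Hp|]. intros k. unfold p, q. rewrite Hfs.
    change (Im (u ^ S k)%C) with (al * Im (u ^ k)%C + be * Re (u ^ k)%C). unfold Rdiv. ring. }
  assert (HP0 : P 0 = 1) by (unfold P; rewrite PSeries_0; unfold p; simpl; field).
  assert (HQ0 : Q 0 = 0) by (unfold Q; rewrite PSeries_0; unfold q; simpl; field).
  (* the squared distance between two solutions, divided by its growth, is constant *)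
  set (W := fun t => exp (- (2 * al * t)) * ((P t - exp (al * t) * cos (be * t)) ^ 2
                                            + (Q t - exp (al * t) * sin (be * t)) ^ 2)).
  assert (HW : W 0 = W 1).
  { apply eq_is_derive; [|lra]. intros t _. change (@zero _) with 0. unfold W.
    evar_last.
    - auto_derive.
      + split; [eexists; apply HdP | split; [eexists; apply HdQ | trivial]].
      + reflexivity.
    - change (Derive (fun u => P u) t) with (Derive P t).
      change (Derive (fun u => Q u) t) with (Derive Q t).
      rewrite (is_derive_unique _ _ _ (HdP t)), (is_derive_unique _ _ _ (HdQ t)).
      unfold Rminus. ring. }
  unfold W in HW.
  rewrite !Rmult_0_r, Ropp_0, exp_0, cos_0, sin_0, HP0, HQ0, !Rmult_1_r in HW.
  pose proof (exp_pos (- (2 * al))) as He.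
  assert (E0 : (P 1 - exp al * cos be) ^ 2 + (Q 1 - exp al * sin be) ^ 2 = 0).
  { apply Rmult_eq_reg_l with (exp (- (2 * al))); [|lra]. rewrite <- HW. ring. }
  rewrite <- !Rsqr_pow2 in E0.
  destruct (Rplus_sqr_eq_0 _ _ E0) as [EP EQ]. apply Rminus_diag_uniq in EP, EQ.
  apply is_Cpseries_Cpow, is_Cseries_components. unfold Cexp. simpl Re. simpl Im.
  fold al be. rewrite <- EP, <- EQ. unfold P, Q. rewrite !PSeries_1. split.
  - apply is_series_ext with p.
    + intros k. change (Re (u ^ k)%C / INR (fact k)
        = / INR (fact k) * Re (u ^ k)%C - 0 * Im (u ^ k)%C). unfold Rdiv. ring.
    + apply Series_correct, ex_pseries_1, CV_radius_inside, Hp.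
  - apply is_series_ext with q.
    + intros k. change (Im (u ^ k)%C / INR (fact k)
        = / INR (fact k) * Im (u ^ k)%C + 0 * Re (u ^ k)%C). unfold Rdiv. ring.
    + apply Series_correct, ex_pseries_1, CV_radius_inside, Hq.
Qed.

(** * Majorized power series *)

(** [f] is given on the disc of radius [rho] by a power series whose sum of
    absolute values at radius [rho] is at most [K]. Such bounds pass through
    multiplication by affine functions and through series of functions, so that
    Landau's series is analytic by direct estimates, without Cauchy's formula. *)
Definition majorized (f : C -> C) (z0 : C) (rho K : R) : Prop :=
  exists a : nat -> C,
    (forall N, sum_n (fun k => Cmod (a k) * rho ^ k) N <= K) /\
    (forall z, Cmod (z - z0) < rho -> is_Cpseries a (z - z0)%C (f z)).

Lemma majorized_analytic (f : C -> C) (z0 : C) (rho K : R) :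
  0 < rho -> majorized f z0 rho K -> analytic_at f z0.
Proof.
  intros Hrho (a & _ & Ha). exists a. apply locally_Cmod. now exists rho.
Qed.

Lemma majorized_nonneg (f : C -> C) (z0 : C) (rho K : R) : 0 < rho -> majorized f z0 rho K -> 0 <= K.
Proof.
  intros Hrho (a & HK & _). eapply Rle_trans; [|apply (HK 0%nat)].
  apply sum_n_nonneg. intros k. apply Rmult_le_pos; [apply Cmod_ge_0 | apply pow_le; lra].
Qed.

Lemma Cpseries_abs_bound (a : nat -> C) (u : C) (rho K : R) (N : nat) : Cmod u <= rho ->
  (forall N, sum_n (fun k => Cmod (a k) * rho ^ k) N <= K) ->
  sum_n (fun k => Cmod (a k * u ^ k)%C) N <= K.
Proof.
  intros Hu HK. eapply Rle_trans; [|apply (HK N)].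
  apply sum_n_m_le. intros k. rewrite Cmod_mult, Cmod_pow.
  apply Rmult_le_compat_l; [apply Cmod_ge_0|].
  apply pow_incr. split; [apply Cmod_ge_0 | exact Hu].
Qed.

Lemma majorized_bound (f : C -> C) (z0 : C) (rho K : R) (z : C) :
  majorized f z0 rho K -> Cmod (z - z0) < rho -> Cmod (f z) <= K.
Proof.
  intros (a & HK & Ha) Hz. specialize (Ha z Hz). apply is_Cpseries_Cpow in Ha.
  apply (norm_is_series_le (V := C_NormedModule) _ _ _ Ha). intros N.
  eapply Rle_trans; [apply (norm_sum_n_m (V := C_NormedModule))|].
  apply (Cpseries_abs_bound a (z - z0)%C rho K N); [lra | exact HK].
Qed.

Lemma majorized_ext (f g : C -> C) (z0 : C) (rho K : R) :
  (forall z, f z = g z) -> majorized f z0 rho K -> majorized g z0 rho K.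
Proof.
  intros E (a & HK & Ha). exists a. split; [exact HK|].
  intros z Hz. rewrite <- E. now apply Ha.
Qed.

Lemma majorized_scal (f : C -> C) (c z0 : C) (rho K : R) :
  majorized f z0 rho K -> majorized (fun z => c * f z)%C z0 rho (Cmod c * K).
Proof.
  intros (a & HK & Ha). exists (PS_scal (V := C_NormedModule) c a). split.
  - intros N. rewrite (sum_n_ext _ (fun k => Cmod c * (Cmod (a k) * rho ^ k))).
    + rewrite sum_n_Rmult_l. apply Rmult_le_compat_l; [apply Cmod_ge_0 | apply HK].
    + intros k. unfold PS_scal. change (scal c (a k)) with (c * a k)%C.
      rewrite Cmod_mult. as_R_eq. ring.
  - intros z Hz. apply (is_pseries_scal (V := C_NormedModule)); [apply Cmult_comm | now apply Ha].
Qed.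

Lemma majorized_affine (f : C -> C) (c z0 : C) (rho K : R) : 0 < rho ->
  majorized f z0 rho K ->
  majorized (fun z => (c + z) * f z)%C z0 rho ((Cmod (c + z0) + rho) * K).
Proof.
  intros Hrho (a & HK & Ha). exists (affine_coef (c + z0)%C a). split.
  - intros N. set (m := fun k => Cmod (a k) * rho ^ k) in *.
    assert (Hm : forall k, 0 <= m k).
    { intros k. apply Rmult_le_pos; [apply Cmod_ge_0 | apply pow_le; lra]. }
    apply Rle_trans with (Cmod (c + z0) * sum_n m N + rho * sum_n m N).
    + assert (Hstep : forall M, sum_n (fun k => Cmod (affine_coef (c + z0)%C a k) * rho ^ k) M
                <= Cmod (c + z0) * sum_n m M + rho * (sum_n m M - m M)).
      { induction M as [|M IH].
        - rewrite !sum_O. unfold affine_coef, PS_plus, PS_scal, PS_incr_1, m.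
          change (plus (scal (c + z0)%C (a 0%nat)) zero) with ((c + z0) * a 0%nat + 0)%C.
          rewrite Cplus_0_r, Cmod_mult. right. ring.
        - rewrite !sum_Sn. as_Rplus.
          assert (Hk : Cmod (affine_coef (c + z0)%C a (S M)) * rho ^ S M
                        <= Cmod (c + z0) * m (S M) + rho * m M).
          { unfold affine_coef, PS_plus, PS_scal, PS_incr_1.
            change (plus (scal (c + z0)%C (a (S M))) (a M)) with ((c + z0) * a (S M) + a M)%C.
            unfold m. replace (rho * (Cmod (a M) * rho ^ M)) with (Cmod (a M) * rho ^ S M)
              by (simpl; ring).
            rewrite <- Rmult_assoc, <- Rmult_plus_distr_r.
            apply Rmult_le_compat_r; [apply pow_le; lra|].
            rewrite <- Cmod_mult. apply Cmod_triangle. }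
          lra. }
      eapply Rle_trans; [apply Hstep|]. specialize (Hm N). nra.
    + rewrite <- Rmult_plus_distr_r. apply Rmult_le_compat_l; [|apply HK].
      pose proof (Cmod_ge_0 (c + z0)%C). lra.
  - intros z Hz. replace (c + z)%C with (c + z0 + (z - z0))%C by ring.
    apply is_Cpseries_affine. now apply Ha.
Qed.

Lemma majorized_Cexp (c z0 : C) (lam rho : R) : 0 <= lam -> 0 < rho ->
  majorized (fun z => Cexp (- (z + c) * RtoC lam)%C) z0 rho
            (exp (- (Re z0 + Re c - rho) * lam)).
Proof.
  intros Hlam Hrho.
  set (e := Cexp (- (z0 + c) * RtoC lam)%C).
  exists (fun k => e * (RtoC (/ INR (fact k)) * RtoC (- lam) ^ k))%C. split.
  - intros N.
    rewrite (sum_n_ext _ (fun k => Cmod e * ((lam * rho) ^ k / INR (fact k)))).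
    + rewrite sum_n_Rmult_l. unfold e. rewrite Cmod_Cexp.
      replace (- (Re z0 + Re c - rho) * lam) with
        (Re (- (z0 + c) * RtoC lam)%C + lam * rho) by (unfold Re; simpl; ring).
      rewrite exp_plus. apply Rmult_le_compat_l; [left; apply exp_pos|].
      apply exp_partial_sum_le, Rmult_le_pos; lra.
    + intros k. rewrite !Cmod_mult, Cmod_pow, !Cmod_R, Rabs_Ropp, (Rabs_pos_eq lam) by exact Hlam.
      rewrite (Rabs_pos_eq (/ _)) by (left; apply Rinv_0_lt_compat, INR_fact_lt_0).
      rewrite Rpow_mult_distr. as_R_eq. unfold Rdiv. ring.
  - intros z Hz.
    replace (- (z + c) * RtoC lam)%C with
      (- (z0 + c) * RtoC lam + RtoC (- lam) * (z - z0))%C by (rewrite RtoC_opp; ring).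
    rewrite Cexp_plus. fold e.
    pose proof (is_Cpseries_Cexp (RtoC (- lam) * (z - z0))%C) as H.
    apply is_Cpseries_Cpow in H. apply is_Cpseries_Cpow.
    pose proof (is_series_scal (V := C_NormedModule) e _ _ H) as H'.
    eapply is_series_ext; [|exact H']. intros k.
    change (e * (RtoC (/ INR (fact k)) * (RtoC (- lam) * (z - z0)) ^ k)
            = e * (RtoC (/ INR (fact k)) * RtoC (- lam) ^ k) * (z - z0) ^ k)%C.
    rewrite Cpow_mult_l. ring.
Qed.

Lemma majorized_series (f : nat -> C -> C) (F : C -> C) (z0 : C) (rho : R) (K : nat -> R) :
  0 < rho -> (forall n, majorized (f n) z0 rho (K n)) -> ex_series K ->
  (forall z, Cmod (z - z0) < rho -> is_Cseries (fun n => f n z) (F z)) ->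
  majorized F z0 rho (Series K).
Proof.
  intros Hrho Hf HK HF.
  set (A := fun n => proj1_sig (constructive_indefinite_description _ (Hf n))).
  assert (HA : forall n,
    (forall N, sum_n (fun k => Cmod (A n k) * rho ^ k) N <= K n) /\
    (forall z, Cmod (z - z0) < rho -> is_Cpseries (A n) (z - z0)%C (f n z))).
  { intros n. exact (proj2_sig (constructive_indefinite_description _ (Hf n))). }
  assert (Hterm : forall n k, Cmod (A n k) * rho ^ k <= K n).
  { intros n k. destruct (HA n) as [H _].
    apply (term_le_of_sums (fun k => Cmod (A n k) * rho ^ k)); [|exact H].
    intros i. apply Rmult_le_pos; [apply Cmod_ge_0 | apply pow_le; lra]. }
  assert (Hcol : forall k, is_Cseries (fun n => A n k) (CSeries (fun n => A n k))).
  { intros k. apply CSeries_correct.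
    apply (ex_Cseries_le _ (fun n => / rho ^ k * K n)).
    - intros n. specialize (Hterm n k). pose proof (pow_lt rho k Hrho) as Hp.
      apply Rmult_le_reg_r with (rho ^ k); [exact Hp|].
      replace (/ rho ^ k * K n * rho ^ k) with (K n) by (field; lra). exact Hterm.
    - now apply ex_series_Rmult_l. }
  assert (Hswap : forall u, Cmod u <= rho ->
    exists G : nat -> C, (forall n, is_Cpseries (A n) u (G n)) /\
      forall l, is_Cseries G l -> is_Cpseries (fun k => CSeries (fun n => A n k)) u l /\
      forall N, sum_n (fun k => Cmod (CSeries (fun n => A n k) * u ^ k)%C) N <= Series K).
  { intros u Hu.
    assert (Hbd : forall n N, sum_n (fun k => norm (A n k * u ^ k : C_NormedModule)%C) N <= K n).
    { intros n N. apply (Cpseries_abs_bound _ _ rho); [exact Hu | apply HA]. }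
    exists (fun n => CSeries (fun k => A n k * u ^ k)%C).
    assert (Hrow : forall n, is_Cseries (fun k => A n k * u ^ k)%C
              (CSeries (fun k => A n k * u ^ k)%C)).
    { intros n. apply CSeries_correct, (ex_Cseries_le _ (fun k => Cmod (A n k * u ^ k)%C));
        [intros k; apply Rle_refl|].
      apply (ex_series_of_bounded _ (K n)); [intros k; apply Cmod_ge_0 | apply Hbd]. }
    split; [intros n; apply is_Cpseries_Cpow, Hrow|].
    intros l Hl. rewrite is_Cpseries_Cpow.
    apply (series_swap (V := C_NormedModule) _ _ _ _ K Hrow); [|exact Hl | exact Hbd | exact HK].
    intros k. rewrite Cmult_comm.
    eapply is_series_ext; [|apply (is_series_scal (V := C_NormedModule) (u ^ k)%C _ _ (Hcol k))].
    intros n. apply Cmult_comm. }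
  exists (fun k => CSeries (fun n => A n k)). split.
  - intros N. destruct (Hswap (RtoC rho)) as (G & HG & HGl).
    { rewrite Cmod_R, Rabs_pos_eq; lra. }
    destruct (ex_Cseries_le G K) as [l Hl]; [|exact HK|].
    { intros n. specialize (HG n). apply is_Cpseries_Cpow in HG.
      apply (norm_is_series_le (V := C_NormedModule) _ _ _ HG). intros M.
      eapply Rle_trans; [apply (norm_sum_n_m (V := C_NormedModule))|].
      apply (Cpseries_abs_bound (A n) _ rho); [rewrite Cmod_R, Rabs_pos_eq; lra | apply HA]. }
    eapply Rle_trans; [|apply (HGl l Hl)]. apply sum_n_m_le. intros k.
    rewrite Cmod_mult, Cmod_pow, Cmod_R, Rabs_pos_eq by lra. apply Rle_refl.
  - intros z Hz. destruct (Hswap (z - z0)%C) as (G & HG & HGl); [lra|].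
    apply HGl. eapply is_series_ext; [|apply HF, Hz]. intros n.
    apply (is_Cseries_unique (fun k => A n k * (z - z0) ^ k)%C);
      apply is_Cpseries_Cpow; [now apply HA | apply HG].
Qed.

(** * The binomial series with exponent [-s] *)

(** [s (s+1) ... (s+j-1) / j!], the coefficient of [u^j] in [(1 - u)^-s]. *)
Fixpoint rising (j : nat) (s : R) : R :=
  match j with O => 1 | S j => / INR (S j) * ((INR j + s) * rising j s) end.

Lemma rising_pos (j : nat) (s : R) : 0 < s -> 0 < rising j s.
Proof.
  intros Hs. induction j as [|j IH]; [simpl; lra|].
  cbn [rising]. apply Rmult_lt_0_compat; [apply Rinv_0_lt_compat, lt_0_INR; lia|].
  apply Rmult_lt_0_compat; [pose proof (pos_INR j); lra | exact IH].
Qed.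

Lemma rising_ratio_limit (J : nat) (A : R) :
  is_lim_seq (fun n => / INR (S (J + n)) * (INR (J + n) + A)) 1.
Proof.
  assert (H : is_lim_seq (fun n => 1 + (A - 1) * / INR (S (J + n))) (1 + (A - 1) * 0)).
  { apply is_lim_seq_plus'; [apply is_lim_seq_const|].
    apply is_lim_seq_mult'; [apply is_lim_seq_const|].
    replace (Finite 0) with (Rbar_inv p_infty) by reflexivity.
    apply is_lim_seq_inv; [|discriminate].
    apply is_lim_seq_ext with (fun n => INR (n + S J)); [intros n; f_equal; lia|].
    apply (is_lim_seq_incr_n INR (S J)), is_lim_seq_INR. }
  rewrite Rmult_0_r, Rplus_0_r in H.
  eapply is_lim_seq_ext; [|exact H]. intros n. cbv beta. rewrite S_INR.
  pose proof (pos_INR (J + n)). field. lra.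
Qed.

Lemma CV_radius_rising (s : R) : 0 < s -> CV_radius (fun j => rising j s) = 1.
Proof.
  intros Hs. replace (Finite 1) with (Finite (/ 1)) by (f_equal; field).
  apply CV_radius_finite_DAlembert; [|lra|].
  - intros n. pose proof (rising_pos n s Hs). lra.
  - eapply is_lim_seq_ext; [|apply (rising_ratio_limit 0 s)]. intros n. cbv beta.
    pose proof (rising_pos n s Hs) as H1. pose proof (rising_pos (S n) s Hs) as H2.
    rewrite Rabs_pos_eq by (left; now apply Rdiv_lt_0_compat).
    cbn [rising]. rewrite Nat.add_0_l. field. split; [apply not_0_INR; lia | lra].
Qed.

(** The recurrence of the coefficients is the equation [(1-u) P' = s P] for the
    sum [P]. *)
Lemma is_series_binomial (s u : R) : 0 < s -> 0 <= u < 1 ->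
  is_series (fun j => rising j s * u ^ j) (exp (- (s * ln (1 - u)))).
Proof.
  intros Hs Hu. set (a := fun j => rising j s).
  assert (Hin : forall v, 0 <= v <= u -> Rbar_lt (Rabs v) (CV_radius a)).
  { intros v Hv. unfold a. rewrite CV_radius_rising by exact Hs. simpl.
    rewrite Rabs_pos_eq; lra. }
  assert (Hode : forall v, 0 <= v <= u ->
            (1 - v) * PSeries (PS_derive a) v = s * PSeries a v).
  { intros v Hv.
    assert (Hd : ex_pseries (PS_derive a) v).
    { apply CV_radius_inside. rewrite CV_radius_derive. now apply Hin. }
    assert (E : PSeries (PS_derive a) v
                = PSeries (PS_plus (PS_incr_1 (PS_derive a)) (PS_scal s a)) v).
    { apply PSeries_ext. intros n.
      unfold PS_plus, PS_incr_1, PS_scal, PS_derive, a.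
      assert (En : INR (S n) * rising (S n) s = (INR n + s) * rising n s).
      { cbn [rising]. field. apply not_0_INR; lia. }
      rewrite En. destruct n as [|n].
      - change (plus zero (scal s (rising 0 s))) with (0 + s * rising 0 s). simpl. ring.
      - change (plus (INR (S n) * rising (S n) s) (scal s (rising (S n) s)))
          with (INR (S n) * rising (S n) s + s * rising (S n) s). ring. }
    rewrite PSeries_plus in E.
    - rewrite PSeries_incr_1, PSeries_scal in E. lra.
    - now apply ex_pseries_incr_1.
    - apply ex_pseries_scal; [apply Rmult_comm | apply CV_radius_inside; now apply Hin]. }
  set (E := fun v => PSeries a v * exp (s * ln (1 - v))).
  assert (HE : E 0 = E u).
  { destruct (Req_dec u 0) as [->|Hu0]; [reflexivity|].
    apply eq_is_derive; [|lra]. intros v Hv. change (@zero _) with 0. unfold E.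
    assert (Hdv : is_derive (PSeries a) v (PSeries (PS_derive a) v)) by
      (apply is_derive_PSeries, Hin; lra).
    evar_last.
    - auto_derive.
      + split; [eexists; exact Hdv | split; [lra | trivial]].
      + reflexivity.
    - change (Derive (fun w => PSeries a w) v) with (Derive (PSeries a) v).
      rewrite (is_derive_unique _ _ _ Hdv).
      replace (1 + - v) with (1 - v) by ring.
      transitivity (exp (s * ln (1 - v)) / (1 - v) *
        ((1 - v) * PSeries (PS_derive a) v - s * PSeries a v)); [field; lra|].
      rewrite Hode by lra. ring. }
  unfold E in HE. rewrite PSeries_0, Rminus_0_r, ln_1, Rmult_0_r, exp_0, Rmult_1_r in HE.
  replace (exp (- (s * ln (1 - u)))) with (PSeries a u).
  - apply is_pseries_R, PSeries_correct, CV_radius_inside, Hin. lra.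
  - rewrite exp_Ropp. pose proof (exp_pos (s * ln (1 - u))).
    apply Rmult_eq_reg_r with (exp (s * ln (1 - u))); [|lra].
    rewrite <- HE. unfold a. simpl. field. lra.
Qed.

(** * The zeta function on its half-plane of convergence *)

Lemma is_Cseries_zeta_sub_1 (zeta : C -> C) (s : C) : is_riemann_zeta zeta -> 1 < Re s ->
  is_Cseries (fun n => Cexp (- s * RtoC (ln (INR (n + 2))))%C) (zeta s - 1)%C.
Proof.
  intros [Hz _] Hs.
  apply is_series_ext with (fun n => Cexp (- s * RtoC (ln (INR (S n + 1))))%C).
  { intros n. do 4 f_equal. f_equal. lia. }
  apply (is_series_incr_1 (V := C_NormedModule)
           (fun n => Cexp (- s * RtoC (ln (INR (n + 1))))%C)).
  replace (plus _ _) with (zeta s); [now apply Hz|].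
  simpl INR. rewrite ln_1, Cmult_0_r, Cexp_RtoC, exp_0.
  change (zeta s = zeta s - 1 + 1)%C. ring.
Qed.

Lemma zeta_sub_1_real (zeta : C -> C) (p : R) : is_riemann_zeta zeta -> 1 < p ->
  exists z, zeta (RtoC p) = RtoC (z + 1) /\
            is_series (fun n => exp (- (p * ln (INR (n + 2))))) z.
Proof.
  intros Hz Hp. pose proof (is_Cseries_zeta_sub_1 zeta (RtoC p) Hz Hp) as H.
  assert (E : forall n, Cexp (- RtoC p * RtoC (ln (INR (n + 2))))%C
                        = RtoC (exp (- (p * ln (INR (n + 2)))))).
  { intros n. rewrite <- Cexp_RtoC. f_equal.
    rewrite RtoC_opp, RtoC_mult. ring. }
  apply is_Cseries_components in H. destruct H as [H1 H2].
  exists (Re (zeta (RtoC p) - 1)%C). split.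
  - assert (HI : Im (zeta (RtoC p) - 1)%C = 0).
    { rewrite <- (is_series_unique _ _ H2).
      rewrite (Series_ext _ (fun _ => 0 * 0)); [now rewrite Series_scal_l, Rmult_0_l|].
      intros n. rewrite E. simpl. ring. }
    destruct (zeta (RtoC p)) as [u v]. simpl in HI |- *. unfold RtoC. f_equal; lra.
  - eapply is_series_ext; [|exact H1]. intros n. cbv beta. now rewrite E.
Qed.

(** * Landau's formula for real [s > 0] *)

(** The binomial expansions of [(n-1)^-s - n^-s] for [n >= 2], summed over [n] in
    both orders. *)
Lemma landau_real (zeta : C -> C) (s : R) : is_riemann_zeta zeta -> 0 < s ->
  is_series (fun j => rising (S j) s * (Re (zeta (RtoC (s + INR (S j)))) - 1)) 1.
Proof.
  intros Hz Hs.
  set (U := fun k => exp (- (s * ln (INR (k + 1))))).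
  assert (HU : is_lim_seq U 0).
  { unfold U. apply (is_lim_comp_seq exp _ m_infty 0).
    - apply is_lim_exp_m.
    - exists 0%nat. intros n _. discriminate.
    - apply (is_lim_seq_opp _ p_infty).
      replace p_infty with (Rbar_mult s p_infty).
      2:{ simpl. destruct (Rle_dec 0 s) as [Hle|Hle]; [|lra].
          destruct (Rle_lt_or_eq_dec 0 s Hle); [reflexivity | lra]. }
      apply is_lim_seq_scal_l. apply (is_lim_comp_seq ln _ p_infty p_infty).
      + apply is_lim_ln_p.
      + exists 0%nat. intros n _. discriminate.
      + apply (is_lim_seq_incr_n INR 1), is_lim_seq_INR. }
  set (a := fun k j => rising (S j) s * exp (- ((s + INR (S j)) * ln (INR (k + 2))))).
  assert (Hrow : forall k, is_series (a k) (U k - U (S k))).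
  { intros k. set (n := INR (k + 2)).
    assert (Hn : 2 <= n) by (unfold n; rewrite plus_INR; pose proof (pos_INR k); simpl; lra).
    assert (Hu : 0 < / n <= / 2) by
      (split; [apply Rinv_0_lt_compat; lra | apply Rinv_le_contravar; lra]).
    pose proof (is_series_binomial s (/ n) Hs ltac:(lra)) as Hb.
    assert (Hb1 : is_series (fun j => rising (S j) s * (/ n) ^ S j)
                    (exp (- (s * ln (1 - / n))) - 1)).
    { apply (is_series_incr_1 (V := R_NormedModule) (fun j => rising j s * (/ n) ^ j)).
      replace (plus _ _) with (exp (- (s * ln (1 - / n)))); [exact Hb|].
      change (exp (- (s * ln (1 - / n))) = exp (- (s * ln (1 - / n))) - 1 + 1 * 1). ring. }
    pose proof (is_series_scal (V := R_NormedModule) (exp (- (s * ln n))) _ _ Hb1) as Hb2.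
    replace (U k - U (S k)) with (exp (- (s * ln n)) * (exp (- (s * ln (1 - / n))) - 1)).
    - eapply is_series_ext; [|exact Hb2]. intros j. unfold a. fold n.
      change (exp (- (s * ln n)) * (rising (S j) s * (/ n) ^ S j)
              = rising (S j) s * exp (- ((s + INR (S j)) * ln n))).
      replace ((/ n) ^ S j) with (exp (- (ln n * INR (S j)))).
      + replace (- ((s + INR (S j)) * ln n)) with (- (s * ln n) + - (ln n * INR (S j))) by ring.
        rewrite exp_plus. ring.
      + rewrite exp_mult_INR, exp_Ropp, exp_ln by lra. reflexivity.
    - unfold U. replace (INR (S k + 1)) with n by (unfold n; f_equal; lia).
      replace (INR (k + 1)) with (n * (1 - / n)).
      2:{ unfold n. rewrite !plus_INR. simpl. field. pose proof (pos_INR k). lra. }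
      rewrite ln_mult by lra.
      replace (- (s * (ln n + ln (1 - / n)))) with (- (s * ln n) + - (s * ln (1 - / n))) by ring.
      rewrite exp_plus. ring. }
  pose proof (is_series_telescope U HU) as Htel.
  replace (U 0%nat) with 1 in Htel.
  2:{ unfold U. simpl INR. now rewrite ln_1, Rmult_0_r, Ropp_0, exp_0. }
  destruct (series_swap_pos a (fun k => U k - U (S k)) 1) as [_ H].
  - intros k j. left. apply Rmult_lt_0_compat; [now apply rising_pos | apply exp_pos].
  - exact Hrow.
  - exact Htel.
  - eapply is_series_ext; [|exact H]. intros j. cbv beta. unfold a.
    rewrite Series_scal_l. f_equal.
    destruct (zeta_sub_1_real zeta (s + INR (S j)) Hz) as (z & Ez & Hsz).
    { rewrite S_INR. pose proof (pos_INR j). lra. }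
    rewrite Ez, (is_series_unique _ _ Hsz). simpl Re. ring.
Qed.

(** * Landau's series as an analytic function *)

Fixpoint Crising (j : nat) (s : C) : C :=
  match j with
  | O => 1
  | S j => RtoC (/ INR (S j)) * ((RtoC (INR j) + s) * Crising j s)
  end%C.

Lemma Crising_RtoC (j : nat) (s : R) : Crising j (RtoC s) = RtoC (rising j s).
Proof.
  induction j as [|j IH]; [reflexivity|].
  cbn [Crising rising]. now rewrite IH, !RtoC_mult, RtoC_plus.
Qed.

Definition landau_term (zeta : C -> C) (j : nat) (s : C) : C :=
  (Crising j s * (zeta (s + RtoC (INR j)) - 1))%C.

Definition landau_tail (zeta : C -> C) (J : nat) (s : C) : C :=
  CSeries (fun i => landau_term zeta (J + i) s).

Lemma majorized_le (f : C -> C) (z0 : C) (rho K K' : R) :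
  K <= K' -> majorized f z0 rho K -> majorized f z0 rho K'.
Proof.
  intros HK (a & H & Ha). exists a. split; [|exact Ha]. intros N. specialize (H N). lra.
Qed.

(** The series of [zeta(s) - 1] starts at [2^-s], so each further unit of shift
    gains a factor [1/2]. *)
Lemma majorized_zeta_sub_1 (zeta : C -> C) (z0 : C) (rho : R) (J : nat) :
  is_riemann_zeta zeta -> 0 < rho -> 1 < Re z0 + INR J - rho ->
  exists M, 0 <= M /\ forall i,
    majorized (fun s => zeta (s + RtoC (INR (J + i))) - 1)%C z0 rho (M * (/ 2) ^ i).
Proof.
  intros Hz Hrho Hp. set (p := Re z0 + INR J - rho) in *.
  destruct (zeta_sub_1_real zeta p Hz Hp) as (M & _ & HM).
  assert (Hln : forall n, ln 2 <= ln (INR (n + 2))).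
  { intros n. apply ln_le; [lra|]. rewrite plus_INR. pose proof (pos_INR n). simpl. lra. }
  assert (Hln2 : 0 < ln 2) by (rewrite <- ln_1; apply ln_increasing; lra).
  exists M. split.
  { rewrite <- (is_series_unique _ _ HM). eapply Rle_trans; [|apply (sum_n_le_Series _ 0)].
    - rewrite sum_O. left. apply exp_pos.
    - intros n. left. apply exp_pos.
    - eexists; exact HM. }
  intros i.
  set (K := fun n => exp (- (Re z0 + INR (J + i) - rho) * ln (INR (n + 2)))).
  assert (HK : forall n, 0 <= K n <= (/ 2) ^ i * exp (- (p * ln (INR (n + 2))))).
  { intros n. unfold K. split; [left; apply exp_pos|].
    replace ((/ 2) ^ i) with (exp (- (ln 2 * INR i))).
    - rewrite <- exp_plus. apply exp_le. rewrite plus_INR. unfold p.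
      pose proof (Hln n). pose proof (pos_INR i). nra.
    - rewrite exp_mult_INR, exp_Ropp, exp_ln by lra. reflexivity. }
  assert (Hsc : is_series (fun n => (/ 2) ^ i * exp (- (p * ln (INR (n + 2))))) ((/ 2) ^ i * M)).
  { apply (is_series_scal (V := R_NormedModule)), HM. }
  assert (Hex : ex_series K).
  { apply (ex_series_le (V := R_CompleteNormedModule) _
             (fun n => (/ 2) ^ i * exp (- (p * ln (INR (n + 2)))))); [|eexists; exact Hsc].
    intros n. change (norm (K n)) with (Rabs (K n)). rewrite Rabs_pos_eq; apply HK. }
  apply majorized_le with (Series K).
  - rewrite Rmult_comm, <- (is_series_unique _ _ Hsc).
    apply Series_le; [exact HK | eexists; exact Hsc].
  - apply (majorized_series (fun n s => Cexp (- (s + RtoC (INR (J + i))) * RtoC (ln (INR (n + 2))))%C));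
      [exact Hrho | | exact Hex |].
    + intros n. apply (majorized_Cexp (RtoC (INR (J + i)))); [|exact Hrho].
      pose proof (Hln n). lra.
    + intros s Hs. apply is_Cseries_zeta_sub_1; [exact Hz|].
      assert (Hre : Rabs (Re (s - z0)%C) < rho).
      { eapply Rle_lt_trans; [apply re_le_Cmod | exact Hs]. }
      replace (Re (s - z0)%C) with (Re s - Re z0) in Hre by (unfold Re; simpl; ring).
      apply Rabs_def2 in Hre.
      change (1 < Re s + INR (J + i)). rewrite plus_INR. unfold p in Hp.
      pose proof (pos_INR i). lra.
Qed.

(** One factor [j + s] at a time. On the disc it is at most [j + |z0| + rho], so
    the bounds multiply to the real rising factorial at [|z0| + rho]. *)
Lemma majorized_Crising (f : C -> C) (z0 : C) (rho K : R) (j : nat) : 0 < rho ->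
  majorized f z0 rho K ->
  majorized (fun s => Crising j s * f s)%C z0 rho (rising j (Cmod z0 + rho) * K).
Proof.
  intros Hrho Hf. pose proof (majorized_nonneg _ _ _ _ Hrho Hf) as HK.
  pose proof (Cmod_ge_0 z0) as Hz0.
  induction j as [|j IH].
  - simpl. rewrite Rmult_1_l. refine (majorized_ext _ _ _ _ _ _ Hf). intros z. ring.
  - pose proof (majorized_scal _ (RtoC (/ INR (S j))) _ _ _
                  (majorized_affine _ (RtoC (INR j)) _ _ _ Hrho IH)) as H.
    refine (majorized_le _ _ _ _ _ _ (majorized_ext _ _ _ _ _ _ H)).
    + assert (Hi : 0 < / INR (S j)) by (apply Rinv_0_lt_compat, lt_0_INR; lia).
      rewrite Cmod_R, Rabs_pos_eq by lra. cbn [rising]. rewrite Rmult_assoc.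
      apply Rmult_le_compat_l; [lra|]. rewrite Rmult_assoc. apply Rmult_le_compat_r.
      * apply Rmult_le_pos; [left; apply rising_pos; lra | exact HK].
      * pose proof (Cmod_triangle (RtoC (INR j)) z0) as Ht.
        rewrite Cmod_R, Rabs_pos_eq in Ht by apply pos_INR. lra.
    + intros z. cbn [Crising]. ring.
Qed.

Lemma ex_series_rising (J : nat) (A : R) : 0 < A ->
  ex_series (fun i => rising (J + i) A * (/ 2) ^ i).
Proof.
  intros HA.
  assert (Hpos : forall i, 0 < rising (J + i) A * (/ 2) ^ i).
  { intros i. apply Rmult_lt_0_compat; [now apply rising_pos | apply pow_lt; lra]. }
  apply ex_series_ext with (fun i => Rabs (rising (J + i) A * (/ 2) ^ i)).
  { intros i. apply Rabs_pos_eq. left. apply Hpos. }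
  apply ex_series_DAlembert with (/ 2); [lra | |].
  - intros i. specialize (Hpos i). lra.
  - replace (Finite (/ 2)) with (Finite (1 * / 2)) by (f_equal; ring).
    eapply is_lim_seq_ext;
      [|apply (is_lim_seq_mult' _ _ 1 (/ 2) (rising_ratio_limit J A) (is_lim_seq_const (/ 2)))].
    intros i. cbv beta.
    rewrite Rabs_pos_eq by (left; apply Rdiv_lt_0_compat; apply Hpos).
    replace (J + S i)%nat with (S (J + i)) by lia. cbn [rising]. simpl pow.
    pose proof (rising_pos (J + i) A HA). assert (0 < (/ 2) ^ i) by (apply pow_lt; lra).
    field. repeat split; try lra; apply not_0_INR; lia.
Qed.

Lemma landau_tail_majorized (zeta : C -> C) (z0 : C) (rho : R) (J : nat) :
  is_riemann_zeta zeta -> 0 < rho -> 1 < Re z0 + INR J - rho ->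
  (exists K, majorized (landau_tail zeta J) z0 rho K) /\
  ex_Cseries (fun i => landau_term zeta (J + i) z0).
Proof.
  intros Hz Hrho Hp.
  destruct (majorized_zeta_sub_1 zeta z0 rho J Hz Hrho Hp) as (M & HM & Hmaj).
  set (A := Cmod z0 + rho). assert (HA : 0 < A) by (unfold A; pose proof (Cmod_ge_0 z0); lra).
  set (K := fun i => rising (J + i) A * (M * (/ 2) ^ i)).
  assert (HK : ex_series K).
  { apply ex_series_ext with (fun i => M * (rising (J + i) A * (/ 2) ^ i)).
    - intros i. unfold K. as_R_eq. ring.
    - now apply ex_series_Rmult_l, ex_series_rising. }
  assert (Hterm : forall i, majorized (landau_term zeta (J + i)) z0 rho (K i)).
  { intros i. apply (majorized_Crising _ _ _ _ (J + i) Hrho (Hmaj i)). }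
  assert (Hex : forall z, Cmod (z - z0) < rho -> ex_Cseries (fun i => landau_term zeta (J + i) z)).
  { intros z Hzz. apply (ex_Cseries_le _ K); [|exact HK].
    intros i. now apply (majorized_bound _ _ _ _ z (Hterm i)). }
  split.
  - exists (Series K). apply (majorized_series (fun i => landau_term zeta (J + i)) _ z0 rho K);
      [exact Hrho | exact Hterm | exact HK |].
    intros z Hzz. apply CSeries_correct. now apply Hex.
  - apply Hex. replace (z0 - z0)%C with (RtoC 0) by ring. rewrite Cmod_0. exact Hrho.
Qed.

Lemma ex_landau_tail (zeta : C -> C) (J : nat) (z : C) : is_riemann_zeta zeta ->
  ex_Cseries (fun i => landau_term zeta (J + i) z).
Proof.
  intros Hz. destruct (INR_unbounded (2 - Re z)) as [n Hn].
  destruct n as [|n].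
  - destruct (landau_tail_majorized zeta z (1 / 2) J Hz) as [_ H]; [lra | | exact H].
    pose proof (pos_INR J). simpl in Hn. lra.
  - apply (ex_series_incr_n (V := C_NormedModule) _ (S n)).
    destruct (landau_tail_majorized zeta z (1 / 2) (J + S n) Hz) as [_ H]; [lra | |].
    + rewrite plus_INR. pose proof (pos_INR J). lra.
    + eapply ex_series_ext; [|exact H]. intros i. cbv beta. now rewrite Nat.add_assoc.
Qed.

Lemma landau_tail_split (zeta : C -> C) (J : nat) (z : C) : is_riemann_zeta zeta ->
  landau_tail zeta J z = (landau_term zeta J z + landau_tail zeta (S J) z)%C.
Proof.
  intros Hz. unfold landau_tail. rewrite CSeries_first by now apply ex_landau_tail.
  rewrite Nat.add_0_r. f_equal. apply CSeries_ext. intros i. now rewrite Nat.add_succ_r.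
Qed.

Lemma analytic_Crising (f : C -> C) (z0 : C) (j : nat) :
  analytic_at f z0 -> analytic_at (fun s => Crising j s * f s)%C z0.
Proof.
  intros Hf. induction j as [|j IH].
  - refine (analytic_ext_loc _ _ _ _ Hf). apply filter_forall. intros z. simpl. ring.
  - refine (analytic_ext_loc _ _ _ _ (analytic_scal _ (RtoC (/ INR (S j))) _
              (analytic_affine _ (RtoC (INR j)) _ IH))).
    apply filter_forall. intros z. cbn [Crising]. ring.
Qed.

Lemma analytic_landau_term (zeta : C -> C) (j : nat) (z0 : C) : is_riemann_zeta zeta ->
  (z0 + RtoC (INR j))%C <> 1 -> analytic_at (landau_term zeta j) z0.
Proof.
  intros [_ Hz] Hj. apply (analytic_Crising (fun s => zeta (s + RtoC (INR j)) - 1)%C).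
  apply (analytic_plus (fun s => zeta (s + RtoC (INR j))%C)); [|apply analytic_const].
  apply analytic_shift. now apply Hz.
Qed.

(** Far enough in the series the tail is majorized, and finitely many terms are
    split off. *)
Lemma analytic_landau_tail (zeta : C -> C) (J : nat) (z0 : C) : is_riemann_zeta zeta ->
  (forall j, (J <= j)%nat -> (z0 + RtoC (INR j))%C <> 1) -> analytic_at (landau_tail zeta J) z0.
Proof.
  intros Hz HJ. destruct (INR_unbounded (2 - Re z0)) as [n Hn].
  assert (H : forall d J, (n <= J + d)%nat -> (forall j, (J <= j)%nat -> (z0 + RtoC (INR j))%C <> 1) ->
            analytic_at (landau_tail zeta J) z0).
  { clear J HJ. induction d as [|d IH]; intros J Hd HJ.
    - destruct (landau_tail_majorized zeta z0 (1 / 2) J Hz) as [[K HK] _]; [lra | |].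
      + rewrite Nat.add_0_r in Hd. apply le_INR in Hd. lra.
      + apply (majorized_analytic _ _ (1 / 2) K); [lra | exact HK].
    - apply (analytic_ext_loc (fun z => landau_term zeta J z + landau_tail zeta (S J) z)%C).
      + apply filter_forall. intros z. symmetry. now apply landau_tail_split.
      + apply analytic_plus.
        * apply analytic_landau_term; [exact Hz | now apply HJ].
        * apply IH; [lia|]. intros j Hj. apply HJ. lia. }
  apply (H n); [lia | exact HJ].
Qed.

Lemma landau_tail_real (zeta : C -> C) (s : R) : is_riemann_zeta zeta -> 0 < s ->
  landau_tail zeta 1 (RtoC s) = 1.
Proof.
  intros Hz Hs. apply CSeries_unique.
  assert (E : forall j, landau_term zeta (1 + j) (RtoC s) =
            RtoC (rising (S j) s * (Re (zeta (RtoC (s + INR (S j)))) - 1))).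
  { intros j. unfold landau_term. change (1 + j)%nat with (S j). rewrite Crising_RtoC, <- RtoC_plus.
    destruct (zeta_sub_1_real zeta (s + INR (S j)) Hz) as (z & Ez & _).
    { rewrite S_INR. pose proof (pos_INR j). lra. }
    rewrite Ez, <- RtoC_minus, <- RtoC_mult. do 2 f_equal. }
  apply is_Cseries_components. split.
  - eapply is_series_ext; [|apply (landau_real zeta s Hz Hs)]. intros j. now rewrite E.
  - apply is_series_ext with (fun _ => 0); [intros j; now rewrite E|].
    exact (is_series_zero (V := R_NormedModule)).
Qed.

(** * Continuation to the non-positive integers *)

Lemma C_shift_neq_1 (u v : R) (j : nat) : v <> 0 \/ u + INR j <> 1 -> ((u, v) + RtoC (INR j))%C <> 1.
Proof.
  intros H E. injection E as E1 E2. rewrite Rplus_0_r in E2. destruct H; contradiction.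
Qed.

(** The terms are singular only at non-positive integers, so the identity
    theorem carries the formula from the positive reals to the other real points
    through the imaginary unit. *)
Lemma landau_continued (zeta : C -> C) (s : R) : is_riemann_zeta zeta ->
  (forall j : nat, s + INR j <> 1) -> landau_tail zeta 1 (RtoC s) = 1.
Proof.
  intros Hz Hs.
  set (h := fun z => (landau_tail zeta 1 z + - (1))%C).
  assert (Han : forall z, (forall j, (1 <= j)%nat -> (z + RtoC (INR j))%C <> 1) -> analytic_at h z).
  { intros z Hj. apply analytic_plus; [|apply analytic_const].
    now apply analytic_landau_tail. }
  assert (H1 : locally_zero h (RtoC 1)).
  { apply (locally_zero_of_ray h (RtoC 1) (RtoC 1) 1); [| | lra |].
    - apply Han. intros j Hj. apply C_shift_neq_1. right.
      apply (le_INR 1) in Hj. simpl in Hj. lra.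
    - intros E. injection E as E. lra.
    - intros t Ht. unfold h. rewrite Cmult_1_r, <- RtoC_plus.
      rewrite landau_tail_real by (exact Hz || lra). ring. }
  assert (H2 : locally_zero h (RtoC 1 + (-1, 1))%C).
  { apply locally_zero_segment; [| |exact H1].
    - intros E. injection E as E1 E2. lra.
    - intros t Ht. replace (RtoC 1 + RtoC t * (-1, 1))%C with (1 - t, t)
        by (apply injective_projections; simpl; ring).
      apply Han. intros j Hj. apply C_shift_neq_1.
      destruct (Req_dec t 0) as [->|Ht0]; [right | now left].
      apply (le_INR 1) in Hj. simpl in Hj. lra. }
  replace (RtoC 1 + (-1, 1))%C with (0, 1) in H2 by (apply injective_projections; simpl; ring).
  assert (H3 : locally_zero h ((0, 1) + (s, -1))%C).
  { apply locally_zero_segment; [| |exact H2].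
    - intros E. injection E as E1 E2. lra.
    - intros t Ht. replace ((0, 1) + RtoC t * (s, -1))%C with (t * s, 1 - t)
        by (apply injective_projections; simpl; ring).
      apply Han. intros j _. apply C_shift_neq_1.
      destruct (Req_dec t 1) as [->|Ht1]; [right; rewrite Rmult_1_l; apply Hs | left; lra]. }
  replace ((0, 1) + (s, -1))%C with (RtoC s) in H3 by (apply injective_projections; simpl; ring).
  apply (locally_singleton (T := C_UniformSpace) _ (fun z => h z = 0)) in H3.
  unfold h in H3. replace (landau_tail zeta 1 (RtoC s)) with
    (landau_tail zeta 1 (RtoC s) + - (1) + 1)%C by ring.
  rewrite H3. ring.
Qed.

Definition landau_sum (zeta : C -> C) (m : nat) (s : C) : C :=
  sum_n_m (G := C_AbelianMonoid) (fun j => landau_term zeta j s) 1 m.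

Lemma landau_sum_tail (zeta : C -> C) (m : nat) (s : C) : is_riemann_zeta zeta ->
  landau_tail zeta 1 s = (landau_sum zeta m s + landau_tail zeta (S m) s)%C.
Proof.
  intros Hz. unfold landau_sum. induction m as [|m IH].
  - rewrite sum_n_m_zero by lia. change (@zero C_AbelianMonoid) with (RtoC 0). ring.
  - rewrite IH, sum_n_Sm by lia. rewrite (landau_tail_split zeta (S m)) by exact Hz.
    change (@plus C_AbelianMonoid) with Cplus. ring.
Qed.

Lemma analytic_landau_sum (zeta : C -> C) (m : nat) (z0 : C) : is_riemann_zeta zeta ->
  (forall j, (1 <= j <= m)%nat -> (z0 + RtoC (INR j))%C <> 1) -> analytic_at (landau_sum zeta m) z0.
Proof.
  intros Hz. unfold landau_sum. induction m as [|m IH]; intros Hj.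
  - apply (analytic_ext_loc (fun _ => 0%C)); [|apply analytic_const].
    apply filter_forall. intros z. now rewrite sum_n_m_zero by lia.
  - apply (analytic_ext_loc (fun z =>
      sum_n_m (G := C_AbelianMonoid) (fun j => landau_term zeta j z) 1 m
      + landau_term zeta (S m) z)%C).
    + apply filter_forall. intros z. now rewrite sum_n_Sm by lia.
    + apply analytic_plus.
      * apply IH. intros j Hjm. apply Hj. lia.
      * apply analytic_landau_term; [exact Hz|]. apply Hj. lia.
Qed.

Lemma rising_neg (m j : nat) : (m < j)%nat -> rising j (- INR m) = 0.
Proof.
  induction j as [|j IH]; [lia|]. intros Hj. cbn [rising].
  destruct (Nat.eq_dec m j) as [->|Hn].
  - replace (INR j + - INR j) with 0 by ring. ring.
  - rewrite IH by lia. ring.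
Qed.

Lemma landau_tail_neg (zeta : C -> C) (m J : nat) : (m < J)%nat ->
  landau_tail zeta J (RtoC (- INR m)) = 0.
Proof.
  intros HJ. apply CSeries_unique. apply (is_series_ext (V := C_NormedModule) (fun _ => RtoC 0)).
  - intros i. unfold landau_term. rewrite Crising_RtoC, rising_neg by lia.
    change (RtoC 0 = RtoC 0 * (zeta (RtoC (- INR m) + RtoC (INR (J + i))) - 1))%C. ring.
  - exact (is_series_zero (V := C_NormedModule)).
Qed.

Lemma INR_diff_neq_1 (m j : nat) (t : R) : 0 <= t < 1 -> (j = S m -> t <> 0) ->
  - INR m + t + INR j <> 1.
Proof.
  intros Ht Hj E. destruct (le_lt_dec j m) as [H|H].
  - apply le_INR in H. lra.
  - destruct (Nat.eq_dec j (S m)) as [Ej|Ej].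
    + rewrite Ej, S_INR in E. apply (Hj Ej). lra.
    + assert (H' : (S (S m) <= j)%nat) by lia. apply le_INR in H'. rewrite !S_INR in H'. lra.
Qed.

(** At [s = -m] the term with [j = m + 1] meets the pole of [zeta (s + j)].
    Landau's formula at [s + m] expresses the product of [s + m] and
    [zeta(s+m+1) - 1] by an analytic tail, so that no limit of a product is
    needed. *)
Lemma landau_at_neg (zeta : C -> C) (m : nat) : is_riemann_zeta zeta ->
  landau_sum zeta m (RtoC (- INR m)) = RtoC (1 - / INR (S m) * rising m (- INR m)).
Proof.
  intros Hz. set (z0 := RtoC (- INR m)).
  set (D := fun z => (landau_sum zeta m z + landau_tail zeta (S (S m)) z
                      + RtoC (/ INR (S m)) * (Crising m z * (1 + -1 * landau_tail zeta 2 (z + RtoC (INR m))))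
                      + - (1))%C).
  assert (Hpt : forall j t, (z0 + RtoC t + RtoC (INR j))%C = RtoC (- INR m + t + INR j)).
  { intros j t. unfold z0. now rewrite !RtoC_plus. }
  assert (Hz0 : forall j, j <> S m -> (z0 + RtoC (INR j))%C <> 1).
  { intros j Hj E. apply (INR_diff_neq_1 m j 0); [lra | contradiction |].
    apply RtoC_inj. rewrite <- E, <- Hpt. ring. }
  assert (HD : analytic_at D z0).
  { unfold D.
    apply (analytic_plus (fun z => landau_sum zeta m z + landau_tail zeta (S (S m)) z
      + RtoC (/ INR (S m)) * (Crising m z * (1 + -1 * landau_tail zeta 2 (z + RtoC (INR m)))))%C
      (fun _ => (- (1))%C)); [|apply analytic_const].
    apply (analytic_plus (fun z => landau_sum zeta m z + landau_tail zeta (S (S m)) z)%C).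
    1: apply (analytic_plus (landau_sum zeta m) (landau_tail zeta (S (S m)))).
    - apply analytic_landau_sum; [exact Hz|]. intros j Hj. apply Hz0. lia.
    - apply analytic_landau_tail; [exact Hz|]. intros j Hj. apply Hz0. lia.
    - apply (analytic_scal (fun z => Crising m z * (1 + -1 * landau_tail zeta 2 (z + RtoC (INR m))))%C).
      apply (analytic_Crising (fun z => 1 + -1 * landau_tail zeta 2 (z + RtoC (INR m)))%C).
      apply (analytic_plus (fun _ => 1%C)); [apply analytic_const|].
      apply (analytic_scal (fun z => landau_tail zeta 2 (z + RtoC (INR m)))%C).
      apply analytic_shift, analytic_landau_tail; [exact Hz|].
      intros j Hj E. unfold z0 in E. rewrite <- !RtoC_plus in E. apply RtoC_inj in E.
      apply le_INR in Hj. simpl in Hj. lra. }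
  assert (Hzero : forall t, 0 < t < 1 -> D (z0 + RtoC t)%C = 0).
  { intros t Ht. set (z := (z0 + RtoC t)%C).
    assert (Ez : z = RtoC (- INR m + t)) by (unfold z, z0; now rewrite RtoC_plus).
    assert (L1 : landau_tail zeta 1 z = 1).
    { rewrite Ez. apply landau_continued; [exact Hz|]. intros j.
      apply INR_diff_neq_1; lra. }
    rewrite (landau_sum_tail zeta m) in L1 by exact Hz.
    rewrite landau_tail_split in L1 by exact Hz.
    assert (Ezm : (z + RtoC (INR m))%C = RtoC t).
    { rewrite Ez, <- RtoC_plus. f_equal. ring. }
    pose proof (landau_tail_real zeta t Hz ltac:(lra)) as L2.
    rewrite landau_tail_split in L2 by exact Hz.
    assert (E1 : landau_term zeta 1 (RtoC t) = (RtoC t * (zeta (RtoC (t + 1)) - 1))%C).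
    { unfold landau_term. rewrite Crising_RtoC, <- RtoC_plus. f_equal.
      f_equal. simpl. field. }
    assert (E2 : landau_term zeta (S m) z =
        (RtoC (/ INR (S m)) * (Crising m z * (RtoC t * (zeta (RtoC (t + 1)) - 1))))%C).
    { unfold landau_term. cbn [Crising]. rewrite (Cplus_comm (RtoC (INR m)) z), Ezm.
      replace (z + RtoC (INR (S m)))%C with (RtoC (t + 1)).
      - ring.
      - rewrite (S_INR m), !RtoC_plus, Cplus_assoc, Ezm. reflexivity. }
    rewrite E2 in L1. rewrite E1 in L2.
    unfold D. rewrite Ezm. set (tz := (RtoC t * (zeta (RtoC (t + 1)) - 1))%C) in *.
    set (T2 := landau_tail zeta 2 (RtoC t)) in *.
    replace (1 + -1 * T2)%C with tz by (rewrite <- L2; ring).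
    replace (RtoC 0) with (1 + - (1))%C by ring. rewrite <- L1 at 1. ring. }
  assert (HD0 : D z0 = 0).
  { apply (locally_singleton (T := C_UniformSpace) _ (fun z => D z = 0)).
    apply (locally_zero_of_ray D z0 1 1 HD); [|lra|].
    - intros E. injection E as E. lra.
    - intros t Ht. rewrite Cmult_1_r. now apply Hzero. }
  unfold D in HD0. unfold z0 in HD0.
  rewrite landau_tail_neg in HD0 by lia.
  replace (RtoC (- INR m) + RtoC (INR m))%C with (RtoC (- INR 0)) in HD0.
  2:{ rewrite <- RtoC_plus. f_equal. simpl. ring. }
  rewrite landau_tail_neg in HD0 by lia. rewrite Crising_RtoC in HD0.
  fold z0 in HD0. rewrite RtoC_minus, RtoC_mult.
  set (L := landau_sum zeta m z0) in *.
  set (X := RtoC (/ INR (S m))) in *. set (Y := RtoC (rising m (- INR m))) in *.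
  replace L with ((L + 0 + X * (Y * (1 + -1 * 0)) + - (1)) + (1 - X * Y))%C by ring.
  rewrite HD0. ring.
Qed.

(** * The values at the non-positive integers *)

Lemma sum_n_rev (n : nat) : forall f : nat -> R, sum_n f n = sum_n (fun k => f (n - k)%nat) n.
Proof.
  induction n as [|n IH]; intros f; [now rewrite !sum_O|].
  rewrite sum_n_first, sum_Sn, (IH (fun j => f (S j))), Nat.sub_diag.
  as_Rplus. rewrite Rplus_comm. f_equal.
  apply sum_n_ext_loc. intros k Hk. f_equal. lia.
Qed.

Lemma sum_rising (s : R) (n : nat) : sum_n (fun j => rising j s) n = rising n (s + 1).
Proof.
  induction n as [|n IH]; [now rewrite sum_O|].
  rewrite sum_Sn, IH. as_Rplus.
  assert (E : forall k, s * rising k (s + 1) = INR (S k) * rising (S k) s).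
  { induction k as [|k IHk].
    - simpl. field.
    - cbn [rising] in *. replace (INR (S (S k))) with (INR (S k) + 1) by (symmetry; apply S_INR).
      assert (Hk : INR (S k) <> 0) by (apply not_0_INR; lia).
      assert (Hk' : INR (S k) + 1 <> 0) by (pose proof (pos_INR (S k)); lra).
      transitivity (/ INR (S k) * (INR k + s + 1) * (s * rising k (s + 1))); [ring|].
      rewrite IHk. replace (INR k) with (INR (S k) - 1) by (rewrite S_INR; ring).
      field. repeat split; assumption. }
  cbn [rising]. assert (Hn : INR (S n) <> 0) by (apply not_0_INR; lia).
  specialize (E n). cbn [rising] in E.
  replace ((INR n + s) * rising n s) with (s * rising n (s + 1)).
  - as_R_eq. rewrite S_INR in *. field. exact Hn.
  - rewrite E. field. exact Hn.
Qed.

Lemma rising_neg_le (m j : nat) : (j <= m)%nat ->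
  rising j (- INR m) = (-1) ^ j * INR (fact m) / (INR (fact j) * INR (fact (m - j))).
Proof.
  induction j as [|j IH]; intros Hj.
  - rewrite Nat.sub_0_r. simpl. field. apply INR_fact_neq_0.
  - cbn [rising]. rewrite IH by lia. replace (m - j)%nat with (S (m - S j)) by lia.
    rewrite !fact_simpl, !mult_INR. replace (S (m - S j)) with (m - j)%nat by lia.
    rewrite minus_INR by lia. simpl pow.
    assert (H1 : INR m - INR j <> 0) by (apply lt_INR in Hj; lra).
    pose proof (INR_fact_neq_0 j). pose proof (INR_fact_neq_0 (m - S j)).
    assert (H2 : INR (S j) <> 0) by (apply not_0_INR; lia).
    field. repeat split; assumption.
Qed.

(** [(-1)^i B_(i+1) / (i+1)], since [bern] contains the factor [1 / (i+1)!]. *)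
Definition zeta_neg (B : nat -> R -> R) (i : nat) : R :=
  (-1) ^ i * bern B 0 (S i) * INR (fact i).

(** The relations of [landau_at_neg], which after reversing the sum are the
    recurrence of the Bernoulli numbers. *)
Lemma zeta_neg_recurrence (B : nat -> R -> R) (M : nat) : is_bernoulli_polynomials B ->
  sum_n (fun i => rising (S i) (- INR (S M)) * (zeta_neg B (M - i) - 1)) M
  = 1 - / INR (S (S M)) * rising (S M) (- INR (S M)).
Proof.
  intros HB. set (m := S M).
  assert (H1 : sum_n (fun i => rising (S i) (- INR m)) M = -1).
  { pose proof (sum_rising (- INR m) m) as H. unfold m in H at 2. rewrite sum_n_first in H.
    replace (- INR m + 1) with (- INR M) in H by (unfold m; rewrite S_INR; ring).
    rewrite (rising_neg M m) in H by (unfold m; lia). change (rising 0 (- INR m)) with 1 in H. lra. }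
  assert (H2 : sum_n (fun i => rising (S i) (- INR m) * zeta_neg B (M - i)) M
               = (-1) ^ m * INR (fact m) * - / INR (fact (S m))).
  { pose proof (bern_recurrence B HB m) as Hr. simpl Nat.eqb in Hr.
    unfold m in Hr at 2. rewrite sum_n_first, bern_0, Nat.sub_0_r in Hr by exact HB.
    replace (- / INR (fact (S m)))
      with (sum_n (fun j => bern B 0 (S j) / INR (fact (S (m - S j)))) M).
    2:{ change (sum_n (fun j => bern B 0 (S j) / INR (fact (S (m - S j)))) M) with
          (sum_n (fun k => bern B 0 (S k) / INR (fact (S (m - S k)))) M).
        unfold Rdiv in Hr at 1. lra. }
    rewrite sum_n_rev, <- sum_n_Rmult_l. apply sum_n_ext_loc. intros i Hi.
    replace (M - (M - i))%nat with i by lia. unfold zeta_neg, m.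
    rewrite rising_neg_le by lia.
    replace (S M - S (M - i))%nat with i by lia. replace (S M - S i)%nat with (M - i)%nat by lia.
    assert (Hp : (-1) ^ S M = (-1) ^ S (M - i) * (-1) ^ i).
    { rewrite <- pow_add. f_equal. lia. }
    rewrite Hp. as_R_eq. field. split; apply INR_fact_neq_0. }
  rewrite (sum_n_ext _ (fun i => rising (S i) (- INR m) * zeta_neg B (M - i)
                                 + -1 * rising (S i) (- INR m))) by (intros i; as_R_eq; ring).
  rewrite (sum_n_plus (fun i => rising (S i) (- INR m) * zeta_neg B (M - i))
             (fun i => -1 * rising (S i) (- INR m))).
  as_Rplus. rewrite sum_n_Rmult_l, H1, H2.
  rewrite (rising_neg_le m m) by lia. rewrite Nat.sub_diag, (fact_simpl m), mult_INR.
  simpl (fact 0). simpl (INR 1). fold m. as_R_eq. field.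
  split; [apply INR_fact_neq_0 | apply not_0_INR; lia].
Qed.

(** The relation of [landau_at_neg] with [m = i + 1] determines [zeta(-i)] from
    the preceding values, as its coefficient is [- m]. *)
Lemma zeta_neg_value (zeta : C -> C) (B : nat -> R -> R) :
  is_riemann_zeta zeta -> is_bernoulli_polynomials B ->
  forall i, zeta (RtoC (- INR i)) = RtoC (zeta_neg B i).
Proof.
  intros Hz HB i. induction i as [M IH] using (well_founded_induction lt_wf).
  pose proof (landau_at_neg zeta (S M) Hz) as HL.
  rewrite <- (zeta_neg_recurrence B M HB) in HL. unfold landau_sum in HL.
  rewrite <- sum_n_m_S in HL. fold (Csum_n (fun j => landau_term zeta (S j) (RtoC (- INR (S M)))) M) in HL.
  assert (Hterm : forall j, (j <= M)%nat -> landau_term zeta (S j) (RtoC (- INR (S M)))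
     = (RtoC (rising (S j) (- INR (S M))) * (zeta (RtoC (- INR (M - j))) - 1))%C).
  { intros j Hj. unfold landau_term. rewrite Crising_RtoC, <- RtoC_plus. do 4 f_equal.
    rewrite minus_INR by lia. rewrite !S_INR. ring. }
  assert (Hsum : forall n (f : nat -> C) (g : nat -> R), (forall j, (j <= n)%nat -> f j = RtoC (g j)) ->
            Csum_n f n = RtoC (sum_n g n)).
  { induction n as [|n IHn]; intros f g Hfg.
    - rewrite !sum_O. apply Hfg. lia.
    - rewrite !sum_Sn, (IHn f g) by (intros j Hj; apply Hfg; lia). rewrite Hfg by lia.
      change (@plus C_AbelianMonoid) with Cplus. as_Rplus.
      now rewrite RtoC_plus. }
  assert (Hr1 : rising 1 (- INR (S M)) <> 0).
  { cbn [rising]. pose proof (pos_INR M). change (INR 1) with 1. change (INR 0) with 0.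
    rewrite Rinv_1, S_INR. lra. }
  assert (Htail : forall j, (j < M)%nat -> landau_term zeta (S (S j)) (RtoC (- INR (S M)))
     = RtoC (rising (S (S j)) (- INR (S M)) * (zeta_neg B (M - S j) - 1))).
  { intros j Hj. rewrite Hterm by lia. rewrite IH by lia.
    now rewrite RtoC_mult, RtoC_minus. }
  assert (H0 : landau_term zeta 1 (RtoC (- INR (S M)))
               = RtoC (rising 1 (- INR (S M)) * (zeta_neg B M - 1))).
  { destruct M as [|M].
    - rewrite !sum_O in HL. exact HL.
    - rewrite sum_n_first in HL. unfold sum_n in HL at 1.
      rewrite sum_Sn_m, <- sum_n_m_S in HL by lia.
      fold (Csum_n (fun j => landau_term zeta (S (S j)) (RtoC (- INR (S (S M))))) M) in HL.
      rewrite (Hsum M _ (fun j => rising (S (S j)) (- INR (S (S M))) * (zeta_neg B (S M - S j) - 1)))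
        in HL by (intros j Hj; apply Htail; lia).
      rewrite RtoC_plus in HL. change (@plus C_AbelianMonoid) with Cplus in HL.
      set (X := RtoC (sum_n _ _)) in HL.
      replace (landau_term zeta 1 (RtoC (- INR (S (S M)))))
        with (landau_term zeta 1 (RtoC (- INR (S (S M)))) + X - X)%C by ring.
      rewrite HL. rewrite Nat.sub_0_r. ring. }
  rewrite (Hterm 0%nat), Nat.sub_0_r, RtoC_mult, RtoC_minus in H0 by lia.
  set (r := RtoC (rising 1 (- INR (S M)))) in *.
  assert (Hr : r <> 0) by (intros E; apply Hr1, RtoC_inj, E).
  replace (zeta (RtoC (- INR M))) with (r * (zeta (RtoC (- INR M)) - 1) / r + 1)%C by (field; exact Hr).
  rewrite H0. field. exact Hr.
Qed.

(** * The asymptotic expansions *)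

Lemma RtoC_sum_n_m (g : nat -> R) (f : nat -> C) (n m : nat) :
  (forall k, (n <= k <= m)%nat -> f k = RtoC (g k)) ->
  sum_n_m (G := C_AbelianMonoid) f n m = RtoC (sum_n_m g n m).
Proof.
  intros H. destruct (le_lt_dec n m) as [Hnm|Hnm].
  - induction Hnm as [|m Hnm IH].
    + rewrite !sum_n_n. apply H. lia.
    + rewrite !sum_n_Sm by lia. rewrite IH by (intros k Hk; apply H; lia).
      rewrite H by lia. symmetry. apply RtoC_plus.
  - now rewrite !sum_n_m_zero by lia.
Qed.

Lemma asymp_log_q_of_real (f g : R -> R) (c : nat -> R) (cC : nat -> C) :
  (forall k, (1 <= k)%nat -> cC k = RtoC (c k)) ->
  (forall N, exists M r, 0 < r /\ forall t, 0 < t <= r ->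
     Rabs (f (exp (- t)) - (g (exp (- t)) + sum_n_m (fun k => c k * (- t) ^ k) 1 N)) <= M * t ^ S N) ->
  asymp_log_q f g cC.
Proof.
  intros Hc H N. destruct (H N) as (M & r & Hr & HM). exists M.
  assert (Her := exp_neg_lt_1 r Hr).
  assert (Hd : 0 < 1 - exp (- r)) by lra.
  exists (mkposreal _ Hd). intros q Hq Hq1.
  apply Rabs_of_ball in Hq. simpl in Hq. apply Rabs_def2 in Hq.
  assert (Hq0 : 0 < q) by lra.
  set (t := - ln q).
  assert (Ht : 0 < t <= r).
  { unfold t. split.
    - assert (ln q < 0); [|lra]. rewrite <- ln_1. apply ln_increasing; lra.
    - assert (ln (exp (- r)) <= ln q) by (apply ln_le; lra). rewrite ln_exp in H0. lra. }
  assert (Eq : exp (- t) = q) by (unfold t; rewrite Ropp_involutive; now apply exp_ln).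
  specialize (HM t Ht). rewrite Eq in HM.
  rewrite (RtoC_sum_n_m (fun k => c k * (- t) ^ k)).
  - rewrite <- RtoC_plus, <- RtoC_minus, Cmod_R.
    replace (Rabs (ln q)) with t.
    + replace (N + 1)%nat with (S N) by lia. exact HM.
    + unfold t. rewrite Rabs_left; [reflexivity | unfold t in Ht; lra].
  - intros k Hk. rewrite Hc by lia. unfold t. now rewrite Ropp_involutive, RtoC_mult, RtoC_pow.
Qed.

Lemma zeta_one_sub (zeta : C -> C) (B : nat -> R -> R) (k : nat) :
  is_riemann_zeta zeta -> is_bernoulli_polynomials B -> (1 <= k)%nat ->
  zeta (RtoC (1 - INR k)) = RtoC (zeta_neg B (pred k)).
Proof.
  intros Hz HB Hk. destruct k as [|k]; [lia|].
  rewrite <- (zeta_neg_value zeta B Hz HB). do 2 f_equal. rewrite S_INR. simpl pred. ring.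
Qed.

Lemma zeta_neg_pow (B : nat -> R -> R) (k : nat) (t : R) : (1 <= k)%nat ->
  zeta_neg B (pred k) * (- t) ^ k = - (bern B 0 k * INR (fact (pred k)) * t ^ k).
Proof.
  intros Hk. destruct k as [|k]; [lia|]. unfold zeta_neg. simpl pred.
  replace (- t) with (-1 * t) by ring. rewrite Rpow_mult_distr.
  assert (E : (-1) ^ k * (-1) ^ k = 1).
  { rewrite <- Rpow_mult_distr. replace (-1 * -1) with 1 by ring. apply pow1. }
  transitivity (- ((-1) ^ k * (-1) ^ k * (bern B 0 (S k) * INR (fact k) * t ^ S k)));
    [simpl pow at 2; ring|].
  rewrite E. ring.
Qed.

Theorem theorem5p1 (zeta : C -> C) (hzeta : is_riemann_zeta zeta)
    (B : nat -> R -> R) (hB : is_bernoulli_polynomials B)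
    (x : R) (hx : 0 < x) :
  (forall q : R, 0 < q < 1 ->
     ex_series (q_digamma_term q x) /\
     is_derive (fun y => ln (q_Gamma q y)) x
       (- ln (1 - q) + ln q * Series (q_digamma_term q x))) /\
  asymp_log_q (fun q => q_digamma q x)
    (fun q => digamma x + ln (ln q / (q - 1)))
    (fun k => - (zeta (RtoC (1 - INR k)) / RtoC (INR (fact k))
                 * RtoC (B k x)))%C /\
  asymp_log_q (fun q => q_digamma q x)
    (fun q => digamma x)
    (fun k => zeta (RtoC (1 - INR k)) / RtoC (INR (fact k))
              * RtoC (1 - B k x))%C.
Proof.
  split; [|split].
  - intros q Hq. split.
    + eexists. now apply is_series_q_digamma_term.
    + now apply is_derive_ln_q_Gamma.
  - apply asymp_log_q_of_real with
      (c := fun k => - (zeta_neg B (pred k) / INR (fact k) * B k x)).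
    + intros k Hk. rewrite (zeta_one_sub zeta B k hzeta hB Hk).
      rewrite RtoC_opp, RtoC_mult, RtoC_div by apply INR_fact_neq_0. reflexivity.
    + intros N.
      destruct (q_digamma_expansion B x N hB hx) as [K HK].
      destruct (ln_gen_expansion B N hB) as (K' & r & Hr & HK').
      exists (K + K'), (Rmin 1 r). split; [apply Rmin_glb_lt; lra|]. intros t Ht.
      pose proof (Rmin_l 1 r). pose proof (Rmin_r 1 r).
      specialize (HK t ltac:(lra)). specialize (HK' t ltac:(lra)).
      rewrite ln_exp.
      replace (- t / (exp (- t) - 1)) with (t / (1 - exp (- t))).
      2:{ assert (He := exp_neg_lt_1 t ltac:(lra)). field. lra. }
      set (s := sum_n_m (fun k => bern B 0 k * INR (fact (pred k)) / INR (fact k) * t ^ k) 1 N) in *.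
      rewrite (sum_n_m_ext_loc _ (fun k => plus (expansion_coef B x k * t ^ k)
         (bern B 0 k * INR (fact (pred k)) / INR (fact k) * t ^ k))).
      * rewrite sum_n_m_plus. fold s. as_Rplus.
        set (e := sum_n_m _ 1 N) in *. rewrite Rmult_plus_distr_r.
        apply Rabs_le_between in HK. apply Rabs_le_between in HK'. apply Rabs_le. lra.
      * intros k Hk. as_Rplus. as_R_eq.
        transitivity (- (zeta_neg B (pred k) * (- t) ^ k * (B k x / INR (fact k))));
          [unfold Rdiv; ring|].
        rewrite zeta_neg_pow by lia. unfold expansion_coef, bern. field. apply INR_fact_neq_0.
  - apply asymp_log_q_of_real with
      (c := fun k => zeta_neg B (pred k) / INR (fact k) * (1 - B k x)).
    + intros k Hk. rewrite (zeta_one_sub zeta B k hzeta hB Hk).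
      rewrite RtoC_mult, RtoC_div by apply INR_fact_neq_0. reflexivity.
    + intros N. destruct (q_digamma_expansion B x N hB hx) as [K HK].
      exists K, 1. split; [lra|]. intros t Ht. specialize (HK t Ht).
      rewrite (sum_n_m_ext_loc _ (fun k => expansion_coef B x k * t ^ k)); [exact HK|].
      intros k Hk. as_R_eq.
      transitivity (zeta_neg B (pred k) * (- t) ^ k * ((1 - B k x) / INR (fact k)));
        [unfold Rdiv; ring|].
      rewrite zeta_neg_pow by lia. unfold expansion_coef, bern. field. apply INR_fact_neq_0.
Qed.
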